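(* Let $u,v,w$ be weights on $(0,\infty)$ and let $p,q\in(0,\infty]$. Assume that $u$ is such that $U$ is admissible and that the measure $w(t)\,dt$ is non-degenerate with respect to $U^q$. When $q<p<\infty$, set $r=\frac{pq}{p-q}$. Consider the inequality $$\|Sh\|_{q,w,(0,\infty)}\le c\,\|h\|_{p,v,(0,\infty)},\qquad h\in\mathcal M^+(0,\infty),\qquad( * )$$ where $c$ is a finite constant independent of $h$. (i) Let $p=1$, $1\le q<\infty$. Then $( * )$ holds for every $h\in\mathcal M^+(0,\infty)$ if and only if $$S_1:=\sup_{x\in(0,\infty)}\left(\int_0^\infty\mathcal U(x,t)^qw(t)\,dt\right)^{\frac1q}U(x)^{-1}\sup_{t\in(0,x)}U(t)\operatorname*{ess\,sup}_{s\in(t,\infty)}(U(s)v(s))^{-1}<\infty .$$ Moreover, the best constant $c$ in $( * )$ satisfies $c\approx S_1$. (ii) Let $p=1$, $0<q<1$. Then $( * )$ holds for every $h\in\mathcal M^+(0,\infty)$ if and only if $$S_2:=\left(\int_0^\infty\left(\int_0^\infty\mathcal U(x,t)^qw(t)\,dt\right)^{q^*}U(x)^{-q^*}\left(\sup_{t\in(0,x)}U(t)^{q^*}\operatorname*{ess\,sup}_{s\in(t,\infty)}(U(s)v(s))^{-q^*}\right)w(x)\,dx\right)^{\frac1{q^*}}<\infty .$$ Moreover, the best constant $c$ in $( * )$ satisfies $c\approx S_2$. (iii) Let $1<p\le q<\infty$. Then $( * )$ holds for every $h\in\mathcal M^+(0,\infty)$ if and only if $$S_3:=\sup_{x\in(0,\infty)}\left(\int_0^\infty\mathcal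 U(x,t)^qw(t)\,dt\right)^{\frac1q}\left(\int_0^\infty\mathcal U(t,x)^{p'}U(t)^{-p'}v(t)^{1-p'}\,dt\right)^{\frac1{p'}}<\infty .$$ Moreover, the best constant $c$ in $( * )$ satisfies $c\approx S_3$. (iv) Let $1<p<\infty$, $0<q<p$. Then $( * )$ holds for every $h\in\mathcal M^+(0,\infty)$ if and only if $$S_4:=\left(\int_0^\infty\left(\int_0^\infty\mathcal U(x,t)^qw(t)\,dt\right)^{\frac rp}\left(\int_0^\infty\mathcal U(t,x)^{p'}U(t)^{-p'}v(t)^{1-p'}\,dt\right)^{\frac r{p'}}w(x)\,dx\right)^{\frac1r}<\infty .$$ Moreover, the best constant $c$ in $( * )$ satisfies $c\approx S_4$. (v) Let $p=\infty$, $0<q<\infty$. Then $( * )$ holds for every $h\in\mathcal M^+(0,\infty)$ if and only if $$S_5:=\left(\int_0^\infty\left(\int_0^\infty\mathcal U(t,x)U(t)^{-1}\frac{dt}{v(t)}\right)^qw(x)\,dx\right)^{\frac1q}<\infty .$$ Moreover, the best constant $c$ in $( * )$ satisfies $c\approx S_5$.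
   Context: A weight is a locally integrable non-negative function on $(0,\infty)$; $\mathcal M^+(0,\infty)$ is the set of non-negative measurable functions on $(0,\infty)$. $U(t)=\int_0^tu(s)\,ds$, with $U(t)>0$ for all $t>0$, and $\mathcal U(x,t)=\dfrac{U(x)}{U(t)+U(x)}$. $U$ is admissible if it is continuous and strictly increasing on $[0,\infty)$, $U(0)=0$ and $\lim_{t\to\infty}U(t)=\infty$. For $0<q<\infty$ the measure $w(t)\,dt$ is non-degenerate with respect to $U^{q}$ if $\int_0^\infty \frac{w(s)\,ds}{U(s)^q+U(t)^q}<\infty$ for all $t\in(0,\infty)$ and $\int_0^1\frac{w(s)}{U(s)^q}\,ds=\int_1^\infty w(s)\,ds=\infty$. $\|f\|_{p,w,(0,\infty)}=\left(\int_0^\infty|f(x)|^pw(x)\,dx\right)^{1/p}$ for $0<p<\infty$ and $\|f\|_{\infty,w,(0,\infty)}=\operatorname{ess\,sup}_{x\in(0,\infty)}|f(x)|w(x)$. The generalized Stieltjes transform is $(Sh)(x)=\int_0^\infty\frac{h(t)\,dt}{U(x)+U(t)}$. For $p\in[1,\infty]$, $1/p+1/p'=1$; for $q\in(0,1)$, $q^*=\frac q{1-q}$. Conventions: $1/0=\infty$, $1/\infty=0$, $0\cdot\infty=0$, $0/0=0$, $\infty/\infty=0$. $a\approx b$ means $\lambda^{-1}a\le b\le\lambda a$ with $\lambda>0$ depending only on inessential parameters (here $p,q$). *)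

(* Defs.v *)
From HB Require Import structures.
From mathcomp Require Import all_boot all_order all_algebra.
From mathcomp Require Import all_classical all_reals all_analysis.
From mathcomp Require Import measurable_realfun ess_sup_inf lebesgue_integral_differentiation.
Set Implicit Arguments.
Unset Strict Implicit.
Unset Printing Implicit Defensive.
Import Order.TTheory GRing.Theory Num.Theory.
Import numFieldNormedType.Exports.
Local Open Scope classical_set_scope.
Local Open Scope ring_scope.
Local Open Scope ereal_scope.

(* Products, inverses and powers that can meet 0 or +oo are taken in [\bar R],
   where [inve] and [mule] satisfy 1/0 = +oo, 1/+oo = 0, 0 * +oo = 0, hence
   also 0/0 = 0 and +oo/+oo = 0. *)

Section Weights.
Context {R : realType}.
Implicit Types (u v w : R -> R) (U : R -> R) (p q : R).
Local Notation mu := (@lebesgue_measure R).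

Definition weight w : Prop :=
  locally_integrable `]0%R, +oo[ w /\ forall x : R, (0 < x)%R -> (0 <= w x)%R.

(* [R]-valued integral, whose value is 0 if the integral diverges; this value
   is incompatible with [0 < primitive u t] for t > 0. *)
Definition primitive u (t : R) : R := (\int[mu]_(s in `]0%R, t[) u s)%R.

Definition admissible U : Prop :=
  [/\ {within `[0%R, +oo[, continuous U},
      {in `[0%R, +oo[ &, {homo U : x y / (x < y)%R}},
      U 0%R = 0%R &
      U x @[x --> +oo%R] --> +oo%R].

Definition kernelU U (x t : R) : R := (U x / (U t + U x))%R.

Definition nondegenerate_wrt U w q : Prop :=
  [/\ forall t : R, (0 < t)%R ->
        \int[mu]_(s in `]0%R, +oo[) (w s / (U s `^ q + U t `^ q))%:E < +oo,
      \int[mu]_(s in `]0%R, 1%R[) (w s / U s `^ q)%:E = +oo &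
      \int[mu]_(s in `]1%R, +oo[) (w s)%:E = +oo].

Definition Mplus (h : R -> \bar R) : Prop :=
  measurable_fun (`]0%R, +oo[%classic : set R) h /\ forall x : R, (0 < x)%R -> 0 <= h x.

Definition ess_sup_on (I : interval R) (f : R -> \bar R) : \bar R :=
  ess_sup (mrestr mu (measurable_itv I)) f.

Definition wnorm (p : \bar R) w (f : R -> \bar R) : \bar R :=
  match p with
  | r%:E => (\int[mu]_(x in `]0%R, +oo[) (`|f x| `^ r * (w x)%:E)) `^ r^-1
  | +oo => ess_sup_on `]0%R, +oo[ (fun x => `|f x| * (w x)%:E)
  | -oo => 0
  end.

Definition stieltjes U (h : R -> \bar R) (x : R) : \bar R :=
  \int[mu]_(t in `]0%R, +oo[) (h t / (U x + U t)%:E).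

Definition stieltjes_ineq (p q : \bar R) U v w (c : R) : Prop :=
  (0 <= c)%R /\
  forall h, Mplus h -> wnorm q w (stieltjes U h) <= c%:E * wnorm p v h.

(* The infimum is +oo when no finite constant is possible. *)
Definition best_constant (p q : \bar R) U v w : \bar R :=
  ereal_inf [set c%:E | c in [set c | stieltjes_ineq p q U v w c]].

Definition equiv_upto (lam : R) (a b : \bar R) : Prop :=
  lam^-1%:E * a <= b <= lam%:E * a.

Definition characterized_by (lam : R) (p q : \bar R) U v w (S : \bar R) : Prop :=
  ((exists c : R, stieltjes_ineq p q U v w c) <-> S < +oo) /\
  equiv_upto lam (best_constant p q U v w) S.

(* x^(-a) for x >= 0 and a > 0, with 0^(-a) = +oo; the library's
   [powR 0 (- a)] is 0 instead. *)
Definition npow (x a : R) : \bar R := (x%:E)^-1 `^ a.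

Definition qstar q : R := (q / (1 - q))%R.

Definition conj_exp p : R := fine (hoelder_conjugate p%:E).

Definition rexp p q : R := (p * q / (p - q))%R.

Definition Wint U w q (x : R) : \bar R :=
  \int[mu]_(t in `]0%R, +oo[) (kernelU U x t `^ q * w t)%:E.

Definition Vint U v p (x : R) : \bar R :=
  let p' := conj_exp p in
  \int[mu]_(t in `]0%R, +oo[)
    ((kernelU U t x `^ p')%:E * npow (U t) p' * npow (v t) (p' - 1)).

Definition S1 U v w q : \bar R :=
  ereal_sup [set Wint U w q x `^ q^-1 * npow (U x) 1 *
                 ereal_sup [set (U t)%:E *
                      ess_sup_on `]t, +oo[ (fun s => npow (U s * v s) 1)
                   | t in `]0%R, x[ ]
            | x in `]0%R, +oo[ ].

Definition S2 U v w q : \bar R :=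
  let q' := qstar q in
  (\int[mu]_(x in `]0%R, +oo[)
     (Wint U w q x `^ q' * npow (U x) q' *
      ereal_sup [set (U t `^ q')%:E *
                     ess_sup_on `]t, +oo[ (fun s => npow (U s * v s) q')
                | t in `]0%R, x[ ] *
      (w x)%:E)) `^ q'^-1.

Definition S3 U v w p q : \bar R :=
  ereal_sup [set Wint U w q x `^ q^-1 * Vint U v p x `^ (conj_exp p)^-1
            | x in `]0%R, +oo[ ].

Definition S4 U v w p q : \bar R :=
  let r := rexp p q in
  (\int[mu]_(x in `]0%R, +oo[)
     (Wint U w q x `^ (r / p) * Vint U v p x `^ (r / conj_exp p) *
      (w x)%:E)) `^ r^-1.

Definition S5 U v w q : \bar R :=
  (\int[mu]_(x in `]0%R, +oo[)
     ((\int[mu]_(t in `]0%R, +oo[)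
         ((kernelU U t x)%:E * npow (U t) 1 / (v t)%:E)) `^ q *
      (w x)%:E)) `^ q^-1.

End Weights.

(* Main.v *)
Require Import Defs.
From HB Require Import structures.
From mathcomp Require Import all_boot all_order all_algebra.
From mathcomp Require Import all_classical all_reals all_analysis.
From mathcomp Require Import measurable_realfun ess_sup_inf.
From mathcomp Require Import ring lra zify.
Set Implicit Arguments.
Unset Strict Implicit.
Unset Printing Implicit Defensive.
Import Order.TTheory GRing.Theory Num.Theory.
Import numFieldNormedType.Exports.
Local Open Scope classical_set_scope.
Local Open Scope ring_scope.
Local Open Scope ereal_scope.

(* Since U(x) + U(t) is comparable with the larger of the two terms, S is
   comparable with the sum of a Hardy operator and a dual Hardy operator, which
   are exchanged by reversing the order defined by U.  Put
   Phi(x) = \int U(x,t)^q w(t) dt, and let m(x) be the norm of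
   t |-> 1 / (U(x) + U(t)) in the dual of L^p(v): a weighted L^p' norm if p > 1,
   a weighted essential supremum if p = 1.  Both m decreases and U m increases.
   Sufficiency: two weighted Hardy inequalities L^p -> L^p, for the measures
   with the critical distribution function, are transferred to L^q by
   monotonicity if p <= q and by Hoelder's inequality if q < p.
   Necessity: a near extremizer for m(y) satisfies S h >= m(y) U(y,.), so
   Phi^(1/q) m is bounded; if q < p, the l^p sum of weighted near extremizers at
   points y_j exhausting the sets {m >= 2^j} bounds \int Phi^(q/(p-q)) m^r w.
   If p = oo, the extremizer is 1/v. *)

(** * Powers of extended reals *)

(** The measures are only sigma-finite and the order comes from a function [a] that may have ties,
    so a power of a distribution function W has no primitive to integrate with. The substitute is a
    bound of the integral of W ^ (al - 1) over {W <= k} by a multiple of k ^ al, for every al > 0,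
    deduced from nu {W <= c} <= c alone. The auxiliary weights are powers chosen to fit this bound.
    One condition on Phi and m controls both Hardy inequalities: Phi is comparable to W1 + a ^ q *
    W2, built from the two distribution functions involved, and on each half the truncated kernel is
    at most twice the full one, whose size m measures. In the necessity for q < p the unknown
    integral appears on both sides, with exponent q / p < 1 on the right. It can be absorbed only if
    it is finite, so finite families come first and Fatou's lemma last. Since v may vanish, m may be
    infinite. It stays in the extended reals, and its finiteness is derived from whichever side of
    the equivalence is assumed. *)

Section ereal_power.
Context {R : realType}.
Implicit Types (x y : \bar R) (r s : R).

Lemma lee_poweR x y r : (0 <= r)%R -> 0 <= x -> x <= y -> x `^ r <= y `^ r.
Proof.
move=> r0 x0 xy; apply: gt0_ler_poweR => //; rewrite in_itv/= leey andbT//.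
exact: le_trans xy.
Qed.

Lemma poweRK x r : r != 0%R -> 0 <= x -> (x `^ r) `^ r^-1 = x.
Proof. by move=> r0 x0; rewrite -poweRrM divff// poweRe1. Qed.

Lemma poweRVK x r : r != 0%R -> 0 <= x -> (x `^ r^-1) `^ r = x.
Proof. by move=> r0 x0; rewrite -poweRrM mulVf// poweRe1. Qed.

Lemma poweRD_ge0 x r s : (0 <= r)%R -> (0 <= s)%R -> 0 <= x ->
  x `^ (r + s) = x `^ r * x `^ s.
Proof.
move=> r0 s0 x0.
have [rs|rs] := eqVneq (r + s)%R 0%R; last first.
  by rewrite poweRD// /poweRD_def (negbTE rs).
have -> : r = 0%R by lra.
have -> : s = 0%R by lra.
by rewrite addr0 !poweRe0 mule1.
Qed.

(* Young's inequality; the infinite cases are trivial as the right-hand side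
   is then infinite. *)
Lemma young_poweR (th al be : R) x y : (0 < th < 1)%R -> (0 < al)%R ->
  (0 < be)%R -> 0 <= x -> 0 <= y ->
  x `^ th * y `^ (1 - th) <=
    (al `^ th * be `^ (1 - th))%:E * ((th / al)%:E * x + ((1 - th) / be)%:E * y).
Proof.
move=> /andP[t0 t1] a0 b0.
have c0 : (0 < al `^ th * be `^ (1 - th))%R by rewrite mulr_gt0 ?powR_gt0.
have ta : (0 < th / al)%R by rewrite divr_gt0.
have tb : (0 < (1 - th) / be)%R by rewrite divr_gt0 ?subr_gt0.
case: x => [x||]//; last first.
  move=> _ y0; rewrite gt0_muley ?lte_fin// addye; last first.
    by rewrite gt_eqF// (lt_le_trans ltNy0)// mule_ge0// lee_fin ltW.
  by rewrite gt0_muley ?lte_fin// leey.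
case: y => [y||]// x0; last first.
  move=> _; rewrite gt0_muley ?lte_fin//= addey//.
  by rewrite gt0_muley ?lte_fin// leey.
rewrite lee_fin in x0; rewrite lee_fin => y0; rewrite lee_fin.
have := @conjugate_powR _ ((x / al) `^ th)%R ((y / be) `^ (1 - th))%R th^-1%R (1 - th)^-1%R
  (powR_ge0 _ _) (powR_ge0 _ _).
rewrite !invr_gt0 subr_gt0 t0 t1 !invrK => /(_ isT isT).
have e1 : (th + (1 - th) = 1)%R by ring.
move=> /(_ e1) {e1}.
have t1' : (1 - th != 0)%R by rewrite gt_eqF// subr_gt0.
rewrite -!powRrM (divff t1') divff ?(gt_eqF t0)//.
rewrite !powRr1 ?divr_ge0 ?(ltW a0) ?(ltW b0)// => h.
have e (z c s : R) : (0 <= z)%R -> (0 < c)%R -> (z `^ s = c `^ s * (z / c) `^ s)%R.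
  move=> z0 c0'; rewrite -powRM ?divr_ge0 ?(ltW c0')//.
  by rewrite mulrC divfK ?(gt_eqF c0').
rewrite (e x al)// (e y be)// mulrACA ler_pM2l//.
by apply: (le_trans h); rewrite le_eqVlt; apply/orP; left; apply/eqP; ring.
Qed.

End ereal_power.

(** * Hoelder's inequality for functions with values in the extended reals *)

Section integral_lemmas.
Context d (T : measurableType d) (R : realType).
Variable mu : {measure set T -> \bar R}.
Implicit Types f g : T -> \bar R.

Lemma measurable_funP_poweR f r : measurable_fun setT f ->
  measurable_fun setT (fun x => f x `^ r).
Proof. by move=> mf; exact: (measurableT_comp (measurable_poweR r)). Qed.

Lemma ge0_integralT_le f g : measurable_fun setT f -> measurable_fun setT g ->
  (forall x, 0 <= f x) -> (forall x, f x <= g x) ->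
  \int[mu]_x f x <= \int[mu]_x g x.
Proof. by move=> mf mg f0 fg; apply: ge0_le_integral. Qed.

Lemma ge0_integral_eq0_ae f : measurable_fun setT f -> (forall x, 0 <= f x) ->
  \int[mu]_x f x = 0 -> {ae mu, forall x, f x = 0}.
Proof.
move=> mf f0 i0.
have := (ae_eq_integral_abs mu measurableT mf).1.
rewrite (eq_integral f) => [/(_ i0)|x _]; last by rewrite gee0_abs.
by apply: filterS => x /(_ Logic.I).
Qed.

Lemma ae0_integral0 f : measurable_fun setT f -> (forall x, 0 <= f x) ->
  {ae mu, forall x, f x = 0} -> \int[mu]_x f x = 0.
Proof.
move=> mf f0 h.
have := (ae_eq_integral_abs mu measurableT mf).2.
rewrite (eq_integral f) => [|x _]; last by rewrite gee0_abs.
by apply; apply: filterS h => x -> _.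
Qed.

(** Young's inequality with [al] and [be] the two integrals makes the bracket integrate to th + (1 -
    th) = 1. If an integral vanishes, so does the product almost everywhere; if one is infinite, the
    other is positive and the bound is +oo. *)
Lemma hoelder_poweR f g (th : R) : (0 < th < 1)%R ->
  measurable_fun setT f -> measurable_fun setT g ->
  (forall x, 0 <= f x) -> (forall x, 0 <= g x) ->
  \int[mu]_x (f x `^ th * g x `^ (1 - th)) <=
    (\int[mu]_x f x) `^ th * (\int[mu]_x g x) `^ (1 - th).
Proof.
move=> /[dup] th01 /andP[t0 t1] mf mg f0 g0.
have t10 : (0 < 1 - th)%R by rewrite subr_gt0.
have mfg : measurable_fun setT (fun x => f x `^ th * g x `^ (1 - th)).
  by apply: emeasurable_funM; exact: measurable_funP_poweR.
have fg0 x : 0 <= f x `^ th * g x `^ (1 - th).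
  by rewrite mule_ge0 ?poweR_ge0.
have if0 : 0 <= \int[mu]_x f x by exact: integral_ge0.
have ig0 : 0 <= \int[mu]_x g x by exact: integral_ge0.
have [fz|fn0] := eqVneq (\int[mu]_x f x) 0.
  rewrite (ae0_integral0 mfg) ?mule_ge0 ?poweR_ge0//.
  have := ge0_integral_eq0_ae mf f0 fz; apply: filterS => x ->.
  by rewrite poweR0r ?gt_eqF// mul0e.
have [gz|gn0] := eqVneq (\int[mu]_x g x) 0.
  rewrite (ae0_integral0 mfg) ?mule_ge0 ?poweR_ge0//.
  have := ge0_integral_eq0_ae mg g0 gz; apply: filterS => x ->.
  by rewrite poweR0r ?gt_eqF// mule0.
have {fn0 if0}fp : 0 < \int[mu]_x f x by rewrite lt0e fn0.
have {gn0 ig0}gp : 0 < \int[mu]_x g x by rewrite lt0e gn0.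
case ef : (\int[mu]_x f x) fp => [al||]// al0; last first.
  by rewrite poweRyr ?gt_eqF// gt0_mulye ?leey// poweR_gt0.
case eg : (\int[mu]_x g x) gp => [be||]// be0; last first.
  by rewrite poweRyr ?gt_eqF// gt0_muley ?leey// poweR_gt0.
rewrite !lte_fin in al0 be0.
apply: le_trans.
  apply: (ge0_integralT_le mfg _ fg0 (fun x => young_poweR th01 al0 be0 (f0 x) (g0 x))).
  by apply: measurable_funeM; apply: emeasurable_funD; exact: measurable_funeM.
have c1 : (0 <= th / al)%R by rewrite divr_ge0 ?ltW.
have c2 : (0 <= (1 - th) / be)%R by rewrite divr_ge0 ?ltW.
rewrite ge0_integralZl//=; last 3 first.
- by apply: emeasurable_funD; exact: measurable_funeM.
- by move=> x _; rewrite adde_ge0 ?mule_ge0 ?lee_fin.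
- by rewrite lee_fin mulr_ge0 ?powR_ge0.
rewrite ge0_integralD//; last 4 first.
- by move=> x _; rewrite mule_ge0 ?lee_fin.
- exact: measurable_funeM.
- by move=> x _; rewrite mule_ge0 ?lee_fin.
- exact: measurable_funeM.
rewrite !ge0_integralZl_EFin// ef eg.
rewrite -!EFinM lee_fin /=.
by rewrite !divfK ?gt_eqF// addrC subrK mulr1.
Qed.

End integral_lemmas.

(** * Measures with a density *)

(** [mf] and [f0] are parameters so that the measure and sigma-finite structures below attach to the
    name itself; weighted measures can then be fed to lemmas on arbitrary measures. *)
Definition density_measure d (T : measurableType d) (R : realType)
  (mu : set T -> \bar R) (f : T -> R) (mf : measurable_fun setT f)
  (f0 : forall x, (0 <= f x)%R) : set T -> \bar R :=
  fun A => \int[mu]_(x in A) (f x)%:E.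

Section density_integral.
Context d (T : measurableType d) (R : realType).
Variables (mu : {measure set T -> \bar R}) (f : T -> R).
Hypotheses (mf : measurable_fun setT f) (f0 : forall x, (0 <= f x)%R).

Local Notation nu := (density_measure mu mf f0).

Let nu0 : nu set0 = 0.
Proof. by rewrite /density_measure integral_set0. Qed.

Let nu_ge0 A : 0 <= nu A.
Proof. by apply: integral_ge0 => x _; rewrite lee_fin. Qed.

Let nu_sigma_additive : semi_sigma_additive nu.
Proof.
move=> F mF tF mU; rewrite /density_measure ge0_integral_bigcup//; last 2 first.
- exact/measurable_funTS/measurable_EFinP.
- by move=> x _; rewrite lee_fin.
apply: is_cvg_ereal_nneg_natsum_cond => n _ _.
by apply: integral_ge0 => x _; rewrite lee_fin.
Qed.

HB.instance Definition _ := isMeasure.Build _ _ _ nu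
  nu0 nu_ge0 nu_sigma_additive.

Import HBNNSimple.

(** Monotone convergence along simple approximations of [g] reduces the claim to indicators, where
    it is the definition of [density_measure]. *)
Lemma integral_density (g : T -> \bar R) : measurable_fun setT g ->
  (forall x, 0 <= g x) -> \int[nu]_x g x = \int[mu]_x (g x * (f x)%:E).
Proof.
move=> mg g0; have mf' : measurable_fun setT (EFin \o f) by exact/measurable_EFinP.
have f0' x : 0 <= (EFin \o f) x by rewrite lee_fin.
pose h := nnsfun_approx measurableT mg.
have hg x : EFin \o h^~ x @ \oo --> g x by exact: cvg_nnsfun_approx.
have ndh x : nondecreasing_seq (h^~ x).
  by move=> a b ab; exact/lefP/nd_nnsfun_approx.
transitivity (limn (fun n => \int[nu]_x (h n x)%:E)).
  rewrite -monotone_convergence//; last 3 first.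
  - by move=> n; exact/measurable_EFinP.
  - by move=> n x _; rewrite lee_fin.
  - by move=> x _ a b ab; rewrite lee_fin; exact: ndh.
  by apply: eq_integral => x _; apply/esym/cvg_lim => //; exact: hg.
transitivity (limn (fun n => \int[mu]_x ((h n x)%:E * (f x)%:E))); last first.
  rewrite -monotone_convergence//; last 3 first.
  - by move=> n; apply: emeasurable_funM => //; exact/measurable_EFinP.
  - by move=> n x _; rewrite mule_ge0// lee_fin.
  - by move=> x _ a b ab; rewrite lee_wpmul2r ?lee_fin//; exact: ndh.
  apply: eq_integral => x _; apply/cvg_lim => //.
  by apply: cvgeZr => //; exact: hg.
congr (limn _); apply/funext => n.
transitivity (\int[nu]_x (\sum_(y \in range (h n))
    (y * \1_(h n @^-1` [set y]) x)%:E)).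
  by apply: eq_integral => t _; rewrite fimfunE -fsumEFin.
rewrite ge0_integral_fsum//; last 2 first.
- move=> r; apply/measurable_EFinP; exact: measurable_funM.
- by move=> m y _; exact: nnfun_muleindic_ge0.
transitivity (\int[mu]_x (\sum_(y \in range (h n))
    (y * \1_(h n @^-1` [set y]) x)%:E * (f x)%:E)); last first.
  apply: eq_integral => x _.
  rewrite -ge0_mule_fsuml => [|y]; last exact: nnfun_muleindic_ge0.
  by rewrite fsumEFin// -(fimfunE _ x).
rewrite ge0_integral_fsum//; last 2 first.
- move=> y; apply: emeasurable_funM => //.
  by apply/measurable_EFinP; exact: measurable_funM.
- by move=> m y _; rewrite mule_ge0 ?f0'// nnfun_muleindic_ge0.
apply: eq_fsbigr => r rhn.
have r0 : (0 <= r)%R by move: rhn; rewrite inE => -[t _ <-].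
under eq_integral do rewrite EFinM.
under [RHS]eq_integral do rewrite EFinM -muleA.
have mi : measurable_fun setT (fun x => (\1_(h n @^-1` [set r]) x)%:E : \bar R).
  exact/measurable_EFinP.
rewrite ge0_integralZl_EFin// [in RHS]ge0_integralZl_EFin//; last 2 first.
- by move=> x _; rewrite mule_ge0 ?f0'// lee_fin.
- exact: emeasurable_funM.
congr (_ * _); rewrite integral_indic// setIT /= /density_measure.
rewrite integral_mkcond; apply: eq_integral => x _.
by rewrite epatch_indic muleC.
Qed.

Lemma integral_density_in (D : set T) (g : T -> \bar R) : measurable D ->
  measurable_fun setT g -> (forall x, 0 <= g x) ->
  \int[nu]_(x in D) g x = \int[mu]_(x in D) (g x * (f x)%:E).
Proof.
move=> mD mg g0; rewrite [LHS]integral_mkcond [RHS]integral_mkcond.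
transitivity (\int[mu]_x ((g \_ D) x * (f x)%:E)).
  apply: integral_density.
    by apply/(measurable_restrictT _ mD); exact: measurable_funTS.
  by move=> x; rewrite patchE; case: ifP.
by apply: eq_integral => x _; rewrite !patchE; case: ifP => //; rewrite mul0e.
Qed.

End density_integral.

Section density_sigma_finite.
Context d (T : measurableType d) (R : realType).
Variables (mu : {sigma_finite_measure set T -> \bar R}) (f : T -> R).
Hypotheses (mf : measurable_fun setT f) (f0 : forall x, (0 <= f x)%R).

Let nu_sigma_finite : sigma_finite setT (density_measure mu mf f0).
Proof.
have [F UF mF] := sigma_finiteT mu.
have mfn n : measurable (f @^-1` `]-oo, n%:R]).
  by rewrite -[X in measurable X]setTI; exact: mf.
(* On the [n]-th set the density is at most n and [mu] is finite. The first [n] pieces are united so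
   that one index can meet both conditions. *)
exists (fun n => (\bigcup_(i < n) F i) `&` f @^-1` `]-oo, n%:R]).
  apply/seteqP; split => // x _.
  have [i _ Fi] : (\bigcup_i F i) x by rewrite -UF.
  have := archi_boundP (f0 x); set k := Num.bound _ => fk.
  exists (maxn i.+1 k) => //; split; first by exists i => //=; exact: leq_maxl.
  by rewrite /= in_itv/= (le_trans (ltW fk))// ler_nat leq_maxr.
move=> n.
have mG : measurable (\bigcup_(i < n) F i).
  by apply: bigcup_measurable => i _; exact: (mF i).1.
split; first exact: measurableI.
have mI := measurableI _ _ mG (mfn n).
rewrite /density_measure (@le_lt_trans _ _ (n%:R%:E * mu (\bigcup_(i < n) F i)))//.
  apply: (@le_trans _ _ (\int[mu]_(x in (\bigcup_(i < n) F i) `&`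
      f @^-1` `]-oo, n%:R]) (cst n%:R%:E) x)).
    apply: ge0_le_integral => //=.
    - by move=> x _; rewrite lee_fin.
    - exact/measurable_funTS/measurable_EFinP.
    - by move=> x [_]; rewrite in_itv/= lee_fin.
  by rewrite integral_cst// lee_wpmul2l ?lee_fin// le_measure ?inE//.
rewrite lte_mul_pinfty ?lee_fin//.
rewrite bigcup_mkord.
apply: (@le_lt_trans _ _ (\sum_(i < n) mu (F i))).
  by apply: Boole_inequality => i _; exact: (mF i).1.
by apply: lte_sum_pinfty => i _; exact: (mF i).2.
Qed.

HB.instance Definition _ := @Measure_isSigmaFinite.Build _ _ _
  (density_measure mu mf f0) nu_sigma_finite.

End density_sigma_finite.

(** * Measures of sublevel sets of monotone functions *)

Section order_sublevel.
Context d (T : measurableType d) (R : realType).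
Variable nu : {measure set T -> \bar R}.
Implicit Types (a K : T -> R) (E : set T).

(** Countability comes from the rationals: if [a] has no maximum on [E], a rational separates [a z]
    from a larger value, and a point of [E] is chosen above each rational that has one. Lower sets
    thus become countable increasing unions. *)
Lemma cofinal_sequence a E : E !=set0 -> exists x : nat -> T,
  [/\ forall n, E (x n), forall n, (a (x n) <= a (x n.+1))%R &
      forall z, E z -> exists n, (a z <= a (x n))%R].
Proof.
move=> [x0 Ex0].
have [[x [Ex xmax]]|nomax] := pselect (exists x, E x /\ forall y, E y -> (a y <= a x)%R).
  by exists (fun=> x); split => // z /xmax; exists 0%N.
have gt_ex x : E x -> exists y, E y /\ (a x < a y)%R.
  move=> Ex; apply: contrapT => /forallNP h; apply: nomax; exists x; split => // y Ey.
  by rewrite leNgt; apply/negP => xy; apply: (h y).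
have gP (r : rat) : exists y, E y /\ ((exists2 z, E z & (ratr r <= a z)%R) -> (ratr r <= a y)%R).
  have [[z Ez rz]|h] := pselect (exists2 z, E z & (ratr r <= a z)%R).
    by exists z.
  by exists x0; split.
have [g gE] := choice gP.
pose y n := oapp g x0 (unpickle n).
have Ey n : E (y n) by rewrite /y; case: (unpickle n) => //= r; have [] := gE r.
(* A running maximum of the enumerated points, which makes the sequence monotone. *)
pose X := fix X n := if n is m.+1 then
  (if (a (X m) <= a (y n))%R then y n else X m) else y 0%N.
have EX n : E (X n) by elim: n => //= n ih; case: ifP.
have yX n : (a (y n) <= a (X n))%R.
  by case: n => //= n; case: ifPn => //; rewrite -ltNge => /ltW.
exists X; split => [//|n /=|z Ez]; first by case: ifP.
have [z' [Ez' zz']] := gt_ex _ Ez.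
have [r /andP[zr rz']] := rat_in_itvoo zz'.
exists (pickle r); apply: le_trans (yX _).
rewrite /y pickleK/= (le_trans (ltW zr))//; apply: (gE r).2.
by exists z' => //; exact: ltW.
Qed.

(** The set {K <= c} need not be of the form {a <= a x}, but it is the increasing union of such sets
    along a cofinal sequence of its points, so continuity from below applies. *)
Lemma sublevel_measure a K (c : R) : measurable_fun setT a -> (0 <= c)%R ->
  (forall x y, (a x <= a y)%R -> (K x <= K y)%R) ->
  (forall x, nu [set y | (a y <= a x)%R] <= (K x)%:E) ->
  nu [set x | (K x <= c)%R] <= c%:E.
Proof.
move=> ma c0 aK nuK.
have [->|/set0P E0] := eqVneq [set x | (K x <= c)%R] set0.
  by rewrite measure0 lee_fin.
have [x [Ex xnd xcof]] := cofinal_sequence a E0.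
have mF n : measurable [set y | (a y <= a (x n))%R].
  by rewrite -[X in measurable X]setTI; exact: measurable_fun_le.
have -> : [set x | (K x <= c)%R] = \bigcup_n [set y | (a y <= a (x n))%R].
  apply/seteqP; split => z /=; first by move=> /xcof [n zn]; exists n.
  by move=> [n _ /= /aK zn]; exact: le_trans (Ex n).
have cv : nu \o (fun n => [set y | (a y <= a (x n))%R]) @ \oo -->
    nu (\bigcup_n [set y | (a y <= a (x n))%R]).
  apply: nondecreasing_cvg_mu => //; first exact: bigcup_measurable.
  apply/nondecreasing_seqP => n; apply/subsetPset => z /= zn.
  exact: le_trans zn (xnd n).
rewrite -(cvg_lim _ cv)//; apply: lime_le; first by apply/cvg_ex;
  exists (nu (\bigcup_n [set y | (a y <= a (x n))%R])).
by apply: nearW => n /=; rewrite (le_trans (nuK _))// lee_fin; exact: Ex.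
Qed.

(** The term 1 suffices for al >= 1. For al < 1 the other term is the sum of a geometric series of
    ratio 2 ^ (- al), with 2 ^ (1 - al) from evaluating the power at the lower end of a dyadic
    shell. *)
Definition power_const (al : R) : R :=
  (1 + 2 `^ (1 - al) / (1 - 2^-1 `^ al))%R.

Lemma power_const_gt0 al : (0 < al)%R -> (0 < power_const al)%R.
Proof.
move=> al0; rewrite /power_const ltr_wpDr// divr_ge0 ?powR_ge0// subr_ge0.
have q01 : (0 < (2^-1 : R) <= 1)%R by apply/andP; split; lra.
by rewrite -[leRHS](powRr0 (2^-1)) ger_powR// ltW.
Qed.

Lemma dyadic_bracket (k z : R) : (0 < z)%R -> (z <= k)%R ->
  exists n, (k * 2^-1 ^+ n.+1 < z <= k * 2^-1 ^+ n)%R.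
Proof.
move=> z0 zk; have k0 := lt_le_trans z0 zk.
have ex : exists n, (k * 2^-1 ^+ n.+1 < z)%R.
  exists (Num.bound (k / z)); rewrite exprVn ltr_pdivrMr ?exprn_gt0//.
  rewrite mulrC -ltr_pdivrMr//.
  apply: lt_trans (_ : (Num.bound (k / z))%:R < _)%R.
    by apply: archi_boundP; rewrite divr_ge0// ltW.
  by rewrite -natrX ltr_nat (ltn_trans (ltnSn _))// ltn_expl.
exists (ex_minn ex); case: ex_minnP => n -> nmin /=.
case: n nmin => [|n] nmin; first by rewrite expr0 mulr1.
by rewrite leNgt; apply/negP => /nmin; rewrite ltnn.
Qed.

(* For al < 1, sum the bounds on the dyadic shells
   k / 2 ^ (n + 1) < K <= k / 2 ^ n. *)
Lemma integral_power_sublevel K (al k : R) : (0 < al)%R -> (0 < k)%R ->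
  measurable_fun setT K -> (forall x, (0 < K x)%R) ->
  (forall c, (0 < c)%R -> nu [set x | (K x <= c)%R] <= c%:E) ->
  \int[nu]_(x in [set x | (K x <= k)%R]) (K x `^ (al - 1))%:E <=
    (power_const al * k `^ al)%:E.
Proof.
move=> al0 k0 mK K0 nuK.
have mS c : measurable [set x | (K x <= c)%R].
  by rewrite -[X in measurable X]setTI; exact: measurable_fun_le.
have mKp : measurable_fun setT (fun x => (K x `^ (al - 1))%:E).
  by apply/measurable_EFinP; apply: (measurableT_comp (measurable_powR _)).
have q0 : (0 < 2^-1 :> R)%R by rewrite invr_gt0.
have q1 : (2^-1 `^ al < 1 :> R)%R.
  have e : (1 `^ al = 1 :> R)%R by rewrite powR1.
  rewrite -[ltRHS]e.
  by apply: gt0_ltr_powR => //; rewrite ?nnegrE ?(ltW q0)//; lra.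
have [al1|al1] := leP 1%R al.
  apply: (@le_trans _ _ (\int[nu]_(x in [set x | (K x <= k)%R]) (cst (k `^ (al - 1))%:E x))).
    apply: ge0_le_integral => //=.
    - by move=> x _; rewrite lee_fin powR_ge0.
    - exact: measurable_funTS.
    - move=> x Kx; rewrite lee_fin ge0_ler_powR ?subr_ge0// nnegrE ltW//.
  rewrite integral_cst//.
  apply: (@le_trans _ _ ((k `^ (al - 1))%:E * k%:E)).
    by rewrite lee_wpmul2l ?lee_fin ?powR_ge0// nuK.
  rewrite -EFinM lee_fin mulrC mulr_powRB1 ?(ltW k0)// ler_peMl ?powR_ge0//.
  by rewrite /power_const lerDl divr_ge0 ?powR_ge0// subr_ge0 ltW.
pose x_ n : R := (k * 2^-1 ^+ n)%R.
have x0 n : (0 < x_ n)%R by rewrite mulr_gt0 ?exprn_gt0.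
have xS n : (k * 2^-1 ^+ n.+1 = x_ n / 2)%R by rewrite exprSr mulrA.
(* The shell is enlarged to {K <= x_ n}, of measure at most [x_ n], while the power, of exponent al
   - 1 < 0, is taken at the lower end [x_ n / 2]. *)
pose f n x : \bar R := ((x_ n / 2) `^ (al - 1) * \1_[set x | (K x <= x_ n)%R] x)%:E.
have mf n : measurable_fun setT (f n).
  by apply/measurable_EFinP; apply: measurable_funM => //; exact: measurable_indic.
have f0 n x : 0 <= f n x by rewrite lee_fin mulr_ge0 ?powR_ge0.
apply: (@le_trans _ _ (\int[nu]_x (\sum_(n <oo) f n x))).
  rewrite integral_mkcond; apply: ge0_integralT_le => //.
  - by apply/(measurable_restrictT _ (mS k)); exact: measurable_funTS.
  - exact: ge0_emeasurable_sum.
  - by move=> x; rewrite patchE; case: ifP => // _; rewrite lee_fin powR_ge0.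
  move=> x; rewrite patchE; case: ifPn => [|_]; last exact: nneseries_ge0.
  rewrite inE/= => Kk.
  have [n /andP[n1 n2]] := dyadic_bracket (K0 x) Kk.
  apply: (@le_trans _ _ (\sum_(0 <= i < n.+1) f i x)); last first.
    by apply: nneseries_lim_ge => *; exact: f0.
  rewrite big_nat_recr//= (@le_trans _ _ (f n x))//; last first.
    by rewrite leeDr// sume_ge0// => *; exact: f0.
  rewrite /f indicE mem_set//= mulr1 lee_fin.
  have -> : (al - 1 = - (1 - al))%R by ring.
  rewrite !powRN lef_pV2 ?posrE ?powR_gt0 ?divr_gt0//.
  by rewrite ge0_ler_powR ?subr_ge0 ?(ltW al1) ?nnegrE ?(ltW (K0 x)) ?divr_ge0 ?(ltW (x0
    n))// -xS ltW.
rewrite integral_nneseries//.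
pose A : R := (2 `^ (1 - al) * k `^ al)%R.
have A0 : (0 <= A)%R by rewrite mulr_ge0 ?powR_ge0.
have fn n : \int[nu]_x f n x <= (geometric A (2^-1 `^ al) n)%:E.
  rewrite /f; under eq_integral do rewrite EFinM.
  rewrite ge0_integralZl_EFin ?powR_ge0//; last first.
    by apply/measurable_EFinP; exact: measurable_indic.
  rewrite integral_indic// setIT.
  apply: (@le_trans _ _ (((x_ n / 2) `^ (al - 1))%:E * (x_ n)%:E)).
    by rewrite lee_wpmul2l ?lee_fin ?powR_ge0// nuK.
  rewrite -EFinM lee_fin /geometric/= /A.
  rewrite powRM ?(ltW (x0 n))// ?(ltW q0)// mulrAC (mulrC _ (x_ n)) mulr_powRB1 ?(ltW (x0 n))//.
  rewrite powRM ?(ltW k0) ?exprn_ge0 ?(ltW q0)//.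
  rewrite -(powR_mulrn n (ltW q0)) powRAC powR_mulrn ?powR_ge0//.
  have -> : (2^-1 `^ (al - 1) = 2 `^ (1 - al) :> R)%R.
    rewrite -powR_inv1// -powRrM; congr (_ `^ _)%R; ring.
  by rewrite [leLHS]mulrC mulrA.
apply: (@le_trans _ _ (\sum_(n <oo) (geometric A (2^-1 `^ al) n)%:E)).
  by apply: lee_nneseries => // *; exact: integral_ge0.
apply: lime_le.
  by apply: is_cvg_nneseries => *; rewrite lee_fin /geometric/= mulr_ge0 ?exprn_ge0 ?powR_ge0.
apply: nearW => n; rewrite sumEFin lee_fin.
have := geometric_seriesE A (negbT (lt_eqF q1)) => /(congr1 (fun g => g n)) /=.
rewrite /series/= => ->.
have q1' : (0 < 1 - 2^-1 `^ al :> R)%R by rewrite subr_gt0.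
apply: (@le_trans _ _ (A / (1 - 2^-1 `^ al))%R).
  rewrite ler_wpM2r ?invr_ge0 ?(ltW q1')// ler_piMr// gerBl exprn_ge0// powR_ge0//.
rewrite /A mulrAC /power_const ler_wpM2r ?powR_ge0// lerDr//.
Qed.

End order_sublevel.

(** * Hardy operators *)

Lemma powRD_gt0 (R : realType) (x r s : R) : (0 < x)%R ->
  (x `^ (r + s) = x `^ r * x `^ s)%R.
Proof. by move=> x0; rewrite powRD// (gt_eqF x0) implybT. Qed.

Lemma powRV (R : realType) (x r : R) : (0 <= x)%R -> (x^-1 `^ r = (x `^ r)^-1)%R.
Proof. by move=> x0; rewrite -powR_inv1// -powRrM mulN1r powRN. Qed.

Section more_integral_lemmas.
Context d (T : measurableType d) (R : realType).
Variable mu : {measure set T -> \bar R}.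
Implicit Types (f g : T -> \bar R) (D : set T).

Lemma ge0_integral_in_le D f g : measurable D ->
  measurable_fun setT f -> measurable_fun setT g ->
  (forall x, 0 <= f x) -> (forall x, D x -> f x <= g x) ->
  \int[mu]_(x in D) f x <= \int[mu]_(x in D) g x.
Proof.
move=> mD mf mg f0 fg; apply: ge0_le_integral => //; exact: measurable_funTS.
Qed.

Lemma ge0_subset_integralT D E f : measurable D -> measurable E ->
  measurable_fun setT f -> (forall x, 0 <= f x) -> D `<=` E ->
  \int[mu]_(x in D) f x <= \int[mu]_(x in E) f x.
Proof.
move=> mD mE mf f0 DE; apply: ge0_subset_integral => //; exact: measurable_funTS.
Qed.

Lemma hoelder_poweR_in D f g (th : R) : measurable D -> (0 < th < 1)%R ->
  measurable_fun setT f -> measurable_fun setT g ->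
  (forall x, 0 <= f x) -> (forall x, 0 <= g x) ->
  \int[mu]_(x in D) (f x `^ th * g x `^ (1 - th)) <=
    (\int[mu]_(x in D) f x) `^ th * (\int[mu]_(x in D) g x) `^ (1 - th).
Proof.
move=> mD /[dup] th01 /andP[t0 t1] mf mg f0 g0.
rewrite integral_mkcond [X in _ <= X `^ _ * _]integral_mkcond.
rewrite [X in _ <= _ * X `^ _]integral_mkcond.
have mr (h : T -> \bar R) : measurable_fun setT h -> measurable_fun setT (h \_ D).
  by move=> mh; apply/(measurable_restrictT _ mD); exact: measurable_funTS.
have r0 (h : T -> \bar R) : (forall x, 0 <= h x) -> forall x, 0 <= (h \_ D) x.
  by move=> h0 x; rewrite patchE; case: ifP.
apply: le_trans (hoelder_poweR mu th01 (mr _ mf) (mr _ mg) (r0 _ f0) (r0 _ g0)).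
rewrite le_eqVlt; apply/orP; left; apply/eqP; apply: eq_integral => x _.
by rewrite !patchE; case: ifP => // _; rewrite poweR0r ?gt_eqF// mul0e.
Qed.

End more_integral_lemmas.

(** * Tonelli's theorem over a measurable relation *)

Section fubini_relation.
Context d (T : measurableType d) (R : realType).
Variables (mu nu : {sigma_finite_measure set T -> \bar R}) (E : set (T * T)).
Hypothesis mE : measurable E.
Implicit Types g h : T -> \bar R.

Let k g h : T * T -> \bar R := fun z => (h z.1 * g z.2) * (\1_E z)%:E.

Let mk g h : measurable_fun setT g -> measurable_fun setT h -> measurable_fun setT (k g h).
Proof.
move=> mg mh; apply: emeasurable_funM.
  by apply: emeasurable_funM; exact: measurableT_comp.
by apply/measurable_EFinP; exact: measurable_indic.
Qed.

Let k0 g h : (forall x, 0 <= g x) -> (forall x, 0 <= h x) -> forall z, 0 <= k g h z.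
Proof. by move=> g0 h0 z; rewrite !mule_ge0// lee_fin. Qed.

Lemma measurable_section_r x : measurable [set t | E (x, t)].
Proof.
by rewrite -[X in measurable X]setTI; apply: (measurable_pair1 x).
Qed.

Lemma measurable_section_l t : measurable [set x | E (x, t)].
Proof.
by rewrite -[X in measurable X]setTI; apply: (measurable_pair2 t).
Qed.

Let kE1 g h x : measurable_fun setT g -> (forall x, 0 <= g x) -> (forall x, 0 <= h x) ->
  \int[mu]_t k g h (x, t) = h x * \int[mu]_(t in [set t | E (x, t)]) g t.
Proof.
move=> mg g0 h0; have mEx := measurable_section_r x.
rewrite [in RHS]integral_mkcond -ge0_integralZl//; last 2 first.
- by apply/(measurable_restrictT _ mEx); exact: measurable_funTS.
- by move=> t _; rewrite patchE; case: ifP.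
apply: eq_integral => t _; rewrite /k/= patchE indicE; case: ifPn.
  by rewrite inE/= => Et; rewrite mem_set// mule1.
by rewrite notin_setE/= => Et; rewrite memNset// !mule0.
Qed.

Let kE2 g h t : measurable_fun setT h -> (forall x, 0 <= g x) -> (forall x, 0 <= h x) ->
  \int[nu]_x k g h (x, t) = g t * \int[nu]_(x in [set x | E (x, t)]) h x.
Proof.
move=> mh g0 h0; have mEt := measurable_section_l t.
rewrite [in RHS]integral_mkcond -ge0_integralZl//; last 2 first.
- by apply/(measurable_restrictT _ mEt); exact: measurable_funTS.
- by move=> x _; rewrite patchE; case: ifP.
apply: eq_integral => x _; rewrite /k/= patchE indicE; case: ifPn.
  by rewrite inE/= => Et; rewrite mem_set// mule1 muleC.
by rewrite notin_setE/= => Et; rewrite memNset// !mule0.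
Qed.

(** Tonelli's theorem for the kernel [h x * g t] restricted to [E]; taking a relation as parameter
    covers both the weak and the strict order given by [a]. *)
Lemma fubini_relation g h : measurable_fun setT g -> measurable_fun setT h ->
  (forall x, 0 <= g x) -> (forall x, 0 <= h x) ->
  \int[nu]_x (h x * \int[mu]_(t in [set t | E (x, t)]) g t) =
  \int[mu]_t (g t * \int[nu]_(x in [set x | E (x, t)]) h x).
Proof.
move=> mg mh g0 h0.
transitivity (\int[nu]_x \int[mu]_t k g h (x, t)).
  by apply: eq_integral => x _; rewrite kE1.
rewrite (fubini_tonelli (k g h) (mk mg mh) (k0 g0 h0)).
by apply: eq_integral => t _; rewrite kE2.
Qed.

Lemma measurable_integral_section_r g : measurable_fun setT g -> (forall x, 0 <= g x) ->
  measurable_fun setT (fun x => \int[mu]_(t in [set t | E (x, t)]) g t).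
Proof.
move=> mg g0.
have -> : (fun x => \int[mu]_(t in [set t | E (x, t)]) g t) =
    (fun x => \int[mu]_t k g (cst 1) (x, t)).
  by apply/funext => x; rewrite kE1// mul1e.
apply: (measurable_fun_fubini_tonelli_F (m2 := mu) (k g (cst 1))).
  exact: mk.
exact: k0.
Qed.

End fubini_relation.

Section hardy_operator.
Context d (T : measurableType d) (R : realType).
Implicit Types (mu nu : {sigma_finite_measure set T -> \bar R}) (a : T -> R).

(** The order is that of the values of [a]. The dual operator is [hardy mu (\- a)], see [hardyN], so
    each Hardy inequality is proved only once. *)
Definition hardy (mu : set T -> \bar R) a (g : T -> \bar R) (x : T) : \bar R :=
  \int[mu]_(t in [set t | (a x <= a t)%R]) g t.

Lemma measurable_le_rel a : measurable_fun setT a ->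
  measurable [set z : T * T | (a z.1 <= a z.2)%R].
Proof.
move=> ma; rewrite -[X in measurable X]setTI; apply: measurable_fun_le => //.
  exact: (measurableT_comp ma).
exact: (measurableT_comp ma).
Qed.

Lemma measurable_lt_rel a : measurable_fun setT a ->
  measurable [set z : T * T | (a z.1 < a z.2)%R].
Proof.
move=> ma.
rewrite [X in measurable X](_ : _ = ~` [set z : T * T | (a z.2 <= a z.1)%R]).
  apply: measurableC; rewrite -[X in measurable X]setTI; apply: measurable_fun_le => //.
    exact: (measurableT_comp ma).
  exact: (measurableT_comp ma).
by apply/seteqP; split => z /=; rewrite ltNge => /negP.
Qed.

Lemma measurable_hardy mu a g : measurable_fun setT a -> measurable_fun setT g ->
  (forall x, 0 <= g x) -> measurable_fun setT (hardy mu a g).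
Proof.
by move=> ma mg g0; exact: measurable_integral_section_r (measurable_le_rel ma) _ mg g0.
Qed.

Lemma hardy_ge0 mu a g x : (forall x, 0 <= g x) -> 0 <= hardy mu a g x.
Proof. by move=> g0; exact: integral_ge0. Qed.

Lemma fubini_hardy mu nu a g h : measurable_fun setT a ->
  measurable_fun setT g -> measurable_fun setT h ->
  (forall x, 0 <= g x) -> (forall x, 0 <= h x) ->
  \int[nu]_x (h x * hardy mu a g x) =
  \int[mu]_t (g t * \int[nu]_(x in [set x | (a x <= a t)%R]) h x).
Proof.
by move=> ma mg mh g0 h0; exact: (fubini_relation mu nu (measurable_le_rel ma)).
Qed.

End hardy_operator.

(** * Hardy inequalities *)

(** The first factor comes from Hoelder's inequality against [tau], raised to the power p - 1; the
    second from the [nu]-integral left after exchanging the integrations. *)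
Definition hardy_pp_const (R : realType) (p : R) : R :=
  (power_const (1 - p^-1) `^ (p - 1) * power_const p^-1)%R.

Section hardy_pp.
Context d (T : measurableType d) (R : realType).
Variables (tau nu : {sigma_finite_measure set T -> \bar R}) (a K : T -> R).
Variables (p B : R).
Hypotheses (ma : measurable_fun setT a) (mK : measurable_fun setT K).
Hypotheses (K0 : forall x, (0 < K x)%R) (p1 : (1 < p)%R) (B0 : (0 < B)%R).
Hypothesis aK : forall x y, (a x <= a y)%R -> (K y <= K x)%R.
Hypothesis tauK : forall x, tau [set t | (a x <= a t)%R] <= (K x)%:E.
Hypothesis nuK : forall t, nu [set x | (a x <= a t)%R] <= (B * K t `^ (1 - p))%:E.

Let p0 : (0 < p)%R := lt_trans ltr01 p1.
Let e : R := (1 - p^-1)%R.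
Let th0 : (0 < p^-1)%R.
Proof. by rewrite invr_gt0. Qed.
Let th1 : (p^-1 < 1)%R.
Proof. by rewrite invf_lt1. Qed.
Let e0 : (0 < e)%R.
Proof. by rewrite subr_gt0. Qed.
Let ep : (e * p = p - 1)%R.
Proof. by rewrite /e mulrBl mul1r mulVf// gt_eqF. Qed.

Let mle x : measurable [set t | (a x <= a t)%R].
Proof. by rewrite -[X in measurable X]setTI; exact: measurable_fun_le. Qed.
Let mge x : measurable [set t | (a t <= a x)%R].
Proof. by rewrite -[X in measurable X]setTI; exact: measurable_fun_le. Qed.
Let mleK (L : T -> R) c : measurable_fun setT L -> measurable [set t | (L t <= c)%R].
Proof. by move=> mL; rewrite -[X in measurable X]setTI; exact: measurable_fun_le. Qed.

Let mKp r : measurable_fun setT (fun x => (K x `^ r)%:E : \bar R).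
Proof. by apply/measurable_EFinP; apply: (measurableT_comp (measurable_powR _)). Qed.

(** As [K] decreases along [a], the tail lies in {K <= K x}. The pointwise bound on [tau] becomes a
    bound on {K <= c} once the order is reversed. *)
Let tau_power x : \int[tau]_(t in [set t | (a x <= a t)%R]) (K t `^ (e - 1))%:E <=
  (power_const e * K x `^ e)%:E.
Proof.
apply: (@le_trans _ _ (\int[tau]_(t in [set t | (K t <= K x)%R]) (K t `^ (e - 1))%:E)).
  apply: ge0_subset_integralT => //; first exact: mleK.
    by move=> t; rewrite lee_fin powR_ge0.
  by move=> t /= /aK.
apply: integral_power_sublevel => // c c0.
apply: (@sublevel_measure _ _ _ _ (\- a)%R) => //; last 2 first.
- by move=> y z /=; rewrite lerN2 => /aK.
- by move=> y; under eq_set do rewrite lerN2; exact: tauK.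
- exact: measurableT_comp.
- exact: ltW.
Qed.

(** The bound on [nu] below a point. It increases along [a], so [nu] satisfies for [kappa] the
    sublevel estimate that [tau] satisfies for [K]. *)
Let kappa x : R := (B * K x `^ (1 - p))%R.

Let kappa0 x : (0 < kappa x)%R.
Proof. by rewrite mulr_gt0// powR_gt0. Qed.

Let mkappa : measurable_fun setT kappa.
Proof. by apply: measurable_funM => //; apply: (measurableT_comp (measurable_powR _)). Qed.

Let akappa x y : (a x <= a y)%R -> (kappa x <= kappa y)%R.
Proof.
move=> xy; rewrite /kappa ler_pM2l//.
have -> : (1 - p = - (p - 1))%R by ring.
rewrite !powRN lef_pV2 ?posrE ?powR_gt0//.
by rewrite ge0_ler_powR ?nnegrE ?subr_ge0 ?(ltW p1) ?(ltW (K0 _))// aK.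
Qed.

Let nu_power t : \int[nu]_(x in [set x | (a x <= a t)%R]) (K x `^ (p - 1 - e))%:E <=
  (power_const p^-1 * B * K t `^ (- e))%:E.
Proof.
have kE x : (K x `^ (p - 1 - e) = B `^ e * kappa x `^ (p^-1 - 1))%R.
  rewrite /kappa powRM ?powR_ge0 ?(ltW B0)// mulrA -powRD_gt0//.
  have -> : (e + (p^-1 - 1) = 0)%R by rewrite /e; ring.
  rewrite powRr0 mul1r -powRrM; congr (_ `^ _)%R.
  by rewrite /e; field; rewrite gt_eqF.
under eq_integral do rewrite kE EFinM.
have mkp : measurable_fun setT (fun x => (kappa x `^ (p^-1 - 1))%:E : \bar R).
  by apply/measurable_EFinP; apply: (measurableT_comp (measurable_powR _)).
rewrite ge0_integralZl_EFin ?powR_ge0//; last 2 first.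
- by move=> x _; rewrite lee_fin powR_ge0.
- exact: measurable_funTS.
have -> : (power_const p^-1 * B * K t `^ (- e) =
    B `^ e * (power_const p^-1 * kappa t `^ p^-1))%R.
  rewrite /kappa powRM ?powR_ge0 ?(ltW B0)// -powRrM.
  have -> : ((1 - p) * p^-1 = - e)%R by rewrite /e; field; rewrite gt_eqF.
  have {1}-> : (B = B `^ e * B `^ p^-1)%R.
    by rewrite -powRD_gt0// /e subrK powRr1// ltW.
  by ring.
rewrite [leRHS]EFinM lee_wpmul2l ?lee_fin ?powR_ge0//.
apply: (@le_trans _ _ (\int[nu]_(x in [set x | (kappa x <= kappa t)%R])
    (kappa x `^ (p^-1 - 1))%:E)).
  apply: ge0_subset_integralT => //; first exact: mleK.
    by move=> x; rewrite lee_fin powR_ge0.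
  by move=> x /= /akappa.
apply: integral_power_sublevel => // c c0.
by apply: (@sublevel_measure _ _ _ _ a) => //; exact: ltW.
Qed.

(* Hoelder's inequality with the weight K ^ (e / p) reduces the claim to the
   two power integrals above. *)
Lemma hardy_pp_gt1 (f : T -> \bar R) : measurable_fun setT f -> (forall x, 0 <= f x) ->
  \int[nu]_x (hardy tau a f x `^ p) <= (hardy_pp_const p * B)%:E * \int[tau]_x (f x `^ p).
Proof.
move=> mf f0.
pose F t := f t `^ p * (K t `^ e)%:E.
have mF : measurable_fun setT F.
  by apply: emeasurable_funM => //; exact: measurable_funP_poweR.
have F0 t : 0 <= F t by rewrite mule_ge0 ?poweR_ge0// lee_fin powR_ge0.
have Hp x : hardy tau a f x `^ p <=
    (power_const e `^ (p - 1))%:E * ((K x `^ (p - 1 - e))%:E * hardy tau a F x).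
  have fE t : f t = F t `^ p^-1 * ((K t `^ (e - 1))%:E) `^ (1 - p^-1).
    rewrite /F poweRM ?poweR_ge0 ?lee_fin ?powR_ge0// poweRK ?(gt_eqF p0)//.
    rewrite !poweR_EFin -muleA -EFinM -!powRrM -powRD_gt0//.
    rewrite (_ : _ + _ = 0)%R ?powRr0 ?mule1// /e; ring.
  have h : hardy tau a f x <= (hardy tau a F x) `^ p^-1 * (power_const e * K x `^ e)%:E `^ e.
    rewrite /hardy; under eq_integral do rewrite fE.
    apply: le_trans.
      apply: (@hoelder_poweR_in _ _ _ tau _ F (fun t => (K t `^ (e - 1))%:E) p^-1%R
        (mle x)) => //; first exact/andP.
      by move=> t; rewrite lee_fin powR_ge0.
    rewrite lee_wpmul2l ?poweR_ge0// lee_poweR ?(ltW e0)// ?tau_power//.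
    by apply: integral_ge0 => t _; rewrite lee_fin powR_ge0.
  apply: (le_trans (lee_poweR (ltW p0) (hardy_ge0 _ _ _ f0) h)).
  rewrite poweRM ?poweR_ge0// poweRVK ?(gt_eqF p0) ?hardy_ge0//.
  rewrite -poweRrM ep poweR_EFin powRM ?powR_ge0 ?(ltW (power_const_gt0 e0))//.
  rewrite -powRrM (_ : e * (p - 1) = p - 1 - e)%R; last by rewrite mulrBr ep mulr1.
  by rewrite muleC EFinM muleA.
apply: (@le_trans _ _ (\int[nu]_x ((power_const e `^ (p - 1))%:E *
    ((K x `^ (p - 1 - e))%:E * hardy tau a F x)))).
  apply: ge0_integralT_le => //.
  - by apply: measurable_funP_poweR; exact: measurable_hardy.
  - by apply: measurable_funeM; apply: emeasurable_funM => //; exact: measurable_hardy.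
  - by move=> x; exact: poweR_ge0.
rewrite ge0_integralZl_EFin ?powR_ge0//; last 2 first.
- by move=> x _; rewrite mule_ge0 ?hardy_ge0// lee_fin powR_ge0.
- by apply: emeasurable_funM => //; exact: measurable_hardy.
rewrite fubini_hardy//; last by move=> x; rewrite lee_fin powR_ge0.
rewrite /hardy_pp_const -/e -mulrA EFinM -muleA lee_wpmul2l ?lee_fin ?powR_ge0//.
rewrite -ge0_integralZl_EFin//; last 3 first.
- by move=> x _; exact: poweR_ge0.
- exact: measurable_funP_poweR.
- by rewrite mulr_ge0 ?(ltW B0)// ltW// power_const_gt0.
apply: ge0_integralT_le => //.
- apply: emeasurable_funM => //.
  have -> : (fun t => \int[nu]_(x in [set x | (a x <= a t)%R]) (K x `^ (p - 1 - e))%:E) =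
    hardy nu (\- a)%R (fun x => (K x `^ (p - 1 - e))%:E).
    by apply/funext => t; rewrite /hardy; under [in RHS]eq_set do rewrite /= lerN2.
  apply: measurable_hardy => //; first exact: measurableT_comp.
  by move=> x; rewrite lee_fin powR_ge0.
- by apply: measurable_funeM; exact: measurable_funP_poweR.
- by move=> t; rewrite mule_ge0// integral_ge0// => x _; rewrite lee_fin powR_ge0.
move=> t; apply: (@le_trans _ _ (F t * (power_const p^-1 * B * K t `^ (- e))%:E)).
  by rewrite lee_wpmul2l.
have -> : (power_const p^-1 * B * K t `^ (- e) = K t `^ (- e) * (power_const p^-1 * B))%R.
  by ring.
rewrite /F EFinM muleA -(muleA (f t `^ p)) -EFinM -powRD_gt0// subrr powRr0 mule1.
by rewrite muleC.
Qed.

End hardy_pp.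

(** * Weighted Hardy inequalities, and their transfer from L^p to L^q for p <= q *)

Section hardy_bounds.
Context d (T : measurableType d) (R : realType).
Implicit Types (mu nu : {sigma_finite_measure set T -> \bar R}) (a W M om : T -> R).

(** The L^p Hardy inequality as a property of [om] and [M], to be supplied separately for p = 1 and
    p > 1. The measure [nu] is quantified because the transfers to L^q apply it to [nu] times an
    auxiliary weight. *)
Definition hardy_bound mu a om M (p C : R) : Prop :=
  forall nu (B : R), (0 < B)%R ->
    (forall t, nu [set x | (a x <= a t)%R] <= (B / M t)%:E) ->
    forall g : T -> \bar R, measurable_fun setT g -> (forall x, 0 <= g x) ->
    \int[nu]_x (hardy mu a g x `^ p) <= (C * B)%:E * \int[mu]_x (g x `^ p * (om x)%:E).

Lemma measurable_leset a c : measurable_fun setT a -> measurable [set t | (a t <= c)%R].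
Proof. by move=> ma; rewrite -[X in measurable X]setTI; exact: measurable_fun_le. Qed.

Lemma measurable_geset a c : measurable_fun setT a -> measurable [set t | (c <= a t)%R].
Proof. by move=> ma; rewrite -[X in measurable X]setTI; exact: measurable_fun_le. Qed.

Lemma measurable_EFin_powR a r : measurable_fun setT a ->
  measurable_fun setT (fun x => (a x `^ r)%:E : \bar R).
Proof.
by move=> ma; apply/measurable_EFinP; apply: (measurableT_comp (measurable_powR _)).
Qed.

Lemma hardyN mu a g x :
  \int[mu]_(t in [set t | (a t <= a x)%R]) g t = hardy mu (\- a)%R g x.
Proof. by rewrite /hardy; under [in RHS]eq_set do rewrite /= lerN2. Qed.

Lemma measurable_hardyN mu a g : measurable_fun setT a -> measurable_fun setT g ->
  (forall x, 0 <= g x) ->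
  measurable_fun setT (fun x => \int[mu]_(t in [set t | (a t <= a x)%R]) g t).
Proof.
move=> ma mg g0.
have -> : (fun x => \int[mu]_(t in [set t | (a t <= a x)%R]) g t) = hardy mu (\- a)%R g.
  by apply/funext => x; exact: hardyN.
by apply: measurable_hardy => //; exact: measurableT_comp.
Qed.

(** After exchanging the integrations, [g t] is multiplied by nu {a <= a t} <= B / M t, and 1 / M <=
    om almost everywhere. *)
Lemma hardy_bound1 mu a om M : measurable_fun setT a -> measurable_fun setT om ->
  (forall x, 0 <= om x)%R ->
  (forall x, 0 < M x)%R -> {ae mu, forall x, (1 <= om x * M x)%R} ->
  hardy_bound mu a om M 1 1.
Proof.
move=> ma mom om0 M0 omM nu B B0 nuM g mg g0.
under eq_integral do rewrite poweRe1 ?hardy_ge0//.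
under [in leRHS]eq_integral do rewrite poweRe1//.
rewrite mul1r (_ : \int[nu]_x hardy mu a g x = \int[nu]_x (cst 1 x * hardy mu a g x)); last first.
  by apply: eq_integral => x _; rewrite mul1e.
rewrite fubini_hardy//.
have mgom : measurable_fun setT (fun x => g x * (om x)%:E).
  by apply: emeasurable_funM => //; exact/measurable_EFinP.
rewrite -ge0_integralZl_EFin ?(ltW B0)//; last by move=> x _; rewrite mule_ge0// lee_fin.
apply: ae_ge0_le_integral => //.
- by move=> x _; rewrite mule_ge0// integral_ge0.
- by apply: emeasurable_funM => //; exact: measurable_hardyN.
- by move=> x _; rewrite !mule_ge0// lee_fin// ltW.
- exact: measurable_funeM.
apply: filterS omM => t omM _.
rewrite integral_cst ?mul1e; last exact: measurable_leset.
apply: (@le_trans _ _ (g t * (B / M t)%:E)); first by apply: lee_wpmul2l => //; exact: nuM.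
rewrite muleCA -EFinM lee_wpmul2l// lee_fin ler_wpM2l ?(ltW B0)//.
by rewrite -[leLHS]mul1r ler_pdivrMr.
Qed.

(** Put tau = om ^ s mu with s = - 1 / (p - 1). The substitution g = f * om ^ s turns g dmu into f
    dtau and, as - s p + s = 1, g ^ p om dmu into f ^ p dtau; the hypothesis on [K] is the tail
    bound for [tau]. *)
Lemma hardy_bound_gt1 mu a om (K : T -> R) (p : R) : (1 < p)%R ->
  measurable_fun setT a -> measurable_fun setT om -> measurable_fun setT K ->
  (forall x, 0 <= om x)%R -> {ae mu, forall x, (0 < om x)%R} ->
  (forall x, 0 < K x)%R -> (forall x y, (a x <= a y)%R -> (K y <= K x)%R) ->
  (forall x, \int[mu]_(t in [set t | (a x <= a t)%R]) (om t `^ (- (p - 1)^-1))%:E <= (K x)%:E) ->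
  hardy_bound mu a om (fun x => K x `^ (p - 1))%R p (hardy_pp_const p).
Proof.
move=> p1 ma mom mK om0 omp K0 aK muK nu B B0 nuM g mg g0.
have p0 : (0 < p)%R by exact: lt_trans p1.
set s := (- (p - 1)^-1)%R in muK.
have s0 : (s != 0)%R by rewrite oppr_eq0 invr_eq0 subr_eq0 gt_eqF.
have msig : measurable_fun setT (fun x => om x `^ s)%R.
  by apply: (measurableT_comp (measurable_powR _)).
have sig0 x : (0 <= om x `^ s)%R by exact: powR_ge0.
pose tau : {sigma_finite_measure set T -> \bar R} := density_measure mu msig sig0.
pose f x := g x * (om x `^ (- s))%:E.
have mf : measurable_fun setT f by apply: emeasurable_funM => //; exact: measurable_EFin_powR.
have f0 x : 0 <= f x by rewrite mule_ge0// lee_fin powR_ge0.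
have mfs : measurable_fun setT (fun x => f x * (om x `^ s)%:E).
  by apply: emeasurable_funM => //; exact: measurable_EFin_powR.
have gf x : hardy mu a g x <= hardy tau a f x.
  rewrite {2}/hardy integral_density_in//; last exact: measurable_geset.
  apply: ae_ge0_le_integral => //.
  - exact: measurable_geset.
  - exact: measurable_funTS.
  - by move=> t _; rewrite mule_ge0// lee_fin powR_ge0.
  - exact: measurable_funTS.
  apply: filterS omp => t om_t _.
  by rewrite /f -muleA -EFinM -powRD_gt0// addNr powRr0 mule1.
apply: (@le_trans _ _ (\int[nu]_x (hardy tau a f x `^ p))).
  apply: ge0_integralT_le => //.
  - by apply: measurable_funP_poweR; exact: measurable_hardy.
  - by apply: measurable_funP_poweR; exact: measurable_hardy.
  - by move=> x; exact: poweR_ge0.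
  - by move=> x; rewrite lee_poweR ?(ltW p0) ?hardy_ge0.
have tauK x : tau [set t | (a x <= a t)%R] <= (K x)%:E by exact: muK.
have nuK t : nu [set x | (a x <= a t)%R] <= (B * K t `^ (1 - p))%:E.
  apply: (le_trans (nuM t)); rewrite lee_fin.
  by rewrite -(opprB p 1) powRN.
apply: (le_trans (hardy_pp_gt1 ma mK K0 p1 B0 aK tauK nuK mf f0)).
have C0 : (0 <= hardy_pp_const p)%R.
  rewrite /hardy_pp_const mulr_ge0 ?powR_ge0// ltW// power_const_gt0//.
  by rewrite invr_gt0.
apply: lee_wpmul2l; first by rewrite lee_fin mulr_ge0 ?(ltW B0).
have -> : \int[tau]_x (f x `^ p) = \int[mu]_x (f x `^ p * (om x `^ s)%:E).
  by apply: integral_density => [|x]; [exact: measurable_funP_poweR|exact: poweR_ge0].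
rewrite le_eqVlt; apply/orP; left; apply/eqP; apply: eq_integral => x _.
rewrite /f poweRM ?lee_fin ?powR_ge0// poweR_EFin -muleA -EFinM; congr (_ * _%:E).
have [->|omx] := eqVneq (om x) 0%R; first by rewrite (powR0 s0) mulr0.
have omx0 : (0 < om x)%R by rewrite lt0r omx om0.
rewrite -powRrM -powRD_gt0//.
have -> : (- s * p + s = 1)%R by rewrite /s; field; rewrite subr_eq0 gt_eqF.
by rewrite powRr1.
Qed.

Section fixed_order.
Variables (mu nu : {sigma_finite_measure set T -> \bar R}) (a W : T -> R).
Hypotheses (ma : measurable_fun setT a) (W0 : forall x, (0 < W x)%R).
Hypothesis nuW : forall x, nu [set y | (a y <= a x)%R] = (W x)%:E.

Lemma measurable_W : measurable_fun setT W.
Proof.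
apply/measurable_EFinP; rewrite (_ : EFin \o W = fun x => nu [set y | (a y <= a x)%R]).
  rewrite (_ : (fun _ => _) = (fun x => \int[nu]_(y in [set y | (a y <= a x)%R]) cst 1 y)).
    exact: measurable_hardyN.
  by apply/funext => x; rewrite integral_cst ?mul1e//; exact: measurable_leset.
by apply/funext => x /=; rewrite nuW.
Qed.
Let mW := measurable_W.

Let nuW_le x : nu [set y | (a y <= a x)%R] <= (W x)%:E.
Proof. by rewrite nuW. Qed.

Lemma homo_W x y : (a x <= a y)%R -> (W x <= W y)%R.
Proof.
move=> xy; rewrite -lee_fin -!nuW le_measure ?inE//.
- exact: measurable_leset.
- exact: measurable_leset.
- by move=> z /= zx; exact: le_trans xy.
Qed.
Let aW := homo_W.

Lemma sublevel_W c : (0 <= c)%R -> nu [set x | (W x <= c)%R] <= c%:E.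
Proof. by move=> c0; apply: (sublevel_measure ma) => //; exact: nuW_le. Qed.

Lemma integral_powerW al t : (0 < al)%R ->
  \int[nu]_(x in [set x | (a x <= a t)%R]) (W x `^ (al - 1))%:E <=
  (power_const al * W t `^ al)%:E.
Proof.
move=> al0; apply: (@le_trans _ _ (\int[nu]_(x in [set x | (W x <= W t)%R])
    (W x `^ (al - 1))%:E)).
  apply: ge0_subset_integralT; [exact: measurable_leset|exact: measurable_leset| | |].
  - exact: measurable_EFin_powR.
  - by move=> x; rewrite lee_fin powR_ge0.
  - by move=> x /= /aW.
by apply: integral_power_sublevel => // c c0; exact: sublevel_W (ltW c0).
Qed.

(** An embedding of Lorentz type. By monotonicity G x ^ p * W x ^ (p / q) is at most the integral
    [J] on the right; this bounds the second factor of G ^ q = G ^ p * G ^ (p (q / p - 1)). *)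
Lemma integral_decreasing_le (G : T -> \bar R) (p q : R) : (0 < p)%R -> (p <= q)%R ->
  measurable_fun setT G -> (forall x, 0 <= G x) ->
  (forall x y, (a x <= a y)%R -> G y <= G x) ->
  \int[nu]_x (G x `^ q) <= (\int[nu]_x (G x `^ p * (W x `^ (p / q - 1))%:E)) `^ (q / p).
Proof.
move=> p0 pq mG G0 aG.
have q0 : (0 < q)%R by exact: lt_le_trans pq.
set J := \int[nu]_x (_ * _).
have mGW : measurable_fun setT (fun x => G x `^ p * (W x `^ (p / q - 1))%:E).
  by apply: emeasurable_funM; [exact: measurable_funP_poweR|exact: measurable_EFin_powR].
have GW0 x : 0 <= G x `^ p * (W x `^ (p / q - 1))%:E.
  by rewrite mule_ge0 ?poweR_ge0// lee_fin powR_ge0.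
have J0 : 0 <= J by exact: integral_ge0.
have qp0 : (0 < q / p)%R by exact: divr_gt0.
have : J != +oo \/ J = +oo by have [->|?] := eqVneq J +oo; [right|left].
case=> [Jfin|->]; last by rewrite poweRyr ?leey// gt_eqF.
have [j Jj] : exists j, J = j%:E.
  by exists (fine J); rewrite fineK// ge0_fin_numE// ltey.
have j0 : (0 <= j)%R by rewrite -lee_fin -Jj.
have GJ x : G x `^ p <= (j * W x `^ (- (p / q)))%:E.
  have h : G x `^ p * (W x `^ (p / q))%:E <= j%:E.
    rewrite -Jj /J; apply: (@le_trans _ _ (\int[nu]_(y in [set y | (a y <= a x)%R])
       (G y `^ p * (W y `^ (p / q - 1))%:E))); last first.
      exact: ge0_subset_integralT (measurable_leset _ ma) measurableT mGW GW0 (@subsetT _ _).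
    apply: (@le_trans _ _ (\int[nu]_(y in [set y | (a y <= a x)%R])
       (cst (G x `^ p * (W x `^ (p / q - 1))%:E) y))).
      rewrite integral_cst; last exact: measurable_leset.
      rewrite [X in _ <= _ * X]nuW -muleA -EFinM -{3}(powRr1 (ltW (W0 x))).
      by rewrite -powRD_gt0// subrK.
    apply: ge0_integral_in_le => //; first exact: measurable_leset.
      by move=> y; exact: GW0.
    move=> y /= yx; apply: lee_pmul => //; rewrite ?poweR_ge0 ?lee_fin ?powR_ge0//.
      by rewrite lee_poweR ?(ltW p0)// aG.
    have -> : (p / q - 1 = - (1 - p / q))%R by ring.
    rewrite !powRN lef_pV2 ?posrE ?powR_gt0// ge0_ler_powR ?nnegrE ?(ltW (W0 _)) ?aW//.
    by rewrite subr_ge0 ler_pdivrMr// mul1r.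
  rewrite powRN EFinM -[leLHS]mule1.
  rewrite -(@mulfV _ (W x `^ (p / q))%R) ?(gt_eqF (powR_gt0 _ (W0 x)))// EFinM muleA.
  by rewrite lee_wpmul2r// lee_fin invr_ge0 powR_ge0.
apply: (@le_trans _ _ (\int[nu]_x ((j `^ (q / p - 1))%:E * (G x `^ p * (W x `^ (p / q -
  1))%:E)))).
  apply: ge0_integralT_le.
  - exact: measurable_funP_poweR.
  - exact: measurable_funeM.
  - by move=> x; exact: poweR_ge0.
  move=> x; have -> : (G x `^ q = G x `^ (p + p * (q / p - 1)))%E.
    by congr (_ `^ _); field; rewrite gt_eqF.
  have qp1 : (0 <= q / p - 1)%R by rewrite subr_ge0 ler_pdivlMr// mul1r.
  rewrite poweRD_ge0//; [|exact: ltW|by rewrite mulr_ge0// ltW].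
  rewrite muleCA lee_wpmul2l ?poweR_ge0// poweRrM.
  apply: (le_trans (lee_poweR qp1 (poweR_ge0 _ _) (GJ x))).
  rewrite poweR_EFin -EFinM lee_fin powRM ?powR_ge0// ler_wpM2l ?powR_ge0// -powRrM.
  have -> : (- (p / q) * (q / p - 1) = p / q - 1)%R by field; rewrite !gt_eqF.
  by [].
rewrite ge0_integralZl_EFin ?powR_ge0// -/J Jj -EFinM poweR_EFin lee_fin.
by rewrite mulrC mulr_powRB1.
Qed.

Variables (om M : T -> R) (p C : R).
Hypotheses (p0 : (0 < p)%R) (C0 : (0 < C)%R) (M0 : forall x, (0 < M x)%R).
Hypothesis HB : hardy_bound mu a om M p C.

(** The Hardy transform decreases along [a], so its L^q norm is controlled by an L^p norm for the
    measure W ^ (p / q - 1) nu. The distribution function of that measure is at most a multiple of W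
    ^ (p / q), which the hypothesis bounds by A ^ p / M. *)
Lemma hardy_pq (q A : R) : (p <= q)%R -> (0 < A)%R ->
  (forall t, W t `^ q^-1 * M t `^ p^-1 <= A)%R ->
  forall g : T -> \bar R, measurable_fun setT g -> (forall x, 0 <= g x) ->
  \int[nu]_x (hardy mu a g x `^ q) <=
  ((C * (power_const (p / q) * A `^ p))%:E * \int[mu]_x (g x `^ p * (om x)%:E)) `^ (q / p).
Proof.
move=> pq A0 WMA g mg g0.
have q0 : (0 < q)%R by exact: lt_le_trans pq.
have pq0 : (0 < p / q)%R by exact: divr_gt0.
have mH := measurable_hardy mu ma mg g0.
have H0 x : 0 <= hardy mu a g x by exact: hardy_ge0.
apply: le_trans (integral_decreasing_le p0 pq mH H0 _) _.
  move=> x y xy; apply: ge0_subset_integralT => //; try exact: measurable_geset.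
  by move=> t /= /(le_trans xy).
have mk : measurable_fun setT (fun x => W x `^ (p / q - 1))%R.
  by apply: (measurableT_comp (measurable_powR _)).
have k0 x : (0 <= W x `^ (p / q - 1))%R by exact: powR_ge0.
pose nu' : {sigma_finite_measure set T -> \bar R} := density_measure nu mk k0.
rewrite -(@integral_density _ _ _ nu _ mk k0); last 2 first.
- exact: measurable_funP_poweR.
- by move=> x; exact: poweR_ge0.
apply: lee_poweR; first by rewrite divr_ge0// ltW.
  by apply: integral_ge0 => x _; exact: poweR_ge0.
apply: (HB (nu := nu')) => //.
  by rewrite mulr_gt0 ?powR_gt0// power_const_gt0.
move=> t; apply: (le_trans (integral_powerW t pq0)); rewrite lee_fin -mulrA.
rewrite ler_wpM2l ?(ltW (power_const_gt0 pq0))// ler_pdivlMr//.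
have -> : (W t `^ (p / q) * M t = (W t `^ q^-1 * M t `^ p^-1) `^ p)%R.
  rewrite powRM ?powR_ge0// -!powRrM mulVf ?(gt_eqF p0)// powRr1 ?(ltW (M0 t))//.
  by rewrite (mulrC p).
by rewrite ge0_ler_powR ?(ltW p0)// nnegrE ?mulr_ge0 ?powR_ge0// ltW.
Qed.

End fixed_order.

End hardy_bounds.

(** * Transfer of the Hardy inequality from L^p to L^q for q < p *)

Section hardy_qp.
Context d (T : measurableType d) (R : realType).
Variables (mu nu : {sigma_finite_measure set T -> \bar R}) (a W : T -> R).
Hypotheses (ma : measurable_fun setT a) (W0 : forall x, (0 < W x)%R).
Hypothesis nuW : forall x, nu [set y | (a y <= a x)%R] = (W x)%:E.
Variables (om M : T -> R) (p q C : R).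
Hypotheses (q0 : (0 < q)%R) (qp : (q < p)%R) (C0 : (0 < C)%R).
Hypotheses (mM : measurable_fun setT M) (M0 : forall x, (0 < M x)%R).
Hypothesis aM : forall x y, (a x <= a y)%R -> (M y <= M x)%R.
Hypothesis mom : measurable_fun setT om.
Hypothesis om0 : forall x, (0 <= om x)%R.
Hypothesis HB : hardy_bound mu a om M p C.

Let rho : R := (q / (p - q))%R.
Let I : \bar R := \int[nu]_x (W x `^ rho * M x `^ rho)%:E.
Hypothesis Ifin : I < +oo.

Let p0 : (0 < p)%R := lt_trans q0 qp.
Let rho0 : (0 < rho)%R.
Proof. by rewrite divr_gt0// subr_gt0. Qed.
Let rhoV0 : (0 < rho^-1)%R.
Proof. by rewrite invr_gt0. Qed.
Let mW : measurable_fun setT W := measurable_W ma nuW.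
Let aW := homo_W ma nuW.

Let mlt x : measurable [set y | (a x < a y)%R].
Proof. exact: measurable_section_r (measurable_lt_rel ma) x. Qed.

Let mMr : measurable_fun setT (fun x => (M x `^ rho)%:E : \bar R).
Proof. exact: measurable_EFin_powR. Qed.

Let mWr r : measurable_fun setT (fun x => (W x `^ r)%:E : \bar R).
Proof. exact: measurable_EFin_powR. Qed.

Let Mr0 x : 0 <= (M x `^ rho)%:E.
Proof. by rewrite lee_fin powR_ge0. Qed.

Let mWM : measurable_fun setT (fun x => (W x `^ rho * M x `^ rho)%:E).
Proof. by under eq_fun do rewrite EFinM; exact: emeasurable_funM. Qed.

Let WM0 x : 0 <= (W x `^ rho * M x `^ rho)%:E.
Proof. by rewrite lee_fin mulr_ge0 ?powR_ge0. Qed.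

Let Q x : \bar R := \int[nu]_(y in [set y | (a x < a y)%R]) (M y `^ rho)%:E.

Let Q0 x : 0 <= Q x.
Proof. by apply: integral_ge0 => y _. Qed.

Let mQ : measurable_fun setT Q.
Proof. exact: (measurable_integral_section_r nu (measurable_lt_rel ma)). Qed.

(** Since [W] increases along [a], W x ^ rho * Q x <= I. *)
Let Qfin x : Q x < +oo.
Proof.
have h : (W x `^ rho)%:E * Q x <= I.
  rewrite -ge0_integralZl_EFin ?powR_ge0//; last exact: measurable_funTS.
  apply: (@le_trans _ _ (\int[nu]_(y in [set y | (a x < a y)%R]) (W y `^ rho * M y `^ rho)%:E)).
    apply: ge0_integral_in_le => //; first exact: measurable_funeM.
      by move=> y; rewrite mule_ge0// lee_fin powR_ge0.
    move=> y /= xy; rewrite -EFinM lee_fin ler_wpM2r ?powR_ge0//.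
    by rewrite ge0_ler_powR ?(ltW rho0) ?nnegrE ?(ltW (W0 _))// aW// ltW.
  exact: ge0_subset_integralT.
rewrite ltey; apply/eqP => Qy; move: (le_lt_trans h Ifin).
by rewrite Qy gt0_muley ?ltxx// lte_fin powR_gt0.
Qed.

(** The integral of M ^ rho after replacing [M y] by [M x] wherever a y <= a x. As [M] decreases, it
    dominates M t ^ rho * W t for every [t] above [x], yet its integral against W ^ (rho - 1) is at
    most a multiple of [I]. *)
Let Pt x : R := (M x `^ rho * W x + fine (Q x))%R.

Let PtE x : (Pt x)%:E = (M x `^ rho * W x)%:E + Q x.
Proof. by rewrite /Pt EFinD fineK// ge0_fin_numE. Qed.

Let Pt0 x : (0 < Pt x)%R.
Proof. by rewrite ltr_pwDl ?fine_ge0// mulr_gt0 ?powR_gt0. Qed.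

Let mPt : measurable_fun setT Pt.
Proof.
apply/measurable_EFinP; rewrite (_ : EFin \o Pt = fun x => (M x `^ rho * W x)%:E + Q x).
  apply: emeasurable_funD => //; apply/measurable_EFinP; apply: measurable_funM => //.
  exact: (measurableT_comp (measurable_powR _)).
by apply/funext => x /=; rewrite PtE.
Qed.

Let PtM x t : (a x <= a t)%R -> (M t `^ rho * W t <= Pt x)%R.
Proof.
move=> xt; rewrite -lee_fin PtE.
have mD : measurable ([set y | (a x < a y)%R] `&` [set y | (a y <= a t)%R]).
  by apply: measurableI => //; exact: measurable_leset.
have tE : [set y | (a y <= a t)%R] = [set y | (a y <= a x)%R] `|`
    ([set y | (a x < a y)%R] `&` [set y | (a y <= a t)%R]).
  apply/seteqP; split => y /=; last by case=> [/le_trans|[]//]; apply.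
  by move=> yt; case: (leP (a y) (a x)) => yx; [left|right].
have -> : (M t `^ rho * W t)%:E = (M t `^ rho)%:E * ((W x)%:E +
    nu ([set y | (a x < a y)%R] `&` [set y | (a y <= a t)%R])).
  rewrite EFinM -!nuW {1}tE measureU//; first exact: measurable_leset.
  by apply/seteqP; split => y //= -[yx [/lt_le_trans/(_ yx)]]; rewrite ltxx.
rewrite ge0_muleDr ?lee_fin ?(ltW (W0 x))//; apply: leeD.
  rewrite -EFinM lee_fin ler_wpM2r ?(ltW (W0 x))//.
  by rewrite ge0_ler_powR ?(ltW rho0) ?nnegrE ?(ltW (M0 _))// aM.
rewrite -integral_cst// /Q.
apply: (@le_trans _ _ (\int[nu]_(y in [set y | (a x < a y)%R] `&` [set y | (a y <= a t)%R])
   (M y `^ rho)%:E)).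
  apply: ge0_integral_in_le => //; first by move=> y; exact: Mr0.
  move=> y [_ /= yt].
  by rewrite lee_fin ge0_ler_powR ?(ltW rho0) ?nnegrE ?(ltW (M0 _))// aM.
by apply: ge0_subset_integralT => // y [].
Qed.

(** With these exponents the distribution function of psi nu is at most a multiple of 1 / M, and psi
    ^ (- rho) equals W ^ (rho - 1) * Pt. *)
Let psi x : R := (W x `^ (rho^-1 - 1) * Pt x `^ (- rho^-1))%R.

Let psi0 x : (0 < psi x)%R.
Proof. by rewrite mulr_gt0// powR_gt0. Qed.

Let mpsi : measurable_fun setT psi.
Proof. by apply: measurable_funM; apply: (measurableT_comp (measurable_powR _)). Qed.

Let psi_le t : \int[nu]_(x in [set x | (a x <= a t)%R]) (psi x)%:E <=
  (power_const rho^-1 / M t)%:E.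
Proof.
apply: (@le_trans _ _ (\int[nu]_(x in [set x | (a x <= a t)%R])
    (((M t `^ rho * W t) `^ (- rho^-1))%:E * (W x `^ (rho^-1 - 1))%:E))).
  apply: ge0_integral_in_le; first exact: measurable_leset.
  - exact/measurable_EFinP.
  - exact: measurable_funeM.
  - by move=> x; rewrite lee_fin ltW.
  move=> x /= xt; rewrite -EFinM lee_fin /psi [leLHS]mulrC ler_wpM2r ?powR_ge0//.
  rewrite !powRN lef_pV2 ?posrE ?powR_gt0 ?mulr_gt0 ?powR_gt0//.
  by rewrite ge0_ler_powR ?(ltW rhoV0) ?nnegrE ?mulr_ge0 ?powR_ge0 ?(ltW (W0 _)) ?(ltW (Pt0
    _)) ?PtM.
rewrite ge0_integralZl_EFin ?powR_ge0//; last 3 first.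
- exact: measurable_leset.
- by move=> x _; rewrite lee_fin powR_ge0.
- exact: measurable_funTS.
apply: le_trans.
  apply: lee_wpmul2l; first by rewrite lee_fin powR_ge0.
  exact: (integral_powerW ma W0 nuW t rhoV0).
rewrite -EFinM lee_fin le_eqVlt; apply/orP; left; apply/eqP.
rewrite powRM ?powR_ge0 ?(ltW (W0 t))// -powRrM.
have -> : (rho * - rho^-1 = -1)%R by field; rewrite gt_eqF.
rewrite powR_inv1 ?(ltW (M0 t))// powRN.
have := powR_gt0 rho^-1 (W0 t); set z := (W t `^ _)%R => z0.
by field; rewrite !gt_eqF.
Qed.

(** The first part of [Pt] gives [I]. In the second, exchanging the integrations leaves M t ^ rho
    times the integral of W ^ (rho - 1) below [t], which is at most a multiple of W t ^ rho. *)
Let int_psi : \int[nu]_x (psi x `^ (- rho))%:E <= (1 + power_const rho)%:E * I.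
Proof.
have psiE x : (psi x `^ (- rho))%:E =
    (W x `^ rho * M x `^ rho)%:E + (W x `^ (rho - 1))%:E * Q x.
  rewrite /psi powRM ?powR_ge0// -!powRrM.
  have -> : ((rho^-1 - 1) * - rho = rho - 1)%R by field; rewrite gt_eqF.
  have -> : (- rho^-1 * - rho = 1)%R by field; rewrite gt_eqF.
  rewrite powRr1 ?(ltW (Pt0 x))// EFinM PtE ge0_muleDr ?lee_fin ?mulr_ge0 ?powR_ge0 ?(ltW
    (W0 x))//.
  rewrite -EFinM; congr (_%:E + _).
  by rewrite mulrCA (mulrC _ (W x)) mulr_powRB1 ?(ltW (W0 x))// mulrC.
under eq_integral do rewrite psiE.
rewrite ge0_integralD//; last 2 first.
- by move=> x _; rewrite mule_ge0// lee_fin powR_ge0.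
- exact: emeasurable_funM.
rewrite (fubini_relation nu nu (measurable_lt_rel ma) mMr (mWr (rho - 1)) Mr0); last first.
  by move=> x; rewrite lee_fin powR_ge0.
rewrite EFinD ge0_muleDl ?lee_fin//; last exact/ltW/power_const_gt0.
rewrite mul1e leeD2l// -ge0_integralZl_EFin//; last exact/ltW/power_const_gt0.
have mR : measurable_fun setT (fun t => \int[nu]_(x in [set x | (a x < a t)%R]) (W x `^
  (rho - 1))%:E).
  have -> : (fun t => \int[nu]_(x in [set x | (a x < a t)%R]) (W x `^ (rho - 1))%:E) =
      (fun t => \int[nu]_(x in [set x | ((- a x)%R > - a t)%R]) (W x `^ (rho - 1))%:E).
    by apply/funext => t; under [in RHS]eq_set do rewrite ltrN2.
  apply: (measurable_integral_section_r nu (measurable_lt_rel (a := \- a)%R _)) => //.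
    exact: measurableT_comp.
  by move=> x; rewrite lee_fin powR_ge0.
apply: ge0_integralT_le.
- exact: emeasurable_funM.
- exact: measurable_funeM.
- by move=> t; rewrite mule_ge0// integral_ge0// => x _; rewrite lee_fin powR_ge0.
move=> t; rewrite (mulrC (W t `^ rho)%R) EFinM muleCA; apply: lee_wpmul2l => //.
rewrite -EFinM; apply: le_trans (integral_powerW ma W0 nuW t rho0).
apply: ge0_subset_integralT => //.
- exact: measurable_section_l (measurable_lt_rel ma) t.
- exact: measurable_leset.
- by move=> x; rewrite lee_fin powR_ge0.
- by move=> x /= /ltW.
Qed.

(* Hoelder against the weight psi, chosen so that the p-p inequality holds for
   psi nu while psi ^ (- rho) stays integrable. *)
Lemma hardy_qp (g : T -> \bar R) : measurable_fun setT g -> (forall x, 0 <= g x) ->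
  \int[nu]_x (hardy mu a g x `^ q) <=
  ((C * power_const rho^-1)%:E * \int[mu]_x (g x `^ p * (om x)%:E)) `^ (q / p) *
  ((1 + power_const rho)%:E * I) `^ (1 - q / p).
Proof.
move=> mg g0.
have mH := measurable_hardy mu ma mg g0.
have H0 x : 0 <= hardy mu a g x by exact: hardy_ge0.
have psiW x : (0 <= psi x)%R by exact: ltW.
have th01 : (0 < q / p < 1)%R by rewrite divr_gt0//= ltr_pdivrMr// mul1r.
have mF : measurable_fun setT (fun x => hardy mu a g x `^ p * (psi x)%:E).
  by apply: emeasurable_funM; [exact: measurable_funP_poweR|exact/measurable_EFinP].
have F0 x : 0 <= hardy mu a g x `^ p * (psi x)%:E.
  by rewrite mule_ge0 ?poweR_ge0// lee_fin.
have HE x : hardy mu a g x `^ q =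
    (hardy mu a g x `^ p * (psi x)%:E) `^ (q / p) * ((psi x `^ (- rho))%:E) `^ (1 - q / p).
  rewrite poweRM ?poweR_ge0 ?lee_fin// -poweRrM.
  have -> : (p * (q / p) = q)%R by field; rewrite gt_eqF.
  rewrite !poweR_EFin -powRrM -muleA -EFinM -powRD_gt0//.
  have -> : (q / p + - rho * (1 - q / p) = 0)%R.
    by rewrite /rho; field; rewrite subr_eq0 !gt_eqF.
  by rewrite powRr0 mule1.
under eq_integral do rewrite HE.
apply: le_trans.
  apply: (@hoelder_poweR _ _ _ nu _ (fun x => (psi x `^ (- rho))%:E) (q / p)%R th01 mF) => //.
    exact: measurable_EFin_powR.
  by move=> x; rewrite lee_fin powR_ge0.
apply: lee_pmul; rewrite ?poweR_ge0//.
- apply: lee_poweR; first by case/andP: th01 => /ltW.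
    by apply: integral_ge0 => x _.
  rewrite -(@integral_density _ _ _ nu _ mpsi psiW); last 2 first.
  + exact: measurable_funP_poweR.
  + by move=> x; exact: poweR_ge0.
  by apply: HB => //; exact: power_const_gt0.
- apply: lee_poweR => //; first by rewrite subr_ge0; case/andP: th01 => _ /ltW.
  by apply: integral_ge0 => x _; rewrite lee_fin powR_ge0.
Qed.

End hardy_qp.

(** * The Stieltjes operator *)

Section stieltjes_operator.
Context d (T : measurableType d) (R : realType).
Implicit Types (mu nu : {sigma_finite_measure set T -> \bar R}) (a : T -> R).

Definition stieltjes_op (mu : set T -> \bar R) a (h : T -> \bar R) (x : T) : \bar R :=
  \int[mu]_t (h t * ((a x + a t)^-1)%:E).

(** The sum is at most twice the larger term, so q < 1 and q >= 1 are treated alike. *)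
Lemma poweR_add_le (x y : \bar R) (q : R) : (0 < q)%R -> 0 <= x -> 0 <= y ->
  (x + y) `^ q <= (2 `^ q)%:E * (x `^ q + y `^ q).
Proof.
move=> q0; wlog xy : x y / x <= y.
  move=> h x0 y0; have [xy|/ltW yx] := leP x y; first exact: h.
  by rewrite addeC [X in _ * X]addeC; exact: h.
move=> x0 y0; apply: (@le_trans _ _ ((2%:E * y) `^ q)).
  apply: lee_poweR; [exact: ltW|exact: adde_ge0|].
  rewrite (_ : 2%:E * y = y + y); first by rewrite leeD2r.
  by rewrite -[2%R]/(1 + 1)%R EFinD ge0_muleDl// mul1e.
by rewrite poweRM// poweR_EFin lee_wpmul2l ?lee_fin ?powR_ge0// leeDr// poweR_ge0.
Qed.

Variables (mu nu : {sigma_finite_measure set T -> \bar R}) (a : T -> R).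
Hypotheses (ma : measurable_fun setT a) (a0 : forall x, (0 < a x)%R).

Lemma measurable_inv_fun (b : T -> R) : measurable_fun setT b -> (forall x, 0 < b x)%R ->
  measurable_fun setT (fun x => (b x)^-1)%R.
Proof.
move=> mb b0; under eq_fun => x do rewrite -powR_inv1 ?(ltW (b0 x))//.
exact: (measurableT_comp (measurable_powR _)).
Qed.

Lemma measurable_stieltjes_op_kernel : measurable_fun setT
  (fun z : T * T => ((a z.1 + a z.2)^-1)%R).
Proof.
have h : measurable_fun setT (fun z : T * T => (a z.1 + a z.2)%R).
  by apply: measurable_funD; exact: (measurableT_comp ma).
under eq_fun => z do rewrite -powR_inv1 ?addr_ge0 ?(ltW (a0 _))//.
exact: (measurableT_comp (measurable_powR _)).
Qed.

Lemma measurable_stieltjes_op h : measurable_fun setT h -> (forall x, 0 <= h x) ->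
  measurable_fun setT (stieltjes_op mu a h).
Proof.
move=> mh h0.
apply: (measurable_fun_fubini_tonelli_F (m2 := mu)
  (fun z : T * T => h z.2 * ((a z.1 + a z.2)^-1)%:E)).
  apply: emeasurable_funM; first exact: measurableT_comp.
  by apply/measurable_EFinP; exact: measurable_stieltjes_op_kernel.
by move=> z; rewrite mule_ge0// lee_fin invr_ge0 addr_ge0// ltW.
Qed.

Lemma stieltjes_op_ge0 h x : (forall x, 0 <= h x) -> 0 <= stieltjes_op mu a h x.
Proof.
move=> h0; apply: integral_ge0 => t _.
by rewrite mule_ge0// lee_fin invr_ge0 addr_ge0// ltW.
Qed.

Lemma measurable_stieltjes_op_integrand h x : measurable_fun setT h ->
  measurable_fun setT (fun t => h t * ((a x + a t)^-1)%:E).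
Proof.
move=> mh; apply: emeasurable_funM => //; apply/measurable_EFinP.
apply: measurable_inv_fun => [|t]; first exact: measurable_funD.
by rewrite addr_gt0.
Qed.

Lemma stieltjes_op_le_hardy h x : measurable_fun setT h -> (forall x, 0 <= h x) ->
  stieltjes_op mu a h x <= hardy mu a (fun t => h t * ((a t)^-1)%:E) x +
    ((a x)^-1)%:E * hardy mu (\- a)%R h x.
Proof.
move=> mh h0; rewrite /stieltjes_op.
have mla := measurable_geset (a x) ma.
have mle := measurable_leset (a x) ma.
have k0 t : 0 <= h t * ((a x + a t)^-1)%:E.
  by rewrite mule_ge0// lee_fin invr_ge0 addr_ge0// ltW.
have ha0 t : 0 <= h t * ((a t)^-1)%:E by rewrite mule_ge0// lee_fin invr_ge0 ltW.
have mha : measurable_fun setT (fun t => h t * ((a t)^-1)%:E).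
  by apply: emeasurable_funM => //; apply/measurable_EFinP; exact: measurable_inv_fun.
have mk := measurable_stieltjes_op_integrand x mh.
have mC : measurable (~` [set t | (a x <= a t)%R]) by exact: measurableC.
rewrite -(setUv [set t | (a x <= a t)%R]) ge0_integral_setU//; last 2 first.
- exact: measurable_funTS.
- by apply/disj_setPS => t [].
apply: leeD.
  apply: ge0_integral_in_le => // t /= xt; apply: lee_wpmul2l => //.
  by rewrite lee_fin lef_pV2 ?posrE ?addr_gt0// lerDr ltW.
rewrite -hardyN -ge0_integralZl_EFin//; last 2 first.
- exact: measurable_funTS.
- by rewrite invr_ge0 ltW.
apply: (@le_trans _ _ (\int[mu]_(t in [set t | (a t <= a x)%R]) (h t * ((a x + a t)^-1)%:E))).
  by apply: ge0_subset_integralT => // t /= /negP; rewrite -ltNge => /ltW.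
apply: ge0_integral_in_le => //; first exact: measurable_funeM.
move=> t /= tx; rewrite muleC; apply: lee_wpmul2r => //.
by rewrite lee_fin lef_pV2 ?posrE ?addr_gt0// lerDl ltW.
Qed.

Variables (v m phi W1 W2 : T -> R) (p q C : R).
Hypotheses (mv : measurable_fun setT v) (v0 : forall x, (0 <= v x)%R).
Hypotheses (mm : measurable_fun setT m) (m0 : forall x, (0 < m x)%R).
Hypotheses (p0 : (0 < p)%R) (q0 : (0 < q)%R) (C0 : (0 < C)%R).
Hypothesis am : forall x y, (a x <= a y)%R -> (m y <= m x)%R.
Hypothesis aam : forall x y, (a x <= a y)%R -> (a x * m x <= a y * m y)%R.

Let maq : measurable_fun setT (fun x => a x `^ (- q))%R.
Proof. exact: (measurableT_comp (measurable_powR _)). Qed.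
Let aq0 x : (0 <= a x `^ (- q))%R := powR_ge0 _ _.

(** The factor 1 / a x in front of the second Hardy operator is moved into the measure. *)
Let nu2 : {sigma_finite_measure set T -> \bar R} := density_measure nu maq aq0.

Hypothesis nuW1 : forall x, nu [set y | (a y <= a x)%R] = (W1 x)%:E.
Hypothesis nuW2 : forall x,
  \int[nu]_(y in [set y | (a x <= a y)%R]) (a y `^ (- q))%:E = (W2 x)%:E.
Hypotheses (W10 : forall x, (0 < W1 x)%R) (W20 : forall x, (0 < W2 x)%R).
Hypotheses (mphi : measurable_fun setT phi) (phi0 : forall x, (0 < phi x)%R).
Hypothesis W1phi : forall x, (W1 x <= 2 `^ q * phi x)%R.
Hypothesis W2phi : forall x, (W2 x <= 2 `^ q * (phi x * a x `^ (- q)))%R.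

(** [M1] goes with the weight v a ^ p because the first Hardy operator acts on h / a; its 2 ^ p pays
    for replacing 1 / a t by 2 / (a x + a t) where a x <= a t. In [M2], likewise, 1 is replaced by 2
    a x / (a x + a t). *)
Let M1 x : R := (2 `^ p * m x `^ p)%R.
Let M2 x : R := (2 `^ p * (a x * m x) `^ p)%R.

Hypothesis HB1 : hardy_bound mu a (fun x => v x * a x `^ p)%R M1 p C.
Hypothesis HB2 : hardy_bound mu (\- a)%R v M2 p C.

Let mNa : measurable_fun setT (\- a)%R.
Proof. exact: measurableT_comp. Qed.

Let nu2W2 x : nu2 [set y | ((\- a)%R y <= (\- a)%R x)%R] = (W2 x)%:E.
Proof. by under eq_set do rewrite /= lerN2; exact: nuW2. Qed.

Let M10 x : (0 < M1 x)%R.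
Proof. by rewrite mulr_gt0// powR_gt0. Qed.
Let M20 x : (0 < M2 x)%R.
Proof. by rewrite mulr_gt0// powR_gt0// mulr_gt0. Qed.

Let N (h : T -> \bar R) := \int[mu]_t (h t `^ p * (v t)%:E).

Let N1 h : (forall x, 0 <= h x) ->
  \int[mu]_t ((h t * ((a t)^-1)%:E) `^ p * (v t * a t `^ p)%:E) = N h.
Proof.
move=> h0; apply: eq_integral => t _.
rewrite poweRM ?lee_fin ?invr_ge0 ?(ltW (a0 t))// poweR_EFin -muleA -EFinM.
congr (_ * _%:E); rewrite powRV ?(ltW (a0 t))// mulrCA mulVf ?mulr1//.
by rewrite gt_eqF// powR_gt0.
Qed.

Let stieltjes_op_split h B : measurable_fun setT h -> (forall x, 0 <= h x) ->
  \int[nu]_x (hardy mu a (fun t => h t * ((a t)^-1)%:E) x `^ q) <= B ->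
  \int[nu2]_x (hardy mu (\- a)%R h x `^ q) <= B ->
  \int[nu]_x (stieltjes_op mu a h x `^ q) <= (2 * 2 `^ q)%:E * B.
Proof.
move=> mh h0 B1 B2.
have ha0 t : 0 <= h t * ((a t)^-1)%:E by rewrite mule_ge0// lee_fin invr_ge0 ltW.
have mha : measurable_fun setT (fun t => h t * ((a t)^-1)%:E).
  by apply: emeasurable_funM => //; apply/measurable_EFinP; exact: measurable_inv_fun.
have mH1 := measurable_funP_poweR q (measurable_hardy mu ma mha ha0).
have mH2 := measurable_funP_poweR q (measurable_hardy mu mNa mh h0).
have mH2q : measurable_fun setT (fun x => hardy mu (\- a)%R h x `^ q * (a x `^ (- q))%:E).
  by apply: emeasurable_funM => //; exact/measurable_EFinP.
have H2q0 x : 0 <= hardy mu (\- a)%R h x `^ q * (a x `^ (- q))%:E.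
  by rewrite mule_ge0 ?poweR_ge0// lee_fin.
apply: (@le_trans _ _ (\int[nu]_x ((2 `^ q)%:E *
   (hardy mu a (fun t => h t * ((a t)^-1)%:E) x `^ q +
    hardy mu (\- a)%R h x `^ q * (a x `^ (- q))%:E)))).
  apply: ge0_integralT_le.
  - by apply: measurable_funP_poweR; exact: measurable_stieltjes_op.
  - by apply: measurable_funeM; exact: emeasurable_funD.
  - by move=> x; exact: poweR_ge0.
  move=> x; apply: le_trans.
    apply: lee_poweR (stieltjes_op_le_hardy x mh h0); first exact: ltW.
    exact: stieltjes_op_ge0.
  apply: le_trans.
    apply: poweR_add_le => //; first exact: hardy_ge0.
    by rewrite mule_ge0 ?hardy_ge0// lee_fin invr_ge0 ltW.
  apply: lee_wpmul2l; first by rewrite lee_fin powR_ge0.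
  rewrite leeD2l// poweRM ?hardy_ge0 ?lee_fin ?invr_ge0 ?(ltW (a0 x))//.
  by rewrite poweR_EFin powRV ?(ltW (a0 x))// powRN muleC.
rewrite ge0_integralZl_EFin ?powR_ge0//; last 2 first.
- by move=> x _; rewrite adde_ge0 ?poweR_ge0.
- exact: emeasurable_funD.
rewrite (mulrC 2%R) EFinM -muleA; apply: lee_wpmul2l; first by rewrite lee_fin powR_ge0.
rewrite ge0_integralD//; last by move=> x _; exact: poweR_ge0.
rewrite (_ : 2%:E * B = B + B); last first.
  rewrite -[2%R]/(1 + 1)%R EFinD ge0_muleDl ?mul1e//.
apply: leeD => //; apply: le_trans B2.
rewrite integral_density//; last by move=> x; exact: poweR_ge0.
Qed.

Definition suff_const_pq : R :=
  (2 * 2 `^ q * (C * power_const (p / q) * (2 `^ p * 2 `^ p)) `^ (q / p))%R.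

Lemma stieltjes_sufficiency_pq (A : R) : (p <= q)%R -> (0 < A)%R ->
  (forall x, phi x `^ q^-1 * m x <= A)%R ->
  forall h, measurable_fun setT h -> (forall x, 0 <= h x) ->
  \int[nu]_x (stieltjes_op mu a h x `^ q) <= (suff_const_pq * A `^ q)%:E * N h `^ (q / p).
Proof.
move=> pq A0 phimA h mh h0.
have ha0 t : 0 <= h t * ((a t)^-1)%:E by rewrite mule_ge0// lee_fin invr_ge0 ltW.
have mha : measurable_fun setT (fun t => h t * ((a t)^-1)%:E).
  by apply: emeasurable_funM => //; apply/measurable_EFinP; exact: measurable_inv_fun.
have Nh0 : 0 <= N h by apply: integral_ge0 => t _; rewrite mule_ge0 ?poweR_ge0// lee_fin.
(* One 2 comes from [W1phi] or [W2phi], whose 2 ^ q is raised to 1 / q, the other from [M1] or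
   [M2]. *)
have A40 : (0 < 2 * 2 * A)%R by rewrite !mulr_gt0.
have pc0 : (0 < power_const (p / q) :> R)%R by rewrite power_const_gt0// divr_gt0.
have E : ((C * (power_const (p / q) * (2 * 2 * A) `^ p))%:E * N h) `^ (q / p) =
   ((C * power_const (p / q) * (2 `^ p * 2 `^ p)) `^ (q / p) * A `^ q)%:E * N h `^ (q / p).
  rewrite poweRM ?lee_fin ?mulr_ge0 ?powR_ge0 ?(ltW C0) ?(ltW pc0)//.
  congr (_ * _); rewrite poweR_EFin; congr (_%:E).
  have -> : (C * (power_const (p / q) * (2 * 2 * A) `^ p) =
      C * power_const (p / q) * (2 `^ p * 2 `^ p) * A `^ p)%R.
    by rewrite powRM ?mulr_ge0 ?(ltW A0)// powRM//; ring.
  rewrite powRM ?mulr_ge0 ?powR_ge0 ?(ltW C0) ?(ltW pc0)//; congr (_ * _)%R.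
  by rewrite -powRrM mulrCA divff ?mulr1// gt_eqF.
(* Serves both halves: b = 1 for the first and b = a t for the second, where the powers of b from
   [W2] and [M2] cancel. *)
have WM (W' M' z : R) (b : R) : (0 < b)%R -> (0 <= z)%R -> (0 <= W')%R -> (0 <= M')%R ->
    (W' <= 2 `^ q * (z * b `^ (- q)))%R -> (z `^ q^-1 * M' <= A)%R ->
    (W' `^ q^-1 * (2 `^ p * (b * M') `^ p) `^ p^-1 <= 2 * 2 * A)%R.
  move=> b0 z0 W'0 M'0 W'z zM'.
  rewrite -powRM ?mulr_ge0 ?(ltW b0)// -powRrM divff ?(gt_eqF p0)// powRr1 ?mulr_ge0 ?(ltW b0)//.
  have : (W' `^ q^-1 <= (2 `^ q * (z * b `^ (- q))) `^ q^-1)%R.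
    by rewrite ge0_ler_powR ?invr_ge0 ?(ltW q0) ?nnegrE ?mulr_ge0 ?powR_ge0.
  rewrite powRM ?mulr_ge0 ?powR_ge0// -powRrM divff ?(gt_eqF q0)// powRr1//.
  rewrite powRM ?powR_ge0// -powRrM mulNr divff ?(gt_eqF q0)// powR_inv1 ?(ltW b0)// => h1.
  apply: (@le_trans _ _ (2 * (z `^ q^-1 * b^-1) * (2 * (b * M')))%R).
    by rewrite ler_wpM2r// !mulr_ge0// ltW.
  have -> : (2 * (z `^ q^-1 * b^-1) * (2 * (b * M')) = 2 * 2 * (z `^ q^-1 * M'))%R.
    by field; rewrite gt_eqF.
  by rewrite ler_pM2l ?mulr_gt0.
rewrite /suff_const_pq -mulrA EFinM -muleA -E; apply: stieltjes_op_split => //.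
- rewrite -(N1 h0).
  apply: (hardy_pq ma W10 nuW1 p0 M10 HB1 pq A40) => // t.
  have := WM (W1 t) (m t) (phi t) 1%R ltr01 (ltW (phi0 t)) (ltW (W10 t)) (ltW (m0 t)).
  by rewrite powR1 mulr1 mul1r; apply.
- apply: (hardy_pq mNa W20 nu2W2 p0 M20 HB2 pq A40) => // t.
  by apply: (WM _ _ (phi t)) => //; exact: ltW.
Qed.

Definition suff_const_qp : R :=
  let rho := (q / (p - q))%R in
  (2 * 2 `^ q * ((C * power_const rho^-1) `^ (q / p) *
   ((1 + power_const rho) * (2 `^ q * 2 `^ p) `^ rho) `^ (1 - q / p)))%R.

Lemma stieltjes_sufficiency_qp (A : R) : (q < p)%R -> (0 < A)%R ->
  \int[nu]_x (phi x `^ (q / (p - q)) * m x `^ (p * q / (p - q)))%:E <=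
    (A `^ (p * q / (p - q)))%:E ->
  forall h, measurable_fun setT h -> (forall x, 0 <= h x) ->
  \int[nu]_x (stieltjes_op mu a h x `^ q) <= (suff_const_qp * A `^ q)%:E * N h `^ (q / p).
Proof.
move=> qp A0 IA h mh h0.
have pq0 : (0 < p - q)%R by rewrite subr_gt0.
set rho := (q / (p - q))%R in IA *; set r := (p * q / (p - q))%R in IA *.
have rE : (r = p * rho)%R by rewrite /r /rho mulrA.
have rho0 : (0 < rho)%R by rewrite divr_gt0.
have ha0 t : 0 <= h t * ((a t)^-1)%:E by rewrite mule_ge0// lee_fin invr_ge0 ltW.
have mha : measurable_fun setT (fun t => h t * ((a t)^-1)%:E).
  by apply: emeasurable_funM => //; apply/measurable_EFinP; exact: measurable_inv_fun.
have Nh0 : 0 <= N h by apply: integral_ge0 => t _; rewrite mule_ge0 ?poweR_ge0// lee_fin.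
have pc0 : (0 < power_const rho :> R)%R by exact: power_const_gt0.
have pcV0 : (0 < power_const rho^-1 :> R)%R by rewrite power_const_gt0// invr_gt0.
have pc1 : (0 <= 1 + power_const rho)%R by exact/ltW/(addr_gt0 ltr01 pc0).
have mpow (b : T -> R) s : measurable_fun setT b -> measurable_fun setT (fun x => b x `^ s)%R.
  by move=> mb; exact: (measurableT_comp (measurable_powR _)).
have mW1 := measurable_W ma nuW1.
have mW2 := measurable_W mNa nu2W2.
have mM1 : measurable_fun setT M1 by apply: measurable_funM => //; exact: mpow.
have mM2 : measurable_fun setT M2.
  by apply: measurable_funM => //; apply: mpow; exact: measurable_funM.
pose k : R := ((2 `^ q * 2 `^ p) `^ rho)%R.
have k0 : (0 <= k)%R by exact: powR_ge0.
have mI : measurable_fun setT (fun x => (phi x `^ rho * m x `^ r)%:E : \bar R).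
  by apply/measurable_EFinP; apply: measurable_funM; exact: mpow.
have IkA : \int[nu]_x (k%:E * (phi x `^ rho * m x `^ r)%:E) <= (k * A `^ r)%:E.
  rewrite ge0_integralZl_EFin//; last by move=> x _; rewrite lee_fin mulr_ge0 ?powR_ge0.
  by rewrite EFinM lee_wpmul2l.
have WM (W' M' z b : R) : (0 < b)%R -> (0 <= z)%R -> (0 <= W')%R -> (0 <= M')%R ->
    (W' <= 2 `^ q * (z * b `^ (- q)))%R ->
    (W' `^ rho * (2 `^ p * (b * M') `^ p) `^ rho * b `^ (- q) <= k * (z `^ rho * M' `^ r))%R.
  move=> b0 z0 W'0 M'0 W'z.
  have h1 : (W' `^ rho <= (2 `^ q * (z * b `^ (- q))) `^ rho)%R.
    by rewrite ge0_ler_powR ?(ltW rho0) ?nnegrE ?mulr_ge0 ?powR_ge0.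
  apply: (@le_trans _ _ ((2 `^ q * (z * b `^ (- q))) `^ rho * (2 `^ p * (b * M') `^ p) `^
    rho * b `^ (- q))%R).
    by rewrite -!mulrA ler_wpM2r// mulr_ge0 ?powR_ge0.
  rewrite /k !powRM ?mulr_ge0 ?powR_ge0 ?(ltW b0)// rE -!powRrM.
  (* The powers of b cancel because (p - q) * rho = q; in the second half the last one is the
     density of [nu2]. *)
  have e : (b `^ (- q * rho) * b `^ (p * rho) * b `^ (- q) = 1)%R.
    rewrite -!powRD_gt0// (_ : _ + _ = 0)%R ?powRr0//.
    by rewrite /rho; field; rewrite gt_eqF.
  rewrite le_eqVlt; apply/orP; left; apply/eqP.
  rewrite -[RHS]mulr1 -e; ring.
have I1 : \int[nu]_x (W1 x `^ rho * M1 x `^ rho)%:E <= (k * A `^ r)%:E.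
  apply: le_trans IkA; apply: ge0_integralT_le.
  - by apply/measurable_EFinP; apply: measurable_funM; exact: mpow.
  - exact: measurable_funeM.
  - by move=> x; rewrite lee_fin mulr_ge0 ?powR_ge0.
  move=> x; rewrite -EFinM lee_fin.
  have := WM (W1 x) (m x) (phi x) 1%R ltr01 (ltW (phi0 x)) (ltW (W10 x)) (ltW (m0 x)).
  by rewrite powR1 !mulr1 mul1r; apply.
have I2 : \int[nu2]_x (W2 x `^ rho * M2 x `^ rho)%:E <= (k * A `^ r)%:E.
  apply: le_trans IkA; rewrite integral_density; last 2 first.
  - by apply/measurable_EFinP; apply: measurable_funM; exact: mpow.
  - by move=> x; rewrite lee_fin mulr_ge0 ?powR_ge0.
  apply: ge0_integralT_le.
  - apply: emeasurable_funM; last exact/measurable_EFinP.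
    by apply/measurable_EFinP; apply: measurable_funM; exact: mpow.
  - exact: measurable_funeM.
  - by move=> x; rewrite mule_ge0// lee_fin ?mulr_ge0 ?powR_ge0.
  move=> x; rewrite -!EFinM lee_fin.
  by apply: WM => //; exact: ltW.
have fin I' : I' <= (k * A `^ r)%:E -> I' < +oo by move=> /le_lt_trans; apply; rewrite ltry.
have qp1 : (0 <= 1 - q / p)%R by rewrite subr_ge0 ler_pdivrMr// mul1r ltW.
have E : ((C * power_const rho^-1)%:E * N h) `^ (q / p) *
    ((1 + power_const rho)%:E * (k * A `^ r)%:E) `^ (1 - q / p) =
    ((C * power_const rho^-1) `^ (q / p) *
    ((1 + power_const rho) * k) `^ (1 - q / p) * A `^ q)%:E * N h `^ (q / p).
  rewrite poweRM ?lee_fin ?mulr_ge0 ?(ltW C0) ?(ltW pcV0)// -EFinM !poweR_EFin mulrA.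
  rewrite (powRM (x := (1 + power_const rho) * k)%R) ?(mulr_ge0 pc1 k0) ?powR_ge0//.
  rewrite -(powRrM A) (_ : r * (1 - q / p) = q)%R; last first.
    by rewrite /r; field; rewrite !gt_eqF.
  by rewrite muleAC -!EFinM !mulrA.
have -> : (suff_const_qp * A `^ q)%:E * N h `^ (q / p) =
  (2 * 2 `^ q)%:E * (((C * power_const rho^-1)%:E * N h) `^ (q / p) *
    ((1 + power_const rho)%:E * (k * A `^ r)%:E) `^ (1 - q / p)).
  rewrite E muleA -EFinM; congr (_%:E * _).
  by rewrite /suff_const_qp -/rho -/k; ring.
apply: stieltjes_op_split => //.
- rewrite -(N1 h0); apply: le_trans.
    apply: (hardy_qp ma W10 nuW1 q0 qp mM1 M10 _ HB1) => //.
    + move=> x y xy; rewrite ler_pM2l ?powR_gt0// ge0_ler_powR ?nnegrE ?(ltW p0) ?(ltW (m0 _))//.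
      exact: am.
    + exact: fin I1.
  apply: lee_wpmul2l; first exact: poweR_ge0.
  apply: lee_poweR => //.
    rewrite mule_ge0 ?lee_fin ?pc1// integral_ge0// => x _.
    by rewrite lee_fin mulr_ge0 ?powR_ge0.
  by apply: lee_wpmul2l; [rewrite lee_fin pc1|exact: I1].
- apply: le_trans.
    apply: (hardy_qp mNa W20 nu2W2 q0 qp mM2 M20 _ HB2) => //.
    + move=> x y; rewrite /= lerN2 => yx.
      rewrite ler_pM2l ?powR_gt0// ge0_ler_powR ?nnegrE ?(ltW p0) ?mulr_ge0 ?(ltW (m0 _))
        ?(ltW (a0 _))//.
      exact: aam.
    + exact: fin I2.
  apply: lee_wpmul2l; first exact: poweR_ge0.
  apply: lee_poweR => //.
    rewrite mule_ge0 ?lee_fin ?pc1// integral_ge0// => x _.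
    by rewrite lee_fin mulr_ge0 ?powR_ge0.
  by apply: lee_wpmul2l; [rewrite lee_fin pc1|exact: I2].
Qed.

End stieltjes_operator.

(** * Necessity *)

Section limit_lemmas.
Context d (T : measurableType d) (R : realType).
Variable nu : {measure set T -> \bar R}.

(** Fatou's lemma: only eventual pointwise domination is asked, so the finite families used for
    different [n] need not be nested. *)
Lemma ge0_integral_le_eventually (F : (T -> \bar R)^nat) (G : T -> \bar R) (B : \bar R) :
  (forall n, measurable_fun setT (F n)) -> (forall n x, 0 <= F n x) ->
  measurable_fun setT G -> (forall x, 0 <= G x) ->
  (forall x, exists N, forall n, (N <= n)%N -> G x <= F n x) ->
  (forall n, \int[nu]_x F n x <= B) -> \int[nu]_x G x <= B.
Proof.
move=> mF F0 mG G0 GF FB.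
apply: (@le_trans _ _ (\int[nu]_x limn_einf (F^~ x))).
  apply: ge0_integralT_le => //.
    under eq_fun do rewrite /limn_einf.
    apply: measurableT_comp => //; apply: measurable_fun_limn_esup => n.
    exact: measurableT_comp.
  move=> x; rewrite limn_einf_lim; apply: lime_ge; first exact: is_cvg_einfs.
  have [N GN] := GF x; exists N => // n /= Nn; apply: le_ereal_inf_tmp => _ [k /= nk <-].
  by apply: GN; exact: leq_trans nk.
apply: (le_trans (fatou nu measurableT mF (fun n x _ => F0 n x))).
rewrite limn_einf_lim; apply: lime_le; first exact: is_cvg_einfs.
by apply: nearW => n; apply: le_trans (FB n); apply: ereal_inf_lbound; exists n => /=.
Qed.

End limit_lemmas.

Section geometric_weights.
Context {R : realType}.

Lemma geometric_sum_le (b : R) (n : nat) : (1 < b)%R ->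
  (\sum_(i < n.+1) b ^+ i <= b / (b - 1) * b ^+ n)%R.
Proof.
move=> b1; have b0 : (0 < b - 1)%R by rewrite subr_gt0.
have e : ((b - 1) * (\sum_(i < n.+1) b ^+ i) = b ^+ n.+1 - 1)%R by rewrite subrX1.
rewrite mulrAC ler_pdivlMr// mulrC e exprS gerBl//.
Qed.

(* The last active term dominates a sum of geometric weights. *)
Lemma geometric_sum_dominated (b l X : R) (n : nat) (P : pred nat) :
  (1 < b)%R -> (0 <= l)%R -> (0 <= X)%R ->
  (forall i, (i < n)%N -> P i -> l * b ^+ i <= X)%R ->
  (\sum_(0 <= i < n | P i) l * b ^+ i <= b / (b - 1) * X)%R.
Proof.
move=> b1 l0 X0.
have b0 : (0 < b)%R by exact: lt_trans b1.
have C0 : (0 <= b / (b - 1))%R by rewrite divr_ge0 ?subr_ge0 ?(ltW b1) ?(ltW b0).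
elim: n => [_|n ih h]; first by rewrite big_geq// mulr_ge0.
have [Pn|Pn] := boolP (P n); last first.
  rewrite big_mkcond big_nat_recr//= (negbTE Pn) addr0 -big_mkcond/=.
  by apply: ih => i /ltnW; exact: h.
apply: (@le_trans _ _ (\sum_(0 <= i < n.+1) l * b ^+ i)%R).
  rewrite [leLHS]big_mkcond/=; apply: ler_sum => i _.
  by case: ifP => // _; rewrite mulr_ge0// exprn_ge0// ltW.
rewrite -mulr_sumr big_mkord; apply: (@le_trans _ _ (l * (b / (b - 1) * b ^+ n))%R).
  by rewrite ler_wpM2l// geometric_sum_le.
by rewrite mulrCA ler_wpM2l// h.
Qed.

End geometric_weights.

Lemma int_shift (j : int) (n : nat) : (absz j <= n)%N ->
  exists i : nat, (i < n.*2.+1)%N /\ (i%:Z - n%:Z)%R = j.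
Proof.
by case: j => k kn; [exists (k + n)%N|exists (n - k.+1)%N]; split; lia.
Qed.

Lemma pow2_bracket (R : realType) (z : R) : (0 < z)%R ->
  exists j : int, (2 ^ j <= z)%R /\ (z <= 2 * 2 ^ j)%R.
Proof.
move=> z0; have [z1|/ltW z1] := leP z 1%R.
  have [n /andP[n1 n2]] := dyadic_bracket z0 z1.
  exists (- n.+1%:Z)%R; move: n1 n2; rewrite !mul1r -exprnN !exprVn => n1 n2.
  split; first exact: ltW.
  by rewrite exprS invfM mulrA divff// mul1r.
have zV0 : (0 < z^-1)%R by rewrite invr_gt0.
have zV1 : (z^-1 <= 1)%R by rewrite invf_le1.
have [n /andP[n1 n2]] := dyadic_bracket zV0 zV1.
exists n%:Z; move: n1 n2; rewrite !mul1r -exprnP !exprVn.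
rewrite ltf_pV2 ?posrE ?exprn_gt0// lef_pV2 ?posrE ?exprn_gt0// => n1 n2.
by split => //; rewrite -exprS ltW.
Qed.

(** * Necessity of the integral condition, for an abstract positive operator *)

Section necessity_qp.
Context d (T : measurableType d) (R : realType).
Variables (mu nu : {sigma_finite_measure set T -> \bar R}) (a W : T -> R).
Hypotheses (ma : measurable_fun setT a) (W0 : forall x, (0 < W x)%R).
Hypothesis nuW : forall x, nu [set y | (a y <= a x)%R] = (W x)%:E.
Variables (om m : T -> R) (p q c : R).
Hypotheses (q0 : (0 < q)%R) (qp : (q < p)%R).
Hypotheses (mom : measurable_fun setT om) (om0 : forall x, (0 <= om x)%R).
Hypotheses (mm : measurable_fun setT m) (m0 : forall x, (0 <= m x)%R).

(** The operator is abstract because the argument is used twice: for the Stieltjes operator, and for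
    [a] times it with the order reversed and the measure a ^ (- q) nu. *)
Variable Op : (T -> \bar R) -> T -> \bar R.
Hypothesis mOp : forall h, measurable_fun setT h -> (forall x, 0 <= h x) ->
  measurable_fun setT (Op h).
Hypothesis Op0 : forall h x, (forall x, 0 <= h x) -> 0 <= Op h x.
Hypothesis Op_le : forall h g x, measurable_fun setT h -> measurable_fun setT g ->
  (forall x, 0 <= h x) -> (forall x, h x <= g x) -> Op h x <= Op g x.
Hypothesis OpZ : forall h (k : R) x, (0 <= k)%R -> measurable_fun setT h ->
  (forall x, 0 <= h x) -> Op (fun x => k%:E * h x) x = k%:E * Op h x.
Hypothesis Op_bounded : forall h, measurable_fun setT h -> (forall x, 0 <= h x) ->
  \int[nu]_x (Op h x `^ q) <= (c `^ q)%:E * (\int[mu]_x (h x `^ p * (om x)%:E)) `^ (q / p).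

Let p0 : (0 < p)%R := lt_trans q0 qp.
Let rho : R := (q / (p - q))%R.
Let r : R := (p * q / (p - q))%R.
Let pq0 : (0 < p - q)%R.
Proof. by rewrite subr_gt0. Qed.
Let rho0 : (0 < rho)%R.
Proof. by rewrite divr_gt0. Qed.
Let r0 : (0 < r)%R.
Proof. by rewrite divr_gt0// mulr_gt0. Qed.
Let b : R := (2 `^ r)%R.
Let b1 : (1 < b)%R.
Proof.
have e : (1 `^ r = 1 :> R)%R by rewrite powR1.
by rewrite /b -[ltLHS]e gt0_ltr_powR ?nnegrE// ltr1n.
Qed.
Let G : R := (b / (b - 1))%R.
Let G0 : (0 < G)%R.
Proof. by rewrite divr_gt0 ?subr_gt0// (lt_trans ltr01). Qed.
Let mW := measurable_W ma nuW.
Let aW := homo_W ma nuW.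
Let mWr s : measurable_fun setT (fun x => (W x `^ s)%:E : \bar R).
Proof. exact: measurable_EFin_powR. Qed.

(* At least half of the mass of {a <= a y} lies where W >= W y / 2. *)
Let half_mass y : (W y `^ (rho + 1))%:E <= (2 `^ (rho + 1))%:E *
  \int[nu]_(x in [set x | (a x <= a y)%R]) (W x `^ rho)%:E.
Proof.
have mA := measurable_leset (a y) ma.
have mS := measurable_leset (W y / 2)%R mW.
have mD : measurable ([set x | (a x <= a y)%R] `\` [set x | (W x <= W y / 2)%R]).
  exact: measurableD.
have hm : (W y / 2)%:E <= nu ([set x | (a x <= a y)%R] `\` [set x | (W x <= W y / 2)%R]).
  have h1 : (W y)%:E <= nu ([set x | (a x <= a y)%R] `\` [set x | (W x <= W y / 2)%R]) +
      nu [set x | (W x <= W y / 2)%R].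
    apply: le_trans (measureU2 nu mD mS); rewrite -nuW.
    apply: le_measure; rewrite ?inE//; first exact: measurableU.
    by move=> x /= xy; case: (pselect (W x <= W y / 2)%R); [right|left].
  have h2 : nu [set x | (W x <= W y / 2)%R] <= (W y / 2)%:E.
    by apply: (sublevel_W ma nuW); rewrite divr_ge0// ltW.
  have := le_trans h1 (leeD2l _ h2); rewrite -leeBlDr// -EFinB.
  by have -> : (W y - W y / 2 = W y / 2)%R by field.
apply: (@le_trans _ _ ((2 `^ (rho + 1))%:E *
   \int[nu]_(x in [set x | (a x <= a y)%R] `\` [set x | (W x <= W y / 2)%R]) (cst ((W y /
     2) `^ rho)%:E x))).
  rewrite integral_cst//; apply: (@le_trans _ _ ((2 `^ (rho + 1))%:E * (((W y / 2) `^
    rho)%:E * (W y / 2)%:E))).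
    rewrite -!EFinM lee_fin.
    have e : ((W y / 2) `^ rho * (W y / 2) = (W y / 2) `^ (rho + 1))%R.
      by rewrite powRD_gt0 ?divr_gt0// powRr1// divr_ge0// ltW.
    by rewrite e -powRM ?divr_ge0 ?(ltW (W0 y))// mulrC divfK.
  by rewrite !lee_wpmul2l// lee_fin powR_ge0.
apply: lee_wpmul2l; first by rewrite lee_fin powR_ge0.
apply: (@le_trans _ _ (\int[nu]_(x in [set x | (a x <= a y)%R] `\` [set x | (W x <= W y /
  2)%R]) (W x `^ rho)%:E)).
  apply: ge0_integral_in_le => //; first by move=> x; rewrite lee_fin powR_ge0.
  move=> x [_ /negP]; rewrite -ltNge => Wx; rewrite lee_fin.
  by rewrite ge0_ler_powR ?(ltW rho0) ?nnegrE ?divr_ge0 ?(ltW (W0 _))// ltW.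
apply: (ge0_subset_integralT nu mD mA (mWr rho)) => [x|x []//].
by rewrite lee_fin powR_ge0.
Qed.

(** [b / (b - 1)] comes from the geometric sum, 2 ^ (rho + 1) from [half_mass], and the outer power
    from solving X <= K * X ^ (q / p) for X. *)
Definition nec_const_qp : R :=
  (((b / (b - 1)) * (2 `^ (rho + 1)) `^ (q / p)) `^ (p / (p - q)))%R.

Section finite_family.
Variables (n : nat) (P : pred nat) (l : R) (y : nat -> T) (f : nat -> T -> \bar R).
Hypothesis l0 : (0 < l)%R.
Hypothesis mf : forall i, measurable_fun setT (f i).
Hypothesis f0 : forall i x, 0 <= f i x.
Hypothesis f1 : forall i, P i -> \int[mu]_x (f i x `^ p * (om x)%:E) <= 1.
Hypothesis fOp : forall i, P i -> forall x, (a x <= a (y i))%R -> (l * 2 ^+ i)%:E <= Op (f i) x.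

(** Chosen so that D i ^ (q / p) * (l * 2 ^ i) ^ q = W (y i) ^ rho * (l * 2 ^ i) ^ r: the q-th power
    of [Op h] then dominates each term of [F], while [half_mass] bounds [D i] by a multiple of the
    integral of the i-th term. *)
Let D i : R := (W (y i) `^ (rho + 1) * (l * 2 ^+ i) `^ r)%R.
Let Dsum : R := (\sum_(0 <= i < n | P i) D i)%R.
Let u i x : R := ((l * 2 ^+ i) `^ r * \1_[set x | (a x <= a (y i))%R] x)%R.
Let F x : R := (W x `^ rho * \sum_(0 <= i < n | P i) u i x)%R.
Let h x : \bar R := (\sum_(0 <= i < n | P i) (D i)%:E * f i x `^ p) `^ p^-1.

Let li0 i : (0 < l * 2 ^+ i)%R.
Proof. by rewrite mulr_gt0// exprn_gt0. Qed.
Let D0 i : (0 <= D i)%R.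
Proof. by rewrite mulr_ge0// powR_ge0. Qed.
Let u0 i x : (0 <= u i x)%R.
Proof. by rewrite mulr_ge0// powR_ge0. Qed.
Let F0 x : (0 <= F x)%R.
Proof. by rewrite mulr_ge0 ?powR_ge0// sumr_ge0. Qed.
Let liE i : ((l * 2 ^+ i) `^ r = l `^ r * b ^+ i)%R.
Proof.
by rewrite powRM ?(ltW l0) ?exprn_ge0// -(powR_mulrn i (ler0n R 2)) powRAC powR_mulrn ?powR_ge0.
Qed.

Let mu_ i : measurable_fun setT (u i).
Proof. by apply: measurable_funM => //; apply: measurable_indic; exact: measurable_leset. Qed.

Let mF : measurable_fun setT F.
Proof.
apply: measurable_funM; first exact: (measurableT_comp (measurable_powR _)).
under eq_fun do rewrite -big_filter.
by apply: measurable_sum => i; exact: mu_.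
Qed.

Let sum0 x : 0 <= \sum_(0 <= i < n | P i) (D i)%:E * f i x `^ p.
Proof. by apply: sume_ge0 => i _; rewrite mule_ge0 ?poweR_ge0// lee_fin. Qed.

Let mDf i : measurable_fun setT (fun x => (D i)%:E * f i x `^ p).
Proof. by apply: measurable_funeM; exact: measurable_funP_poweR. Qed.

Let mh : measurable_fun setT h.
Proof.
apply: measurable_funP_poweR; under eq_fun do rewrite -big_filter.
by apply: emeasurable_sum => i; exact: mDf.
Qed.

Let h0 x : 0 <= h x.
Proof. exact: poweR_ge0. Qed.

Let int_h : \int[mu]_x (h x `^ p * (om x)%:E) <= Dsum%:E.
Proof.
have mDfo i : measurable_fun setT (fun x => (D i)%:E * (f i x `^ p * (om x)%:E)).
  apply: measurable_funeM; apply: emeasurable_funM; first exact: measurable_funP_poweR.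
  exact/measurable_EFinP.
have Dfo0 i x : 0 <= (D i)%:E * (f i x `^ p * (om x)%:E).
  by rewrite !mule_ge0 ?poweR_ge0// lee_fin.
have -> : \int[mu]_x (h x `^ p * (om x)%:E) =
    \int[mu]_x (\sum_(i <- [seq i <- index_iota 0 n | P i]) (D i)%:E * (f i x `^ p * (om x)%:E)).
  apply: eq_integral => x _; rewrite /h poweRVK ?(gt_eqF p0)// big_filter.
  rewrite ge0_sume_distrl => [|i _]; last by rewrite mule_ge0 ?poweR_ge0// lee_fin.
  by apply: eq_bigr => i _; rewrite muleA.
rewrite ge0_integral_sum//.
rewrite big_filter -sumEFin; apply: lee_sum => i Pi.
rewrite ge0_integralZl_EFin//; last 2 first.
- by move=> x _; rewrite mule_ge0 ?poweR_ge0// lee_fin.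
- by apply: emeasurable_funM; [exact: measurable_funP_poweR|exact/measurable_EFinP].
by rewrite -[leRHS]mule1; apply: lee_wpmul2l; [rewrite lee_fin|exact: f1].
Qed.

Let h_ge i : (i < n)%N -> P i -> forall x, (D i `^ p^-1)%:E * f i x <= h x.
Proof.
move=> ni Pi x; rewrite -poweR_EFin -(@poweRK _ (f i x) p) ?(gt_eqF p0)//.
rewrite -poweRM ?lee_fin ?poweR_ge0//; apply: lee_poweR.
- by rewrite invr_ge0 ltW.
- by rewrite mule_ge0 ?poweR_ge0// lee_fin.
rewrite big_mkcond (bigD1_seq i)/= ?mem_index_iota ?iota_uniq// Pi.
rewrite leeDl// sume_ge0// => j _; case: ifP => // _.
by rewrite mule_ge0 ?poweR_ge0// lee_fin.
Qed.

Let F_le x : (F x)%:E <= G%:E * Op h x `^ q.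
Proof.
have term i : (i < n)%N -> P i -> (a x <= a (y i))%R ->
    (W x `^ rho * (l * 2 ^+ i) `^ r)%:E <= Op h x `^ q.
  move=> ni Pi xy.
  have h1 : (D i `^ p^-1 * (l * 2 ^+ i))%:E <= Op h x.
    apply: (@le_trans _ _ ((D i `^ p^-1)%:E * Op (f i) x)).
      by rewrite EFinM lee_wpmul2l ?lee_fin ?powR_ge0// fOp.
    rewrite -OpZ ?powR_ge0//; apply: Op_le => //.
    - exact: measurable_funeM.
    - by move=> z; apply: mule_ge0 => //; rewrite lee_fin powR_ge0.
    - exact: h_ge.
  apply: le_trans (lee_poweR (ltW q0) _ h1); last first.
    by rewrite lee_fin mulr_ge0 ?powR_ge0 ?(ltW (li0 i)).
  rewrite poweR_EFin lee_fin [leRHS]powRM ?powR_ge0 ?(ltW (li0 i))// -powRrM.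
  rewrite /D [in leRHS]powRM ?powR_ge0// -!powRrM.
  have -> : ((rho + 1) * (p^-1 * q) = rho)%R by rewrite /rho; field; rewrite !gt_eqF.
  rewrite -mulrA -powRD_gt0//.
  have -> : (r * (p^-1 * q) + q = r)%R by rewrite /r; field; rewrite !gt_eqF.
  rewrite ler_wpM2r ?powR_ge0// ge0_ler_powR ?(ltW rho0) ?nnegrE ?(ltW (W0 _))//.
  exact: aW.
have [Oy|Ofin] := eqVneq (Op h x) +oo.
  by rewrite Oy poweRyr ?gt_eqF// gt0_muley ?lte_fin// leey.
have [z Oz] : exists z, Op h x = z%:E.
  by exists (fine (Op h x)); rewrite fineK// ge0_fin_numE ?Op0// ltey.
rewrite Oz poweR_EFin -EFinM lee_fin.
rewrite /F mulr_sumr.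
have -> : (\sum_(0 <= i < n | P i) W x `^ rho * u i x =
    \sum_(0 <= i < n | P i && (a x <= a (y i))) (W x `^ rho * l `^ r) * b ^+ i)%R.
  rewrite [RHS]big_mkcondr/=; apply: eq_bigr => i _.
  rewrite /u indicE; case: ifPn => xy; last by rewrite memNset ?mulr0//; exact/negP.
  by rewrite mem_set// mulr1 liE mulrA.
apply: (geometric_sum_dominated (P := fun i => P i && (a x <= a (y i))%R)) => //.
- by rewrite mulr_ge0// powR_ge0.
- exact: powR_ge0.
move=> i ni /andP[Pi xy]; rewrite -mulrA -liE.
by have := term i ni Pi xy; rewrite Oz poweR_EFin lee_fin.
Qed.

Let Dsum_le : Dsum%:E <= (2 `^ (rho + 1))%:E * \int[nu]_x (F x)%:E.
Proof.
have mA i := measurable_leset (a (y i)) ma.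
have muW i : measurable_fun setT (fun x => (W x `^ rho * u i x)%:E : \bar R).
  by under eq_fun do rewrite EFinM; apply: emeasurable_funM => //; exact/measurable_EFinP.
have uW0 i x : 0 <= (W x `^ rho * u i x)%:E by rewrite lee_fin mulr_ge0// powR_ge0.
have -> : \int[nu]_x (F x)%:E =
    \int[nu]_x (\sum_(i <- [seq i <- index_iota 0 n | P i]) (W x `^ rho * u i x)%:E).
  by apply: eq_integral => x _; rewrite sumEFin big_filter /F mulr_sumr.
rewrite ge0_integral_sum//.
rewrite big_filter ge0_sume_distrr; last by move=> i _; exact: integral_ge0.
rewrite /Dsum -sumEFin; apply: lee_sum => i Pi.
have -> : \int[nu]_x (W x `^ rho * u i x)%:E = ((l * 2 ^+ i) `^ r)%:E *
    \int[nu]_(x in [set x | (a x <= a (y i))%R]) (W x `^ rho)%:E.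
  rewrite -ge0_integralZl_EFin ?powR_ge0//; last 2 first.
  - by move=> x _; rewrite lee_fin powR_ge0.
  - exact: measurable_funTS.
  rewrite [RHS]integral_mkcond; apply: eq_integral => x _; rewrite patchE /u indicE.
  by case: ifP => _; rewrite ?mulr1 ?mulr0// mulrC EFinM.
by rewrite /D mulrC EFinM muleCA; apply: lee_wpmul2l; [rewrite lee_fin powR_ge0|exact: half_mass].
Qed.

Lemma necessity_qp_finite : \int[nu]_x (F x)%:E <= (nec_const_qp * c `^ r)%:E.
Proof.
have B0 : (0 <= 2 `^ (rho + 1) :> R)%R by exact: powR_ge0.
have X0 : 0 <= \int[nu]_x (F x)%:E by apply: integral_ge0 => x _; rewrite lee_fin.
have step : \int[nu]_x (F x)%:E <= (G * c `^ q)%:E * Dsum%:E `^ (q / p).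
  apply: (@le_trans _ _ (\int[nu]_x (G%:E * Op h x `^ q))).
    apply: ge0_integralT_le; last exact: F_le.
    - exact/measurable_EFinP.
    - by apply: measurable_funeM; apply: measurable_funP_poweR; exact: mOp.
    - by move=> x; rewrite lee_fin.
  rewrite ge0_integralZl_EFin ?(ltW G0)//; last 2 first.
  - by move=> x _; exact: poweR_ge0.
  - by apply: measurable_funP_poweR; exact: mOp.
  rewrite (EFinM G) -muleA; apply: lee_wpmul2l; first by rewrite lee_fin ltW.
  apply: (le_trans (Op_bounded mh h0)).
  apply: lee_wpmul2l; first by rewrite lee_fin powR_ge0.
  apply: lee_poweR; [by rewrite divr_ge0// ltW| |exact: int_h].
  by apply: integral_ge0 => x _; rewrite mule_ge0 ?poweR_ge0// lee_fin.
have Dle := Dsum_le.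
(* A priori finiteness: [Dsum] is a real number, so a power of [X] may be divided out below. *)
have Xfin : \int[nu]_x (F x)%:E < +oo.
  by apply: (le_lt_trans step); rewrite poweR_EFin -EFinM ltry.
have [X XE] : exists X, \int[nu]_x (F x)%:E = X%:E.
  by exists (fine (\int[nu]_x (F x)%:E)); rewrite fineK// ge0_fin_numE.
rewrite XE in X0 step Dle *; rewrite lee_fin in X0.
rewrite -EFinM lee_fin in Dle; rewrite poweR_EFin -EFinM lee_fin in step.
rewrite lee_fin.
have qp0 : (0 <= q / p)%R by rewrite divr_ge0// ltW.
have {}step : (X <= G * (2 `^ (rho + 1)) `^ (q / p) * c `^ q * X `^ (q / p))%R.
  apply: (le_trans step).
  have -> : (G * (2 `^ (rho + 1)) `^ (q / p) * c `^ q * X `^ (q / p) =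
    G * c `^ q * (2 `^ (rho + 1) * X) `^ (q / p))%R by rewrite powRM//; ring.
  apply: ler_wpM2l; first by rewrite mulr_ge0 ?powR_ge0 ?(ltW G0).
  by apply: ge0_ler_powR => //; rewrite nnegrE; [exact: sumr_ge0|exact: mulr_ge0].
have [->|Xn0] := eqVneq X 0%R; first by rewrite mulr_ge0// powR_ge0.
have Xp : (0 < X)%R by rewrite lt0r Xn0.
have X1 : (X `^ (1 - q / p) <= G * (2 `^ (rho + 1)) `^ (q / p) * c `^ q)%R.
  rewrite -(ler_pM2r (powR_gt0 (q / p) Xp)) -powRD_gt0// subrK powRr1//.
have e0 : (0 < p / (p - q))%R by rewrite divr_gt0.
have -> : X = ((X `^ (1 - q / p)) `^ (p / (p - q)))%R.
  rewrite -powRrM (_ : (_ * _)%R = 1%R) ?powRr1//.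
  by field; rewrite !gt_eqF.
apply: (@le_trans _ _ ((G * (2 `^ (rho + 1)) `^ (q / p) * c `^ q) `^ (p / (p - q)))%R).
  by apply: ge0_ler_powR; rewrite ?nnegrE ?powR_ge0// ?(ltW e0)// (le_trans _ X1)// powR_ge0.
rewrite [leLHS]powRM ?powR_ge0//; last by rewrite mulr_ge0 ?powR_ge0 ?(ltW G0).
rewrite -[in leLHS](powRrM c).
by rewrite (_ : q * (p / (p - q)) = r)%R// /r; ring.
Qed.

End finite_family.

Hypothesis test_family : forall y (lam : R), (0 < lam)%R -> (lam < m y)%R ->
  exists f : T -> \bar R, [/\ measurable_fun setT f, forall x, 0 <= f x,
    \int[mu]_x (f x `^ p * (om x)%:E) <= 1 &
    forall x, (a x <= a y)%R -> lam%:E <= Op f x].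

Lemma necessity_qp (t0 : T) :
  \int[nu]_x (W x `^ rho * m x `^ r)%:E <= (4 `^ r * (nec_const_qp * c `^ r))%:E.
Proof.
(* A level set of [m] need not have a last point in the order of [a], so it is exhausted along a
   cofinal sequence; [t0] fills the empty levels. *)
pose Y (j : int) : set T := [set x | (2 ^ j <= m x)%R].
have seqP j : exists s : nat -> T, Y j !=set0 ->
  [/\ forall n, Y j (s n), forall n, (a (s n) <= a (s n.+1))%R &
      forall z, Y j z -> exists n, (a z <= a (s n))%R].
  have [Yj|Yj] := pselect (Y j !=set0); last by exists (fun=> t0).
  by have [s sP] := cofinal_sequence a Yj; exists s.
have [s sP] := choice seqP.
have famP (yj : T * int) : exists f : T -> \bar R, [/\ measurable_fun setT f, forall x, 0 <= f x &
    Y yj.2 yj.1 -> \int[mu]_x (f x `^ p * (om x)%:E) <= 1 /\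
    forall x, (a x <= a yj.1)%R -> (2 ^ yj.2 / 2)%:E <= Op f x].
  case: yj => y j /=; have [Yjy|?] := pselect (Y j y); last by exists (cst 0).
  have h2 : (0 < 2 ^ j :> R)%R by rewrite exprz_gt0.
  have [||f [mf f0 f1 fO]] := @test_family y (2 ^ j / 2)%R.
  - by rewrite divr_gt0.
  - by apply: lt_le_trans Yjy; rewrite ltr_pdivrMr// mulr_natr mulr2n ltrDl.
  by exists f; split.
have [f0 f0P] := choice famP.
(* The N-th family consists of the nonempty levels from -N to N, each with the N-th point of its
   sequence. Halving 2 ^ j leaves the strict inequality that [test_family] needs. *)
pose lev (N i : nat) : int := (i%:Z - N%:Z)%R.
pose P N i := `[< Y (lev N i) !=set0 >].
pose y N i := s (lev N i) N.
pose f N i := f0 (y N i, lev N i).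
pose l N : R := (2 ^ (- N%:Z) / 2)%R.
have levE N i : (2 ^ lev N i / 2 = l N * 2 ^+ i :> R)%R.
  by rewrite /l /lev expfzDr ?pnatr_eq0// -exprnP mulrAC mulrC mulrAC; ring.
have l0 N : (0 < l N)%R by rewrite divr_gt0// exprz_gt0.
have PY N i : P N i -> Y (lev N i) (y N i).
  by move/asboolP => /sP[] + _ _; exact.
pose F N x : \bar R := (W x `^ rho * \sum_(0 <= i < N.*2.+1 | P N i)
  ((l N * 2 ^+ i) `^ r * \1_[set x | (a x <= a (y N i))%R] x))%:E.
have FB N : \int[nu]_x F N x <= (nec_const_qp * c `^ r)%:E.
  apply: (@necessity_qp_finite N.*2.+1 (P N) (l N) (y N) (f N)) => //.
  - by move=> i; have [] := f0P (y N i, lev N i).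
  - by move=> i; have [] := f0P (y N i, lev N i).
  - by move=> i /PY Yi; have [_ _ /(_ Yi)[]] := f0P (y N i, lev N i).
  - by move=> i /PY Yi; have [_ _ /(_ Yi)[]] := f0P (y N i, lev N i); rewrite levE.
have F0 N x : 0 <= F N x.
  by rewrite lee_fin mulr_ge0 ?powR_ge0// sumr_ge0// => i _; rewrite mulr_ge0 ?powR_ge0.
have mF N : measurable_fun setT (F N).
  apply/measurable_EFinP; apply: measurable_funM;
    first exact: (measurableT_comp (measurable_powR _)).
  under eq_fun do rewrite -big_filter.
  apply: measurable_sum => i; apply: measurable_funM => //.
  by apply: measurable_indic; exact: measurable_leset.
have mWm : measurable_fun setT (fun x => (W x `^ rho * m x `^ r)%:E : \bar R).
  under eq_fun do rewrite EFinM.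
  by apply: emeasurable_funM; exact: measurable_EFin_powR.
(* The 4 is that halving times the dyadic rounding m x <= 2 * 2 ^ j. *)
have E : (fun x => (W x `^ rho * m x `^ r)%:E) =
    (fun x => (4 `^ r)%:E * (W x `^ rho * (m x / 4) `^ r)%:E).
  apply/funext => x; rewrite -EFinM; congr (_%:E).
  by rewrite mulrCA -powRM ?divr_ge0// mulrC mulrC (mulrC 4%R) divfK.
have mWm4 : measurable_fun setT (fun x => (W x `^ rho * (m x / 4) `^ r)%:E : \bar R).
  under eq_fun do rewrite EFinM.
  apply: emeasurable_funM; apply: measurable_EFin_powR => //.
  exact: measurable_funM.
rewrite E ge0_integralZl_EFin ?powR_ge0//; last first.
  by move=> x _; rewrite lee_fin mulr_ge0 ?powR_ge0.
rewrite EFinM; apply: lee_wpmul2l; first by rewrite lee_fin powR_ge0.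
apply: (@ge0_integral_le_eventually _ _ _ nu F) => //.
  by move=> x; rewrite lee_fin mulr_ge0 ?powR_ge0.
move=> x; have [mx|mx] := eqVneq (m x) 0%R.
  by exists 0%N => n _; rewrite mx mul0r powR0 ?gt_eqF// mulr0.
have mxp : (0 < m x)%R by rewrite lt0r mx m0.
have [j [j1 j2]] := pow2_bracket mxp.
have Yj : Y j !=set0 by exists x.
have [_ snd scof] := sP j Yj.
have [n0 xn0] := scof x j1.
have snd' : {homo (fun n => a (s j n)) : k n / (k <= n)%N >-> (k <= n)%R}.
  by apply: homo_leq => //; exact: le_trans.
(* The family has to contain the level j, and the point of that level has to lie above x. *)
exists (maxn n0 `|j|%N) => n; rewrite geq_max => /andP[n0n jn].
have [i [iN ij]] : exists i : nat, (i < n.*2.+1)%N /\ lev n i = j.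
  exact: int_shift.
rewrite lee_fin ler_wpM2l ?powR_ge0//.
have Pi : P n i by apply/asboolP; rewrite ij.
rewrite big_mkcond (bigD1_seq i) ?mem_index_iota ?iota_uniq//=.
rewrite Pi indicE mem_set/=; last first.
  by rewrite /y ij (le_trans xn0)// snd'.
rewrite mulr1 -levE ij; apply: (@le_trans _ _ ((2 ^ j / 2) `^ r)%R).
  rewrite ge0_ler_powR ?(ltW r0) ?nnegrE ?divr_ge0 ?exprz_ge0//.
  by lra.
by rewrite lerDl sumr_ge0// => k _; case: ifP => // _; rewrite mulr_ge0 ?powR_ge0.
Qed.

End necessity_qp.

(** * Necessity for the Stieltjes operator *)

Section stieltjes_necessity.
Context d (T : measurableType d) (R : realType).
Variables (mu nu : {sigma_finite_measure set T -> \bar R}) (a : T -> R).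
Hypotheses (ma : measurable_fun setT a) (a0 : forall x, (0 < a x)%R).
Variables (v phi : T -> R) (p q c : R).
Hypotheses (mv : measurable_fun setT v) (v0 : forall x, (0 <= v x)%R).
Hypotheses (p0 : (0 < p)%R) (q0 : (0 < q)%R) (c0 : (0 <= c)%R).
Hypothesis phiE : forall y,
  \int[nu]_x ((a y / (a x + a y)) `^ q)%:E = (phi y)%:E.
Hypothesis phi0 : forall x, (0 < phi x)%R.

(** Stated for every [lam] below [m y] because the norm may be infinite or not attained. The lower
    bound holds at every [x], so the same functions test both halves. *)
Definition stieltjes_test_family (m : T -> \bar R) : Prop :=
  forall y (lam : R), (0 < lam)%R -> lam%:E < m y ->
  exists h : T -> \bar R, [/\ measurable_fun setT h, forall x, 0 <= h x,
    \int[mu]_x (h x `^ p * (v x)%:E) <= 1 &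
    forall x, (lam * (a y / (a x + a y)))%:E <= stieltjes_op mu a h x].

Hypothesis stieltjes_op_bounded : forall h, measurable_fun setT h -> (forall x, 0 <= h x) ->
  \int[nu]_x (stieltjes_op mu a h x `^ q) <=
    (c `^ q)%:E * (\int[mu]_x (h x `^ p * (v x)%:E)) `^ (q / p).

Let mker y : measurable_fun setT (fun x => ((a y / (a x + a y)) `^ q)%:E : \bar R).
Proof.
apply: measurable_EFin_powR; apply: measurable_funM => //.
apply: measurable_inv_fun => [|x]; first exact: measurable_funD.
by rewrite addr_gt0.
Qed.

(** Integrating the q-th power of the lower bound for a near extremizer gives lam ^ q * phi y <= c ^
    q; then [lam] tends to [m y], which is thereby finite. *)
Lemma stieltjes_necessity_sup m : (forall x, 0 <= m x) -> stieltjes_test_family m ->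
  forall y, (phi y `^ q^-1)%:E * m y <= c%:E.
Proof.
move=> m0 tf y.
have py0 : (0 < phi y `^ q^-1)%R by rewrite powR_gt0.
have key lam : (0 < lam)%R -> lam%:E < m y -> (phi y `^ q^-1 * lam <= c)%R.
  move=> l0 /(tf _ _ l0)[h [mh h0 h1 hl]].
  have : (lam `^ q * phi y)%:E <= (c `^ q)%:E.
    apply: (@le_trans _ _ (\int[nu]_x (stieltjes_op mu a h x `^ q))).
      rewrite EFinM -phiE -ge0_integralZl_EFin ?powR_ge0//; last first.
        by move=> x _; rewrite lee_fin powR_ge0.
      apply: ge0_integralT_le.
      - exact: measurable_funeM.
      - by apply: measurable_funP_poweR; exact: measurable_stieltjes_op.
      - by move=> x; rewrite mule_ge0// lee_fin powR_ge0.
      move=> x; apply: le_trans (lee_poweR (ltW q0) _ (hl x)); last first.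
        by rewrite lee_fin mulr_ge0 ?divr_ge0 ?addr_ge0 ?ltW.
      have k0 : (0 <= a y / (a x + a y))%R by rewrite divr_ge0 ?addr_ge0 ?(ltW (a0 _)).
      by rewrite poweR_EFin (powRM (x := lam)) ?(ltW l0).
    apply: (le_trans (stieltjes_op_bounded mh h0)); rewrite -[leRHS]mule1.
    apply: lee_wpmul2l; first by rewrite lee_fin powR_ge0.
    rewrite -(@poweR1r R (q / p)); apply: lee_poweR => //.
      by rewrite divr_ge0 ?ltW.
    by apply: integral_ge0 => x _; rewrite mule_ge0 ?poweR_ge0// lee_fin.
  rewrite lee_fin => /(ge0_ler_powR (r := q^-1)).
  rewrite invr_ge0 (ltW q0) !nnegrE mulr_ge0 ?powR_ge0 ?(ltW (phi0 y))// => /(_ isT isT isT).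
  rewrite powRM ?powR_ge0 ?(ltW (phi0 y))// -!powRrM divff ?(gt_eqF q0)// !powRr1 ?(ltW l0)//.
  by rewrite mulrC.
have [->|my] := eqVneq (m y) 0; first by rewrite mule0 lee_fin.
have my0 : 0 < m y by rewrite lt0e my m0.
rewrite muleC -lee_pdivlMr//.
apply/lee_addgt0Pr => e e0.
have H (z : R) : (z%:E < m y) -> (z <= c / phi y `^ q^-1)%R.
  move=> zm; have [z0|z0] := leP z 0%R; first by rewrite (le_trans z0)// divr_ge0// ltW.
  by rewrite ler_pdivlMr// mulrC; exact: key.
rewrite leNgt; apply/negP => lt.
have : (c / phi y `^ q^-1 + e)%:E < m y by rewrite EFinD EFinM.
by move=> /H; rewrite gerDl leNgt e0.
Qed.

(** The first power of 2 splits a power of W1 + a ^ q * W2, the next 2 counts the two halves, 2 ^ r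
    undoes the halving of [m], and the rest is the bound of [necessity_qp]. *)
Definition nec_const (p' q' : R) : R :=
  (2 `^ (q' / (p' - q')) * (2 * (2 `^ (p' * q' / (p' - q')) *
     (4 `^ (p' * q' / (p' - q')) * nec_const_qp p' q'))))%R.

(** [necessity_qp] is applied to m / 2 with [W1], and in reversed order to a m / 2 with [W2]; the
    halving reflects that the relevant kernel is at least 1 / 2 on its side. The two conclusions are
    combined through phi <= W1 + a ^ q * W2. *)
Lemma stieltjes_necessity_int (m W1 W2 : T -> R) (t0 : T) : (q < p)%R ->
  measurable_fun setT m -> (forall x, 0 <= m x)%R ->
  stieltjes_test_family (EFin \o m) ->
  (forall x, nu [set y | (a y <= a x)%R] = (W1 x)%:E) ->
  (forall x, \int[nu]_(y in [set y | (a x <= a y)%R]) (a y `^ (- q))%:E = (W2 x)%:E) ->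
  (forall x, 0 < W1 x)%R -> (forall x, 0 < W2 x)%R ->
  measurable_fun setT phi ->
  (forall x, phi x <= W1 x + a x `^ q * W2 x)%R ->
  \int[nu]_x (phi x `^ (q / (p - q)) * m x `^ (p * q / (p - q)))%:E <=
    (nec_const p q * c `^ (p * q / (p - q)))%:E.
Proof.
move=> qp mm m0 tf nuW1 nuW2 W10 W20 mphi phiW.
set rho := (q / (p - q))%R; set r := (p * q / (p - q))%R.
have pq0 : (0 < p - q)%R by rewrite subr_gt0.
have rho0 : (0 < rho)%R by rewrite divr_gt0.
have r0 : (0 < r)%R by rewrite divr_gt0// mulr_gt0.
have mpow (b : T -> R) s : measurable_fun setT b -> measurable_fun setT (fun x => b x `^ s)%R.
  by move=> mb; exact: (measurableT_comp (measurable_powR _)).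
have maq : measurable_fun setT (fun x => a x `^ (- q))%R by exact: mpow.
have aq0 x : (0 <= a x `^ (- q))%R by exact: powR_ge0.
pose nu2 : {sigma_finite_measure set T -> \bar R} := density_measure nu maq aq0.
have mNa : measurable_fun setT (\- a)%R by exact: measurableT_comp.
have nu2W2 x : nu2 [set y | ((\- a)%R y <= (\- a)%R x)%R] = (W2 x)%:E.
  by under eq_set do rewrite /= lerN2; exact: nuW2.
have mW1 := measurable_W ma nuW1.
have mW2 := measurable_W mNa nu2W2.
have mstl h : measurable_fun setT h -> (forall x, 0 <= h x) -> measurable_fun setT
  (stieltjes_op mu a h).
  by move=> mh h0; exact: measurable_stieltjes_op.
have stieltjes_op_le h g x : measurable_fun setT h -> measurable_fun setT g ->
    (forall x, 0 <= h x) -> (forall x, h x <= g x) -> stieltjes_op mu a h x <= stieltjes_op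
      mu a g x.
  move=> mh mg h0 hg; apply: ge0_integralT_le; try exact: measurable_stieltjes_op_integrand.
    by move=> t; rewrite mule_ge0// lee_fin invr_ge0 addr_ge0// ltW.
  by move=> t; rewrite lee_wpmul2r// lee_fin invr_ge0 addr_ge0// ltW.
have stlZ h (k : R) x : (0 <= k)%R -> measurable_fun setT h -> (forall x, 0 <= h x) ->
    stieltjes_op mu a (fun x => k%:E * h x) x = k%:E * stieltjes_op mu a h x.
  move=> k0 mh h0; rewrite /stieltjes_op -ge0_integralZl_EFin//; last 2 first.
  - by move=> t _; rewrite mule_ge0// lee_fin invr_ge0 addr_ge0// ltW.
  - exact: measurable_stieltjes_op_integrand.
  by apply: eq_integral => t _; rewrite muleA.
have half x y : (a x <= a y)%R -> (2^-1 <= a y / (a x + a y))%R.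
  by move=> xy; rewrite ler_pdivlMr ?addr_gt0// mulrC ler_pdivrMr// mulr_natr mulr2n lerD2r.
have N1 : \int[nu]_x (W1 x `^ rho * (m x / 2) `^ r)%:E <=
    (4 `^ r * (nec_const_qp p q * c `^ r))%:E.
  apply: (@necessity_qp _ _ _ mu nu a W1 ma W10 nuW1 v (fun x => m x / 2)%R p q c
    q0 qp mv v0 _ _ (stieltjes_op mu a)) => //.
  - exact: measurable_funM.
  - by move=> x; rewrite divr_ge0.
  - by move=> h x; exact: stieltjes_op_ge0.
  move=> y lam l0 lm; have [||h [mh h0 h1 hl]] := tf y (2 * lam)%R.
  - by rewrite mulr_gt0.
  - by rewrite lte_fin mulrC -ltr_pdivlMr.
  exists h; split => // x xy; apply: le_trans (hl x).
  rewrite lee_fin mulrAC -[leLHS]mul1r ler_wpM2r ?(ltW l0)//.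
  by rewrite -ler_pdivrMl// mulr1 half.
have N2 : \int[nu2]_x (W2 x `^ rho * (a x * m x / 2) `^ r)%:E <=
    (4 `^ r * (nec_const_qp p q * c `^ r))%:E.
  apply: (@necessity_qp _ _ _ mu nu2 (\- a)%R W2 mNa W20 nu2W2 v (fun x => a x * m x / 2)%R p q c
    q0 qp mv v0 _ _ (fun h x => (a x)%:E * stieltjes_op mu a h x)) => //.
  - by apply: measurable_funM => //; exact: measurable_funM.
  - by move=> x; rewrite divr_ge0// mulr_ge0// ltW.
  - by move=> h mh h0; apply: emeasurable_funM; [exact/measurable_EFinP|exact: mstl].
  - by move=> h x h0; rewrite mule_ge0 ?stieltjes_op_ge0// lee_fin ltW.
  - by move=> h g x mh mg h0 hg; rewrite lee_wpmul2l ?lee_fin ?(ltW (a0 x))// stieltjes_op_le.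
  - by move=> h k x k0 mh h0; rewrite stlZ// muleCA.
  - move=> h mh h0; apply: le_trans (stieltjes_op_bounded mh h0).
    rewrite integral_density; last 2 first.
    + apply: measurable_funP_poweR; apply: emeasurable_funM; last exact: mstl.
      exact/measurable_EFinP.
    + by move=> x; exact: poweR_ge0.
    rewrite le_eqVlt; apply/orP; left; apply/eqP; apply: eq_integral => x _.
    rewrite poweRM ?stieltjes_op_ge0 ?lee_fin ?(ltW (a0 x))// muleAC poweR_EFin -EFinM.
    by rewrite -powRD_gt0// subrr powRr0 mul1e.
  move=> y lam l0 lm; have [||h [mh h0 h1 hl]] := tf y (2 * lam / a y)%R.
  - by rewrite divr_gt0 ?mulr_gt0.
  - by rewrite lte_fin ltr_pdivrMr// (mulrC (m y)) (mulrC 2%R) -ltr_pdivlMr.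
  exists h; split => // x; rewrite /= lerN2 => xy.
  apply: (@le_trans _ _ ((a x)%:E * (2 * lam / a y * (a y / (a x + a y)))%:E)); last first.
    by rewrite lee_wpmul2l// lee_fin ltW.
  rewrite -EFinM lee_fin.
  have -> : (a x * (2 * lam / a y * (a y / (a x + a y))) = 2 * (a x / (a y + a x)) * lam)%R.
    by field; rewrite !gt_eqF// addr_gt0.
  by rewrite -[leLHS]mul1r ler_wpM2r ?(ltW l0)// -ler_pdivrMl// mulr1 half.
pose k : R := (4 `^ r * nec_const_qp p q)%R.
have mI1 : measurable_fun setT (fun x => (W1 x `^ rho * (m x / 2) `^ r)%:E : \bar R).
  by apply/measurable_EFinP; apply: measurable_funM; apply: mpow => //; exact: measurable_funM.
have mI2 : measurable_fun setT (fun x => (W2 x `^ rho * (a x * m x / 2) `^ r)%:E : \bar R).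
  apply/measurable_EFinP; apply: measurable_funM; apply: mpow => //.
  by apply: measurable_funM => //; exact: measurable_funM.
have I20 x : 0 <= (W2 x `^ rho * (a x * m x / 2) `^ r)%:E by rewrite lee_fin mulr_ge0 ?powR_ge0.
have mI2a : measurable_fun setT (fun x => (W2 x `^ rho * (a x * m x / 2) `^ r)%:E * (a x `^
  (- q))%:E).
  by apply: emeasurable_funM => //; exact/measurable_EFinP.
rewrite (@integral_density _ _ _ nu _ maq aq0 _ mI2 I20) in N2.
apply: (@le_trans _ _ (\int[nu]_x ((2 `^ rho * 2 `^ r)%:E * ((W1 x `^ rho * (m x / 2) `^ r)%:E +
    (W2 x `^ rho * (a x * m x / 2) `^ r)%:E * (a x `^ (- q))%:E)))).
  apply: ge0_integralT_le.
  - by apply/measurable_EFinP; apply: measurable_funM; exact: mpow.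
  - by apply: measurable_funeM; exact: emeasurable_funD.
  - by move=> x; rewrite lee_fin mulr_ge0 ?powR_ge0.
  move=> x; rewrite -!EFinM lee_fin /=.
  have aW2 : (0 <= a x `^ q * W2 x)%R by rewrite mulr_ge0 ?powR_ge0// ltW.
  have h1 : (phi x `^ rho <= 2 `^ rho * (W1 x `^ rho + (a x `^ q * W2 x) `^ rho))%R.
    apply: (@le_trans _ _ ((W1 x + a x `^ q * W2 x) `^ rho)%R).
      by apply: ge0_ler_powR; rewrite ?nnegrE ?addr_ge0// ltW.
    have := @poweR_add_le R (W1 x)%:E (a x `^ q * W2 x)%:E rho rho0.
    by rewrite !lee_fin (ltW (W10 x)) aW2 => /(_ isT isT).
  apply: (@le_trans _ _ (2 `^ rho * (W1 x `^ rho + (a x `^ q * W2 x) `^ rho) * m x `^ r)%R).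
    by rewrite ler_wpM2r ?powR_ge0.
  have m2 z : (0 <= z)%R -> (z `^ r = 2 `^ r * (z / 2) `^ r)%R.
    by move=> z0; rewrite -powRM ?divr_ge0// mulrC divfK.
  (* Again (p - q) * rho = q; the leftover a ^ (- q) is the density of [nu2]. *)
  have e : (a x `^ (q * rho) = a x `^ r * a x `^ (- q))%R.
    by rewrite -powRD_gt0//; congr (_ `^ _)%R; rewrite /rho /r; field; rewrite gt_eqF.
  rewrite powRM ?powR_ge0 ?(ltW (W20 x))// -powRrM e.
  rewrite le_eqVlt; apply/orP; left; apply/eqP.
  have e2 : ((a x * m x / 2) `^ r = a x `^ r * (m x / 2) `^ r)%R.
    by rewrite -mulrA powRM ?divr_ge0 ?(ltW (a0 x)).
  rewrite e2 (m2 _ (m0 x)).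
  by ring.
rewrite ge0_integralZl_EFin ?mulr_ge0 ?powR_ge0//; last 2 first.
- by move=> x _; rewrite adde_ge0 ?mule_ge0 ?lee_fin ?mulr_ge0 ?powR_ge0.
- exact: emeasurable_funD.
rewrite ge0_integralD//; last 2 first.
- by move=> x _; rewrite lee_fin mulr_ge0 ?powR_ge0.
- by move=> x _; rewrite mule_ge0// lee_fin.
apply: (@le_trans _ _ ((2 `^ rho * 2 `^ r)%:E * ((4 `^ r * (nec_const_qp p q * c `^ r))%:E +
    (4 `^ r * (nec_const_qp p q * c `^ r))%:E))).
  by apply: lee_wpmul2l; [rewrite lee_fin mulr_ge0 ?powR_ge0|exact: leeD].
rewrite -EFinD -EFinM lee_fin le_eqVlt; apply/orP; left; apply/eqP.
by rewrite /nec_const -/rho -/r; ring.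
Qed.

End stieltjes_necessity.

(** * Characterization in terms of the dual norm *)

Section stieltjes_characterization.
Context d (T : measurableType d) (R : realType).
Variables (mu nu : {sigma_finite_measure set T -> \bar R}) (a v : T -> R) (p q C : R).
Variable m : T -> \bar R.
Hypotheses (ma : measurable_fun setT a) (a0 : forall x, (0 < a x)%R).
Hypotheses (mv : measurable_fun setT v) (v0 : forall x, (0 <= v x)%R).
Hypotheses (p0 : (0 < p)%R) (q0 : (0 < q)%R) (C0 : (0 < C)%R).

(* The term \int U(y,x)^q w(x) dx of the theorem. *)
Definition Phi (y : T) : \bar R := \int[nu]_x ((a y / (a x + a y)) `^ q)%:E.

Hypothesis Phi_fin : forall y, Phi y < +oo.
Hypothesis W1_gt0 : forall x, 0 < nu [set y | (a y <= a x)%R].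
Hypothesis W2_gt0 : forall x, 0 < \int[nu]_(y in [set y | (a x <= a y)%R]) (a y `^ (- q))%:E.
Hypothesis m_gt0 : forall x, 0 < m x.
Hypothesis m_dec : forall x y, (a x <= a y)%R -> m y <= m x.
Hypothesis m_inc : forall x y, (a x <= a y)%R -> (a x)%:E * m x <= (a y)%:E * m y.
(** Measurability and the Hardy bounds are asked only if [m] is finite everywhere, which follows
    from either side of the equivalence. *)
Hypothesis m_meas : forall mr : T -> R, (forall x, m x = (mr x)%:E) -> measurable_fun setT mr.
Hypothesis m_tf : stieltjes_test_family mu a v p m.
Hypothesis m_hb : forall mr : T -> R, (forall x, m x = (mr x)%:E) ->
  hardy_bound mu a (fun x => v x * a x `^ p)%R (fun x => 2 `^ p * mr x `^ p)%R p C /\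
  hardy_bound mu (\- a)%R v (fun x => 2 `^ p * (a x * mr x) `^ p)%R p C.

Definition stieltjes_op_bounded_by (c : R) : Prop :=
  forall h : T -> \bar R, measurable_fun setT h -> (forall x, 0 <= h x) ->
  \int[nu]_x (stieltjes_op mu a h x `^ q) <=
    (c `^ q)%:E * (\int[mu]_x (h x `^ p * (v x)%:E)) `^ (q / p).

Let k (y x : T) : R := (a y / (a x + a y))%R.

Let k0 y x : (0 < k y x)%R.
Proof. by rewrite divr_gt0 ?addr_gt0. Qed.

Let k1 y x : (k y x <= 1)%R.
Proof. by rewrite ler_pdivrMr ?addr_gt0// mul1r lerDr ltW. Qed.

Let mkq2 : measurable_fun setT (fun z : T * T => ((k z.1 z.2) `^ q)%:E : \bar R).
Proof.
apply/measurable_EFinP; apply: (measurableT_comp (measurable_powR _)).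
apply: measurable_funM; first exact: (measurableT_comp ma).
have h : measurable_fun setT (fun z : T * T => (a z.2 + a z.1)%R).
  by apply: measurable_funD; exact: (measurableT_comp ma).
under eq_fun => z do rewrite -powR_inv1 ?addr_ge0 ?(ltW (a0 _))//.
exact: (measurableT_comp (measurable_powR _)).
Qed.

Let kq0 y x : 0 <= ((k y x) `^ q)%:E.
Proof. by rewrite lee_fin powR_ge0. Qed.

Let mkq y : measurable_fun setT (fun x => ((k y x) `^ q)%:E : \bar R).
Proof. exact: (measurableT_comp mkq2 (measurable_pair1 _)). Qed.

Let mPhi : measurable_fun setT Phi.
Proof.
exact: (measurable_fun_fubini_tonelli_F (m2 := nu) (fun z : T * T => ((k z.1 z.2) `^ q)%:E)).
Qed.

Let mA x := measurable_leset (a x) ma.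
Let mB x := measurable_geset (a x) ma.
Let maq : measurable_fun setT (fun x => (a x `^ (- q))%:E : \bar R).
Proof. exact: measurable_EFin_powR. Qed.
Let aq0 x : 0 <= (a x `^ (- q))%:E.
Proof. by rewrite lee_fin powR_ge0. Qed.

Let phi x : R := fine (Phi x).
Let W1 x : R := fine (nu [set y | (a y <= a x)%R]).
Let W2 x : R := fine (\int[nu]_(y in [set y | (a x <= a y)%R]) (a y `^ (- q))%:E).

Let Phi0 y : 0 <= Phi y.
Proof. by apply: integral_ge0 => x _; exact: kq0. Qed.
Let PhiE y : Phi y = (phi y)%:E.
Proof. by rewrite fineK// ge0_fin_numE. Qed.

Let PE x : Phi x = \int[nu]_y ((k x y) `^ q)%:E.
Proof. by []. Qed.

(** With [W2_Phi] and [Phi_W]: [k x y] lies between min(1, a x / a y) / 2 and min(1, a x / a y), so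
    [Phi x] is comparable to the mass below [x] plus a x ^ q times the integral of a ^ (- q) above
    it. *)
Let W1_Phi x : nu [set y | (a y <= a x)%R] <= (2 `^ q)%:E * Phi x.
Proof.
rewrite PE -ge0_integralZl_EFin ?powR_ge0//.
apply: (@le_trans _ _ (\int[nu]_(y in [set y | (a y <= a x)%R]) ((2 `^ q)%:E * ((k x y) `^
  q)%:E))).
  rewrite -[leLHS]mul1e -integral_cst//; apply: ge0_integral_in_le => //.
    exact: measurable_funeM.
  move=> y /= yx; rewrite -EFinM lee_fin -powRM ?(ltW (k0 _ _))//.
  have e : (1 = 1 `^ q :> R)%R by rewrite powR1.
  have kk : (1 <= 2 * k x y)%R.
    rewrite -ler_pdivrMl// mulr1 ler_pdivlMr ?addr_gt0// mulrC ler_pdivrMr//.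
    by rewrite mulr_natr mulr2n lerD2r.
  by rewrite [leLHS]e; apply: ge0_ler_powR; rewrite ?nnegrE ?(ltW q0) ?(le_trans _ kk).
apply: ge0_subset_integralT => //; first exact: measurable_funeM.
by move=> y; rewrite mule_ge0// lee_fin powR_ge0.
Qed.

Let W2_Phi x : \int[nu]_(y in [set y | (a x <= a y)%R]) (a y `^ (- q))%:E <=
  (2 `^ q * a x `^ (- q))%:E * Phi x.
Proof.
have c0 : (0 <= 2 `^ q * a x `^ (- q))%R by rewrite mulr_ge0 ?powR_ge0.
rewrite PE -ge0_integralZl_EFin//.
apply: (@le_trans _ _ (\int[nu]_(y in [set y | (a x <= a y)%R])
    ((2 `^ q * a x `^ (- q))%:E * ((k x y) `^ q)%:E))); last first.
  apply: ge0_subset_integralT => //; first exact: measurable_funeM.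
  by move=> y; rewrite mule_ge0// lee_fin.
apply: ge0_integral_in_le => //; first exact: measurable_funeM.
move=> y /= xy; rewrite -EFinM lee_fin.
have kk : ((a y)^-1 <= 2 * (a x)^-1 * k x y)%R.
  have -> : (2 * (a x)^-1 * k x y = 2 / (a y + a x))%R.
    by rewrite /k; field; rewrite !gt_eqF ?addr_gt0.
  rewrite ler_pdivlMr ?addr_gt0// mulrC ler_pdivrMr//.
  by rewrite [leRHS]mulr_natl mulr2n lerD2l.
have -> : (2 `^ q * a x `^ (- q) * k x y `^ q = (2 * (a x)^-1 * k x y) `^ q)%R.
  rewrite (powRM (y := k x y)) ?(ltW (k0 x y)) ?mulr_ge0 ?invr_ge0 ?(ltW (a0 _))//.
  by rewrite (powRM (x := 2%R)) ?invr_ge0 ?(ltW (a0 _))// powRV ?(ltW (a0 _))// powRN.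
rewrite powRN -powRV ?(ltW (a0 _))//.
by apply: ge0_ler_powR; rewrite ?nnegrE ?(ltW q0) ?invr_ge0 ?(ltW (a0 _)) ?(le_trans _ kk)
  ?invr_ge0 ?(ltW (a0 _)).
Qed.

Let Phi_W x : Phi x <= nu [set y | (a y <= a x)%R] +
  (a x `^ q)%:E * \int[nu]_(y in [set y | (a x <= a y)%R]) (a y `^ (- q))%:E.
Proof.
have mC : measurable (~` [set y | (a y <= a x)%R]) by exact: measurableC.
rewrite PE -(setUv [set y | (a y <= a x)%R]) ge0_integral_setU//; last 2 first.
- by apply: measurable_funTS.
- by apply/disj_setPS => t [].
apply: leeD.
  rewrite -[leRHS]mul1e -integral_cst//; apply: ge0_integral_in_le => // y _.
  rewrite lee_fin /= -[leRHS](congr1 (fun f => f q) (@powR1 R)).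
  by apply: ge0_ler_powR (k1 x y); rewrite ?nnegrE ?ler01 ?(ltW q0) ?(ltW (k0 x y)).
rewrite -ge0_integralZl_EFin ?powR_ge0//; last exact: measurable_funTS.
apply: (@le_trans _ _ (\int[nu]_(y in [set y | (a x <= a y)%R]) ((k x y) `^ q)%:E)).
  by apply: ge0_subset_integralT => // y /= /negP; rewrite -ltNge => /ltW.
apply: ge0_integral_in_le => //; first exact: measurable_funeM.
move=> y /= xy; rewrite -EFinM lee_fin powRN -powRV ?(ltW (a0 _))//.
rewrite -powRM ?invr_ge0 ?(ltW (a0 _))//.
have kk : (k x y <= a x * (a y)^-1)%R.
  rewrite /k ler_wpM2l ?(ltW (a0 _))// lef_pV2 ?posrE ?addr_gt0//.
  by rewrite lerDl ltW.
by apply: ge0_ler_powR kk; rewrite ?nnegrE ?(ltW q0) ?(ltW (k0 x y)) ?mulr_ge0 ?invr_ge0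
  ?(ltW (a0 _)).
Qed.

Let W1E x : nu [set y | (a y <= a x)%R] = (W1 x)%:E.
Proof.
rewrite fineK// ge0_fin_numE//; apply: (le_lt_trans (W1_Phi x)).
by rewrite PhiE -EFinM ltry.
Qed.

Let W2E x : \int[nu]_(y in [set y | (a x <= a y)%R]) (a y `^ (- q))%:E = (W2 x)%:E.
Proof.
rewrite fineK// ge0_fin_numE; last exact: integral_ge0.
by apply: (le_lt_trans (W2_Phi x)); rewrite PhiE -EFinM ltry.
Qed.

Let W10 x : (0 < W1 x)%R.
Proof. by have := W1_gt0 x; rewrite W1E. Qed.
Let W20 x : (0 < W2 x)%R.
Proof. by have := W2_gt0 x; rewrite W2E. Qed.
Let W1phi x : (W1 x <= 2 `^ q * phi x)%R.
Proof. by have := W1_Phi x; rewrite W1E PhiE -EFinM lee_fin. Qed.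
Let W2phi x : (W2 x <= 2 `^ q * (phi x * a x `^ (- q)))%R.
Proof.
by have := W2_Phi x; rewrite W2E PhiE -EFinM lee_fin -mulrA (mulrC (phi x)).
Qed.
Let phiW x : (phi x <= W1 x + a x `^ q * W2 x)%R.
Proof. by have := Phi_W x; rewrite W1E W2E PhiE -EFinM -EFinD lee_fin. Qed.
Let phi0 x : (0 < phi x)%R.
Proof.
have := lt_le_trans (W10 x) (W1phi x).
by rewrite pmulr_rgt0// powR_gt0.
Qed.
Let mphi : measurable_fun setT phi.
Proof.
by apply/measurable_EFinP; rewrite (_ : EFin \o phi = Phi)//; apply/funext => x /=; rewrite PhiE.
Qed.

Lemma Phi_gt0 x : 0 < Phi x.
Proof. by rewrite PhiE lte_fin. Qed.

Lemma stieltjes_op_bounded_sup c : (0 <= c)%R -> stieltjes_op_bounded_by c ->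
  forall x, Phi x `^ q^-1 * m x <= c%:E.
Proof.
move=> c0 bc x; rewrite PhiE poweR_EFin.
apply: (stieltjes_necessity_sup ma a0 v0 p0 q0 c0 PhiE phi0 bc) => // y.
exact: ltW.
Qed.

Let real_of_fin : (forall x, m x < +oo) -> exists mr : T -> R,
  (forall x, m x = (mr x)%:E) /\ (forall x, 0 < mr x)%R.
Proof.
move=> mfin; exists (fun x => fine (m x)).
have mE x : m x = (fine (m x))%:E by rewrite fineK// ge0_fin_numE// ltW.
by split => // x; rewrite -lte_fin -mE.
Qed.

Let m_fin_sup A : (forall x, Phi x `^ q^-1 * m x <= A%:E) -> forall x, m x < +oo.
Proof.
move=> h x; rewrite ltey; apply/eqP => mx; have := h x.
by rewrite mx PhiE poweR_EFin gt0_muley ?lte_fin ?powR_gt0.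
Qed.

Let mr_dec (mr : T -> R) : (forall x, m x = (mr x)%:E) ->
  forall x y, (a x <= a y)%R -> (mr y <= mr x)%R.
Proof. by move=> mE x y /m_dec; rewrite !mE lee_fin. Qed.

Let mr_inc (mr : T -> R) : (forall x, m x = (mr x)%:E) ->
  forall x y, (a x <= a y)%R -> (a x * mr x <= a y * mr y)%R.
Proof. by move=> mE x y /m_inc; rewrite !mE -!EFinM lee_fin. Qed.

Lemma sup_stieltjes_op_bounded A : (p <= q)%R -> (0 < A)%R ->
  (forall x, Phi x `^ q^-1 * m x <= A%:E) ->
  stieltjes_op_bounded_by (suff_const_pq p q C `^ q^-1 * A).
Proof.
move=> pq A0 hA h mh h0.
have [mr [mE mr0]] := real_of_fin (m_fin_sup hA).
have [HB1 HB2] := m_hb mE.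
rewrite powRM ?powR_ge0 ?(ltW A0)// -powRrM mulVf ?(gt_eqF q0)// powRr1; last first.
  by rewrite /suff_const_pq !mulr_ge0 ?powR_ge0.
apply: (stieltjes_sufficiency_pq ma a0 v0 mr0 p0 q0 C0 W1E W2E W10 W20 phi0 W1phi W2phi HB1
  HB2 pq A0) => //.
by move=> x; have := hA x; rewrite mE PhiE poweR_EFin -EFinM lee_fin.
Qed.

Let nu_gt0 (t0 : T) : 0 < nu setT.
Proof.
by apply: (lt_le_trans (W1_gt0 t0)); rewrite le_measure ?inE.
Qed.

Lemma stieltjes_op_bounded_int (t0 : T) c : (q < p)%R -> (0 <= c)%R ->
  stieltjes_op_bounded_by c ->
  \int[nu]_x (Phi x `^ (q / (p - q)) * m x `^ (p * q / (p - q))) <=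
    (nec_const p q * c `^ (p * q / (p - q)))%:E.
Proof.
move=> qp c0 bc.
have [mr [mE mr0]] := real_of_fin (m_fin_sup (stieltjes_op_bounded_sup c0 bc)).
have tf : stieltjes_test_family mu a v p (EFin \o mr).
  by rewrite (_ : EFin \o mr = m)//; apply/funext => x /=; rewrite mE.
under eq_integral do rewrite PhiE mE !poweR_EFin -EFinM.
apply: (stieltjes_necessity_int ma a0 mv v0 p0 q0 phi0 bc t0 qp (m_meas mE) _ tf W1E W2E) => // x.
exact: ltW.
Qed.

Lemma int_stieltjes_op_bounded (t0 : T) A : (q < p)%R -> (0 < A)%R ->
  \int[nu]_x (Phi x `^ (q / (p - q)) * m x `^ (p * q / (p - q))) <=
    (A `^ (p * q / (p - q)))%:E ->
  stieltjes_op_bounded_by (suff_const_qp p q C `^ q^-1 * A).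
Proof.
move=> qp A0 hA h mh h0.
have pq0 : (0 < p - q)%R by rewrite subr_gt0.
have r0 : (0 < p * q / (p - q))%R by rewrite divr_gt0// mulr_gt0.
(* Some value of [m] is finite, since otherwise the integrand would be +oo everywhere on a space of
   positive measure. As [m] decreases and a m increases, finiteness spreads to both sides of that
   point. *)
have [x0 mx0] : exists x0, m x0 < +oo.
  apply: contrapT => /forallNP h1.
  have my x : m x = +oo by apply/eqP; rewrite -leye_eq leNgt; apply/negP; exact: h1.
  move: hA; have -> : (fun x => Phi x `^ (q / (p - q)) * m x `^ (p * q / (p - q))) = cst +oo.
    by apply/funext => x; rewrite my poweRyr ?gt_eqF// gt0_muley// poweR_gt0// Phi_gt0.
  by rewrite integral_cst// gt0_mulye ?(nu_gt0 t0).
have mfin x : m x < +oo.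
  have [xx0|/ltW xx0] := leP (a x0) (a x); first exact: le_lt_trans (m_dec xx0) mx0.
  rewrite ltey; apply/eqP => mx; have := m_inc xx0; rewrite mx gt0_muley ?lte_fin//.
  by rewrite leye_eq => /eqP h1; move: mx0; rewrite ltey => /eqP; apply;
    move: h1; case: (m x0) => [z||]//=; rewrite ?gt0_muleNy ?lte_fin.
have [mr [mE mr0]] := real_of_fin mfin.
have [HB1 HB2] := m_hb mE.
rewrite powRM ?powR_ge0 ?(ltW A0)// -powRrM mulVf ?(gt_eqF q0)// powRr1; last first.
  by rewrite /suff_const_qp !mulr_ge0 ?powR_ge0.
apply: (stieltjes_sufficiency_qp ma a0 v0 (m_meas mE) mr0 p0 q0 C0 (mr_dec mE) (mr_inc mE)
  W1E W2E W10 W20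
  mphi phi0 W1phi W2phi HB1 HB2 qp A0) => //.
by move: hA; under eq_integral do rewrite PhiE mE !poweR_EFin -EFinM.
Qed.

End stieltjes_characterization.

(** * The half-line *)

Section positive_half_line.
Context {R : realType}.
Local Notation leb := (@lebesgue_measure R).
Local Notation D := (`]0%R, +oo[%classic : set R).

Lemma measurable_half_line : measurable D.
Proof. exact: measurable_itv. Qed.

Lemma half_lineE (x : R) : (x \in D) = (0 < x)%R.
Proof. by rewrite mem_setE in_itv/= andbT. Qed.

Definition on_pos (Y : Type) (f : R -> Y) (y : Y) (x : R) : Y := if (0 < x)%R then f x else y.

Lemma measurable_on_pos d' (Y : measurableType d') (f : R -> Y) (y : Y) :
  measurable_fun D f -> measurable_fun setT (on_pos f y).
Proof.
move=> mf; rewrite -(setUv D); apply/measurable_funU.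
- exact: measurable_half_line.
- by apply: measurableC; exact: measurable_half_line.
split.
  by apply: (eq_measurable_fun f) => // x; rewrite half_lineE /on_pos => ->.
apply: (eq_measurable_fun (cst y)) => // x; rewrite in_setC half_lineE /on_pos.
by move=> /negbTE ->.
Qed.

Lemma on_pos_ge0 (f : R -> R) : (forall x, 0 < x -> 0 <= f x)%R ->
  forall x, (0 <= on_pos f 0%R x)%R.
Proof. by move=> f0 x; rewrite /on_pos; case: ifP => // /f0. Qed.

Definition pos_indic : R -> R := on_pos (cst 1%R) 0%R.

Lemma measurable_pos_indic : measurable_fun setT pos_indic.
Proof. by apply: measurable_on_pos. Qed.

Lemma pos_indic_ge0 x : (0 <= pos_indic x)%R.
Proof. exact: on_pos_ge0. Qed.

(** Lebesgue measure carried by the half-line but defined on all of R, since the abstract results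
    integrate over a whole type. *)
Definition muD : {sigma_finite_measure set (measurableTypeR R) -> \bar R} :=
  density_measure leb measurable_pos_indic pos_indic_ge0.

Lemma integral_muD_in (B : set R) (f : R -> \bar R) : measurable B ->
  measurable_fun setT f -> (forall x, 0 <= f x) ->
  \int[muD]_(x in B) f x = \int[leb]_(x in D `&` B) f x.
Proof.
move=> mB mf f0; rewrite /muD integral_density_in//.
rewrite [LHS]integral_mkcond [RHS]integral_mkcond; apply: eq_integral => x _.
rewrite !patchE in_setI half_lineE /pos_indic /on_pos.
by case: (0 < x)%R; case: (x \in B); rewrite /= ?mule1 ?mule0.
Qed.

Lemma integral_muD (f : R -> \bar R) : measurable_fun setT f -> (forall x, 0 <= f x) ->
  \int[muD]_x f x = \int[leb]_(x in D) f x.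
Proof. by move=> mf f0; rewrite integral_muD_in// setIT. Qed.

Variables (U w : R -> R) (q : R).
Hypotheses (adm : admissible U) (ww : weight w) (q0 : (0 < q)%R).
Hypothesis nd : nondegenerate_wrt U w q.

Lemma weight_measurable (f : R -> R) : weight f -> measurable_fun D f.
Proof. by case=> -[]. Qed.

Lemma weight_ge0 (f : R -> R) x : weight f -> (0 < x)%R -> (0 <= f x)%R.
Proof. by case=> _; apply. Qed.

Lemma weight_integrable (f : R -> R) (s t : R) : weight f -> (0 < s)%R ->
  \int[leb]_(x in `[s, t]) (f x)%:E < +oo.
Proof.
move=> [[mf _ loc] f0] s0.
have sD : `[s, t]%classic `<=` D.
  by move=> x /=; rewrite !in_itv/= => /andP[sx _]; rewrite andbT (lt_le_trans s0).
have := loc _ sD (@segment_compact _ s t).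
rewrite (_ : \int[leb]_(x in `[s, t]) `|f x|%:E = \int[leb]_(x in `[s, t]) (f x)%:E)//.
apply: eq_integral => x; rewrite inE => /sD/=.
by rewrite in_itv/= andbT => /f0 fx; rewrite ger0_norm.
Qed.

Lemma admissible_lt x y : (0 <= x)%R -> (x < y)%R -> (U x < U y)%R.
Proof.
move: adm => [_ inc _ _] x0 xy; apply: inc => //; rewrite in_itv/= andbT//.
exact: le_trans (ltW xy).
Qed.

Lemma admissible_le x y : (0 <= x)%R -> (x <= y)%R -> (U x <= U y)%R.
Proof. by move=> x0; rewrite le_eqVlt => /predU1P[->//|/(admissible_lt x0)/ltW]. Qed.

Lemma admissible_gt0 x : (0 < x)%R -> (0 < U x)%R.
Proof.
by move=> x0; have [_ _ e0 _] := adm; rewrite -[ltLHS]e0; exact: admissible_lt.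
Qed.

Lemma admissible_small (al : R) : (0 < al)%R -> exists2 s, (0 < s)%R & (U s <= al)%R.
Proof.
move=> al0; move: adm => [/continuous_within_itvcyP[_ U0] _ e0 _].
move: U0; rewrite e0 => /cvgrPdist_le /(_ al al0)[e /= e0' he].
exists (e / 2)%R; first by rewrite divr_gt0.
have e2 : (0 < e / 2)%R by rewrite divr_gt0.
have be : ball_ (fun x : R => `|x|%R) 0%R e (e / 2)%R.
  rewrite /= sub0r normrN ger0_norm ?(ltW e2)//.
  by rewrite ltr_pdivrMr// mulr_natr mulr2n ltrDl.
have := he _ be e2.
by rewrite /= sub0r normrN => /(le_trans (ler_norm _)).
Qed.

Lemma admissible_large (al : R) : exists2 s, (0 < s)%R & (al <= U s)%R.
Proof.
move: adm => [_ _ _ /cvgryPge /(_ al)[M [_ hM]]].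
exists (Num.max 1 (M + 1))%R; first by rewrite lt_max ltr01.
by apply: hM; rewrite lt_max ltrDl ltr01 orbT.
Qed.

Lemma admissible_measurable : measurable_fun D U.
Proof.
apply: (eq_measurable_fun (on_pos U 0%R)).
  by move=> x; rewrite half_lineE /on_pos => ->.
apply: nondecreasing_measurable; first exact: measurable_half_line.
move=> x y xy; rewrite /on_pos; case: (ltP 0%R x) => x0.
  by rewrite (lt_le_trans x0 xy) admissible_le// ltW.
by case: ifP => // /admissible_gt0/ltW.
Qed.

(* The value off the half-line is irrelevant; it makes the function positive. *)
Definition unit_ext : R -> R := on_pos U 1%R.

Lemma unit_extE x : (0 < x)%R -> unit_ext x = U x.
Proof. by rewrite /unit_ext /on_pos => ->. Qed.

Lemma unit_ext_gt0 x : (0 < unit_ext x)%R.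
Proof. by rewrite /unit_ext /on_pos; case: ifP => // /admissible_gt0. Qed.

Lemma measurable_unit_ext : measurable_fun setT unit_ext.
Proof. exact: measurable_on_pos admissible_measurable. Qed.

Lemma measurable_on_pos_weight : measurable_fun setT (on_pos w 0%R).
Proof. by apply: measurable_on_pos; exact: weight_measurable. Qed.

Lemma on_pos_weight_ge0 x : (0 <= on_pos w 0%R x)%R.
Proof. by apply: on_pos_ge0 => y; exact: weight_ge0. Qed.

Definition nuD : {sigma_finite_measure set (measurableTypeR R) -> \bar R} :=
  density_measure muD measurable_on_pos_weight on_pos_weight_ge0.

Lemma integral_nuD_in (B : set R) (f : R -> \bar R) : measurable B ->
  measurable_fun setT f -> (forall x, 0 <= f x) ->
  \int[nuD]_(x in B) f x = \int[leb]_(x in D `&` B) (f x * (w x)%:E).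
Proof.
move=> mB mf f0; rewrite /nuD integral_density_in// integral_muD_in//; last 2 first.
- by apply: emeasurable_funM => //; apply/measurable_EFinP; exact: measurable_on_pos_weight.
- by move=> x; rewrite mule_ge0// lee_fin on_pos_weight_ge0.
apply: eq_integral => x; rewrite in_setI half_lineE /on_pos => /andP[-> _]//.
Qed.

Lemma integral_nuD (f : R -> \bar R) : measurable_fun setT f -> (forall x, 0 <= f x) ->
  \int[nuD]_x f x = \int[leb]_(x in D) (f x * (w x)%:E).
Proof. by move=> mf f0; rewrite integral_nuD_in// setIT. Qed.

Let nu_null_integral (i : interval R) (f : R -> \bar R) : [set` i] `<=` D ->
  measurable_fun setT f -> (forall x, 0 <= f x) -> nuD [set` i] = 0 ->
  \int[leb]_(x in [set` i]) (f x * (w x)%:E) = 0.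
Proof.
move=> iD mf f0 n0; have mi : measurable [set` i] by exact: measurable_itv.
rewrite -(setIidr iD) -integral_nuD_in//.
by apply: null_set_integral => //; exact: measurable_funTS.
Qed.

(** Otherwise w would vanish almost everywhere on some (0, s), and w / U ^ q would be integrable on
    (0, 1) because U >= U s > 0 on [s, 1], against non-degeneracy. *)
Lemma nuD_sub_gt0 x : 0 < nuD [set y | (unit_ext y <= unit_ext x)%R].
Proof.
rewrite lt0e measure_ge0 andbT; apply/eqP => n0.
have [s0 s00 sx] := admissible_small (unit_ext_gt0 x).
pose s := Num.min s0 2^-1%R.
have s01 : (0 < s)%R by rewrite lt_min s00/= invr_gt0.
have s1 : (s < 1)%R by rewrite gt_min orbC invf_lt1 ?ltr1n.
have n1 : nuD `]0%R, s[%classic = 0.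
  apply/eqP; rewrite eq_le measure_ge0 andbT -n0 le_measure ?inE//.
    exact: measurable_leset measurable_unit_ext.
  move=> y /=; rewrite in_itv/= => /andP[y0 ys]; rewrite unit_extE// (le_trans _ sx)//.
  by rewrite admissible_le ?(ltW y0)// (le_trans (ltW ys))// ge_min lexx.
have mUq : measurable_fun setT (fun y => (unit_ext y `^ (- q))%:E : \bar R).
  by apply: measurable_EFin_powR; exact: measurable_unit_ext.
have Uq0 y : 0 <= (unit_ext y `^ (- q))%:E by rewrite lee_fin powR_ge0.
have mw : measurable_fun D (fun y => (unit_ext y `^ (- q))%:E * (w y)%:E).
  apply: emeasurable_funM; first exact: measurable_funTS.
  by apply/measurable_EFinP; exact: weight_measurable.
case: nd => _ /= h _; move: h.
have -> : \int[leb]_(s in `]0%R, 1%R[) (w s / U s `^ q)%:E =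
    \int[leb]_(y in `]0%R, 1%R[) ((unit_ext y `^ (- q))%:E * (w y)%:E).
  apply: eq_integral => y; rewrite inE/= in_itv/= => /andP[y0 _].
  by rewrite unit_extE// -EFinM mulrC powRN.
have sub01 : `]0%R, 1%R[%classic `<=` `]0%R, s[%classic `|` `[s, 1%R]%classic.
  move=> y /=; rewrite !in_itv/= => /andP[y0 y1].
  by case: (ltP y s) => ys; [left; rewrite y0|right; rewrite ltW].
have subD : `]0%R, s[%classic `|` `[s, 1%R]%classic `<=` D.
  move=> y /= [|]; rewrite !in_itv/= andbT; first by case/andP.
  by case/andP => /(lt_le_trans s01).
move=> h; suff : \int[leb]_(y in `]0%R, 1%R[) ((unit_ext y `^ (- q))%:E * (w y)%:E) < +oo
  by rewrite h.
apply: (@le_lt_trans _ _ (\int[leb]_(y in `]0%R, s[%classic `|` `[s, 1%R]%classic)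
    ((unit_ext y `^ (- q))%:E * (w y)%:E))).
  apply: ge0_subset_integral => //.
  - by apply: measurableU; exact: measurable_itv.
  - exact: measurable_funS measurable_half_line subD mw.
  - by move=> y /subD/=; rewrite in_itv/= andbT => y0; rewrite mule_ge0// lee_fin (weight_ge0 ww).
rewrite ge0_integral_setU//; last 3 first.
- exact: measurable_funS measurable_half_line subD mw.
- by move=> y /subD/=; rewrite in_itv/= andbT => y0; rewrite mule_ge0// lee_fin (weight_ge0 ww).
- apply/disj_setPS => y [] /=; rewrite !in_itv/= => /andP[_ ys] /andP[sy _].
  by move: ys; rewrite ltNge sy.
rewrite nu_null_integral// ?add0e; last first.
  by move=> y yi; apply: subD; left.
have sD : `[s, 1%R]%classic `<=` D by move=> y yi; apply: subD; right.
apply: (@le_lt_trans _ _ ((U s `^ (- q))%:E * \int[leb]_(y in `[s, 1%R]) (w y)%:E)); last first.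
  by rewrite lte_mul_pinfty ?lee_fin ?powR_ge0// weight_integrable.
have msw : measurable_fun `[s, 1%R]%classic (EFin \o w).
  by apply/measurable_EFinP; exact: measurable_funS measurable_half_line sD
    (weight_measurable ww).
have w0s y : `[s, 1%R]%classic y -> 0 <= (w y)%:E.
  by move=> /sD/=; rewrite in_itv/= andbT => y0; rewrite lee_fin (weight_ge0 ww).
rewrite -ge0_integralZl_EFin ?powR_ge0//.
apply: ge0_le_integral => //.
- by move=> y yi; rewrite mule_ge0// w0s.
- exact: measurable_funS measurable_half_line sD mw.
- exact: measurable_funeM.
move=> y yi; apply: lee_wpmul2r; first exact: w0s.
move: yi => /=; rewrite in_itv/= => /andP[sy _]; have y0 := lt_le_trans s01 sy.
rewrite lee_fin unit_extE// !powRN lef_pV2 ?posrE ?powR_gt0 ?admissible_gt0//.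
by apply: ge0_ler_powR; rewrite ?nnegrE ?(ltW q0) ?(ltW (admissible_gt0 _)) ?admissible_le// ltW.
Qed.

(** If the integral vanished, so would the mass of w there, since the density U ^ (- q) is positive.
    Then w would be integrable at infinity, against non-degeneracy. *)
Lemma nuD_sup_gt0 x : 0 < \int[nuD]_(y in [set y | (unit_ext x <= unit_ext y)%R]) (unit_ext
  y `^ (- q))%:E.
Proof.
have mB := measurable_geset (unit_ext x) measurable_unit_ext.
have maq : measurable_fun setT (fun y => unit_ext y `^ (- q))%R.
  by apply: (measurableT_comp (measurable_powR _)); exact: measurable_unit_ext.
have aq0 y : (0 <= unit_ext y `^ (- q))%R by exact: powR_ge0.
pose nu2 : {sigma_finite_measure set (measurableTypeR R) -> \bar R} := density_measure nuD
  maq aq0.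
rewrite lt0e integral_ge0 ?andbT//; last by move=> y _; rewrite lee_fin.
apply/eqP => n0; have n2 : nu2 [set y | (unit_ext x <= unit_ext y)%R] = 0 by exact: n0.
have nB : nuD [set y | (unit_ext x <= unit_ext y)%R] = 0.
  have mU : measurable_fun setT (fun y => (unit_ext y `^ q)%:E : \bar R).
    by apply: measurable_EFin_powR; exact: measurable_unit_ext.
  have : \int[nu2]_(y in [set y | (unit_ext x <= unit_ext y)%R]) (unit_ext y `^ q)%:E = 0.
    by apply: null_set_integral => //; exact: measurable_funTS.
  rewrite integral_density_in//; last by move=> y; rewrite lee_fin powR_ge0.
  under eq_integral do rewrite -EFinM -powRD_gt0 ?unit_ext_gt0// subrr powRr0.
  by rewrite integral_cst// mul1e.
have [s s0 sx] := admissible_large (unit_ext x).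
have n1 : nuD `]s, +oo[%classic = 0.
  apply/eqP; rewrite eq_le measure_ge0 andbT -nB le_measure ?inE//.
  move=> y /=; rewrite in_itv/= andbT => sy; rewrite [unit_ext y]unit_extE ?(lt_trans s0)//.
  by rewrite (le_trans sx)// admissible_le// ltW.
have sD : `]s, +oo[%classic `<=` D.
  by move=> y /=; rewrite !in_itv/= !andbT; exact: lt_trans.
have oD : `[1%R, s]%classic `<=` D.
  by move=> y /=; rewrite !in_itv/= !andbT => /andP[]; move/(lt_le_trans ltr01).
have subD : `[1%R, s]%classic `|` `]s, +oo[%classic `<=` D by move=> y [/oD|/sD].
have mw := weight_measurable ww.
case: nd => _ _ /= h.
suff : \int[leb]_(y in `]1%R, +oo[) (w y)%:E < +oo by rewrite h.
have w0 y : D y -> 0 <= (w y)%:E.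
  by rewrite /= in_itv/= andbT => y0; rewrite lee_fin (weight_ge0 ww).
apply: (@le_lt_trans _ _ (\int[leb]_(y in `[1%R, s]%classic `|` `]s, +oo[%classic) (w y)%:E)).
  apply: ge0_subset_integral => //.
  - by apply: measurableU; exact: measurable_itv.
  - by apply/measurable_EFinP; exact: measurable_funS measurable_half_line subD mw.
  - by move=> y /subD/w0.
  - move=> y /=; rewrite !in_itv/= !andbT => y1.
    by case: (leP y s) => ys; [left; rewrite ltW|right].
rewrite ge0_integral_setU//; last 3 first.
- by apply/measurable_EFinP; exact: measurable_funS measurable_half_line subD mw.
- by move=> y /subD/w0.
- apply/disj_setPS => y [] /=; rewrite !in_itv/= andbT => /andP[_ ys].
  by rewrite ltNge ys.
have -> : \int[leb]_(y in `]s, +oo[) (w y)%:E = 0.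
  have := @nu_null_integral `]s, +oo[ (cst 1) sD (@measurable_cst _ _ _ _ _ _) _ n1.
  by under eq_integral do rewrite mul1e; apply.
by rewrite adde0 weight_integrable.
Qed.

Lemma Phi_nuDE y : Phi nuD unit_ext q y = \int[leb]_(x in D) ((unit_ext y / (unit_ext x +
  unit_ext y)) `^ q * w x)%:E.
Proof.
rewrite /Phi integral_nuD//; last by move=> x; rewrite lee_fin powR_ge0.
apply: measurable_EFin_powR; apply: measurable_funM => //.
apply: measurable_inv_fun => [|x]; last by rewrite addr_gt0 ?unit_ext_gt0.
by apply: measurable_funD => //; exact: measurable_unit_ext.
Qed.

(** The kernel increases with U y, so [y] may be replaced by a point [t] of larger level. Then (U x
    + U t) ^ q >= (U x ^ q + U t ^ q) / 2 reduces the claim to the first clause of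
    non-degeneracy. *)
Lemma Phi_nuD_fin y : Phi nuD unit_ext q y < +oo.
Proof.
have [t t0 yt] := admissible_large (unit_ext y).
have Ut0 := admissible_gt0 t0.
have c0 : (0 < 2 * U t `^ q)%R by rewrite mulr_gt0// powR_gt0.
have mk : measurable_fun D (fun x => (w x / (U x `^ q + U t `^ q))%:E).
  apply/measurable_EFinP; apply: measurable_funM; first exact: weight_measurable.
  apply: (eq_measurable_fun (fun x => (unit_ext x `^ q + U t `^ q)^-1)%R).
    by move=> x; rewrite half_lineE => x0; rewrite unit_extE.
  apply: measurable_funTS; apply: measurable_inv_fun => [|x].
    apply: measurable_funD => //; apply: (measurableT_comp (measurable_powR _)).
    exact: measurable_unit_ext.
  by rewrite addr_gt0 ?powR_gt0 ?unit_ext_gt0.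
have k0 x : D x -> 0 <= (w x / (U x `^ q + U t `^ q))%:E.
  rewrite /= in_itv/= andbT => x0.
  by rewrite lee_fin divr_ge0 ?(weight_ge0 ww)// addr_ge0 ?powR_ge0.
rewrite Phi_nuDE.
apply: (@le_lt_trans _ _ ((2 * U t `^ q)%:E * \int[leb]_(x in D) (w x / (U x `^ q + U t `^
  q))%:E)).
  rewrite -ge0_integralZl_EFin ?(ltW c0)//.
  apply: ge0_le_integral => //.
  - move=> x; rewrite /= in_itv/= andbT => x0.
    by rewrite lee_fin mulr_ge0 ?powR_ge0// (weight_ge0 ww).
  - apply/measurable_EFinP; apply: measurable_funM; last exact: weight_measurable.
    apply: measurable_funTS; apply: (measurableT_comp (measurable_powR _)).
    apply: measurable_funM => //; apply: measurable_inv_fun => [|x].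
      by apply: measurable_funD => //; exact: measurable_unit_ext.
    by rewrite addr_gt0 ?unit_ext_gt0.
  - exact: measurable_funeM.
  move=> x; rewrite /= in_itv/= andbT => x0.
  have Ux0 := admissible_gt0 x0.
  rewrite -EFinM lee_fin.
  have -> : (2 * U t `^ q * (w x / (U x `^ q + U t `^ q)) =
    U t `^ q * (2 / (U x `^ q + U t `^ q)) * w x)%R by ring.
  rewrite ler_wpM2r ?(weight_ge0 ww)// [unit_ext x]unit_extE//.
  have h1 : (unit_ext y / (U x + unit_ext y) <= U t / (U x + U t))%R.
    rewrite ler_pdivrMr ?addr_gt0 ?unit_ext_gt0// mulrAC ler_pdivlMr ?addr_gt0//.
    by rewrite !mulrDr (mulrC (U t) (unit_ext y)) lerD2r ler_wpM2r// ltW.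
  apply: (@le_trans _ _ ((U t / (U x + U t)) `^ q)%R).
    apply: ge0_ler_powR h1; rewrite ?nnegrE ?(ltW q0)//.
      by rewrite divr_ge0 ?addr_ge0 ?(ltW (unit_ext_gt0 _)) ?(ltW Ux0).
    by rewrite divr_ge0 ?addr_ge0 ?(ltW Ut0) ?(ltW Ux0).
  rewrite powRM ?invr_ge0 ?addr_ge0 ?(ltW Ut0) ?(ltW Ux0)//.
  rewrite powRV ?addr_ge0 ?(ltW Ut0) ?(ltW Ux0)// ler_wpM2l ?powR_ge0//.
  rewrite ler_pdivlMr ?addr_gt0 ?powR_gt0// mulrC ler_pdivrMr ?powR_gt0 ?addr_gt0//.
  rewrite mulr_natl mulr2n.
  by rewrite lerD// ge0_ler_powR ?nnegrE ?(ltW q0) ?addr_ge0 ?(ltW Ux0) ?(ltW Ut0)//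
    (lerDl, lerDr) ltW.
rewrite lte_mul_pinfty ?lee_fin ?(ltW c0)//.
by case: nd => /(_ t t0).
Qed.

End positive_half_line.

(** * Criteria for the best constant, and translation to the half-line *)

Section characterization_criteria.
Context {R : realType}.

(** Sufficiency is asked for c > 0 only: S may be 0, and the best constant, an infimum, is
    approached through lam * S + e with e > 0. *)
Lemma characterized_byI (lam : R) (p q : \bar R) (U v w : R -> R) (S : \bar R) :
  (0 < lam)%R -> 0 <= S ->
  (forall c, stieltjes_ineq p q U v w c -> S <= lam%:E * c%:E) ->
  (forall c : R, (0 < c)%R -> lam%:E * S <= c%:E -> stieltjes_ineq p q U v w c) ->
  characterized_by lam p q U v w S.
Proof.
move=> lam0 S0 nec suf.
have lamV0 : (0 < lam^-1)%R by rewrite invr_gt0.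
split.
  split=> [[c /nec Sc]|Sfin]; first by rewrite (le_lt_trans Sc)// -EFinM ltry.
  have [s Ss] : exists s, S = s%:E by exists (fine S); rewrite fineK// ge0_fin_numE.
  have s0 : (0 <= s)%R by rewrite -lee_fin -Ss.
  exists (lam * s + 1)%R; apply: suf; first by rewrite ltr_wpDl// mulr_ge0// ltW.
  by rewrite Ss -EFinM lee_fin lerDl.
apply/andP; split.
  have [->|Sy] := eqVneq S +oo; first exact: leey.
  have [s Ss] : exists s, S = s%:E by exists (fine S); rewrite fineK// ge0_fin_numE// ltey.
  have s0 : (0 <= s)%R by rewrite -lee_fin -Ss.
  rewrite Ss -lee_pdivlMl// invrK -EFinM; apply/lee_addgt0Pr => e e0.
  rewrite -EFinD; apply: ereal_inf_lbound; exists (lam * s + e)%R => //=.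
  apply: suf; first by rewrite ltr_wpDl// mulr_ge0// ltW.
  by rewrite Ss -EFinM lee_fin lerDl ltW.
rewrite -lee_pdivrMl//; apply: le_ereal_inf_tmp => _ [c /nec Sc <-].
by rewrite lee_pdivrMl.
Qed.

Local Notation leb := (@lebesgue_measure R).
Local Notation D := (`]0%R, +oo[%classic : set R).

Variables (U v w : R -> R) (p q : R).
Hypotheses (adm : admissible U) (wv : weight v) (ww : weight w).
Hypotheses (p0 : (0 < p)%R) (q0 : (0 < q)%R).

Let a := unit_ext U.
Let a0 := unit_ext_gt0 adm.
Let ma := measurable_unit_ext adm.
Let nu := nuD ww.
Definition zero_ext : R -> R := on_pos v 0%R.

Lemma measurable_zero_ext : measurable_fun setT zero_ext.
Proof. exact: measurable_on_pos_weight. Qed.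

Lemma zero_ext_ge0 x : (0 <= zero_ext x)%R.
Proof. exact: on_pos_weight_ge0. Qed.

Lemma stieltjes_op_muDE (h : R -> \bar R) x : measurable_fun setT h -> (forall x, 0 <= h x) ->
  stieltjes_op muD a h x = \int[leb]_(t in D) (h t * ((a x + a t)^-1)%:E).
Proof.
move=> mh h0; rewrite /stieltjes_op integral_muD//;
  first exact: measurable_stieltjes_op_integrand.
by move=> t; rewrite mule_ge0// lee_fin invr_ge0 addr_ge0// ltW// a0.
Qed.

Let on_pos_meas (h : R -> \bar R) : Mplus h -> measurable_fun setT (on_pos h 0).
Proof. by case=> mh _; exact: measurable_on_pos. Qed.

Let on_pos_ge0E (h : R -> \bar R) : Mplus h -> forall x, 0 <= on_pos h 0 x.
Proof. by case=> _ h0 x; rewrite /on_pos; case: ifP => // /h0. Qed.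

Lemma stieltjesE h x : Mplus h -> (0 < x)%R ->
  stieltjes U h x = stieltjes_op muD a (on_pos h 0) x.
Proof.
move=> hM x0; rewrite stieltjes_op_muDE; [|exact: on_pos_meas|exact: on_pos_ge0E].
apply: eq_integral => t; rewrite half_lineE => t0.
rewrite /on_pos t0 /a !unit_extE// inver gt_eqF// addr_gt0//; exact: (admissible_gt0 adm).
Qed.

Lemma wnorm_vE h : Mplus h ->
  wnorm p%:E v h = (\int[muD]_x (on_pos h 0 x `^ p * (zero_ext x)%:E)) `^ p^-1.
Proof.
move=> hM; rewrite /wnorm integral_muD; first last.
- by move=> x; rewrite mule_ge0 ?poweR_ge0// lee_fin zero_ext_ge0.
- apply: emeasurable_funM; last by apply/measurable_EFinP; exact: measurable_zero_ext.
  by apply: measurable_funP_poweR; exact: on_pos_meas.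
congr (_ `^ _); apply: eq_integral => x; rewrite half_lineE => x0.
by rewrite /zero_ext /on_pos x0 gee0_abs//; case: hM => _; apply.
Qed.

Lemma wnorm_stieltjesE h : Mplus h ->
  wnorm q%:E w (stieltjes U h) = (\int[nu]_x (stieltjes_op muD a (on_pos h 0) x `^ q)) `^ q^-1.
Proof.
move=> hM; have mh := on_pos_meas hM; have h0 := on_pos_ge0E hM.
rewrite /wnorm integral_nuD; first last.
- by move=> x; exact: poweR_ge0.
- by apply: measurable_funP_poweR; exact: (measurable_stieltjes_op muD ma a0 mh h0).
congr (_ `^ _); apply: eq_integral => x; rewrite half_lineE => x0.
by rewrite stieltjesE// gee0_abs// stieltjes_op_ge0.
Qed.

(** Both sides are raised to the power q and functions are extended by 0 off the half-line; neither
    changes the constant. *)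
Lemma stieltjes_ineqP c :
  stieltjes_ineq p%:E q%:E U v w c <->
  (0 <= c)%R /\ stieltjes_op_bounded_by muD nu a zero_ext p q c.
Proof.
have pw (X N : \bar R) : (0 <= c)%R -> 0 <= X -> 0 <= N ->
    (X `^ q^-1 <= c%:E * N `^ p^-1) <-> (X <= (c `^ q)%:E * N `^ (q / p)).
  move=> c0 X0 N0.
  have e : (c%:E * N `^ p^-1) `^ q = (c `^ q)%:E * N `^ (q / p).
    by rewrite poweRM ?poweR_ge0 ?lee_fin// -poweRrM poweR_EFin (mulrC p^-1%R).
  split=> h.
    by rewrite -e -(@poweRVK _ X q) ?(gt_eqF q0)// lee_poweR ?(ltW q0) ?poweR_ge0.
  rewrite -(@poweRK _ (c%:E * N `^ p^-1) q) ?(gt_eqF q0)//; last first.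
    by rewrite mule_ge0 ?poweR_ge0// lee_fin.
  by rewrite e lee_poweR ?invr_ge0 ?(ltW q0).
have N0 h : 0 <= \int[muD]_x (h x `^ p * (zero_ext x)%:E).
  by apply: integral_ge0 => x _; rewrite mule_ge0 ?poweR_ge0// lee_fin zero_ext_ge0.
have X0 h : 0 <= \int[nu]_x (stieltjes_op muD a h x `^ q).
  by apply: integral_ge0 => x _; exact: poweR_ge0.
split=> -[c0 H]; split=> //.
  move=> h mh h0.
  have hM : Mplus h by split; [exact: measurable_funTS|move=> x _; exact: h0].
  have := H h hM; rewrite wnorm_stieltjesE// wnorm_vE// => /(pw _ _ c0 (X0 _) (N0 _)).
  have -> : \int[muD]_x (on_pos h 0 x `^ p * (zero_ext x)%:E) = \int[muD]_x (h x `^ p *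
    (zero_ext x)%:E).
    apply: eq_integral => x _; rewrite /zero_ext /on_pos.
    by case: ifP => //; rewrite !mule0.
  have -> : stieltjes_op muD a (on_pos h 0) = stieltjes_op muD a h; last by [].
  apply/funext => x; rewrite !stieltjes_op_muDE//; [|exact: on_pos_meas|exact: on_pos_ge0E].
  by apply: eq_integral => t; rewrite half_lineE /on_pos => ->.
move=> h hM; rewrite wnorm_stieltjesE// wnorm_vE//.
apply/(pw _ _ c0 (X0 _) (N0 _)); apply: H; [exact: on_pos_meas|exact: on_pos_ge0E].
Qed.

Lemma WintE x : (0 < x)%R -> Wint U w q x = Phi nu a q x.
Proof.
move=> x0; rewrite /nu (Phi_nuDE q adm ww) /Wint; apply: eq_integral => t.
rewrite half_lineE => t0; by rewrite /kernelU /a !unit_extE.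
Qed.

End characterization_criteria.

(** * From a candidate for the dual norm to the two-sided estimate *)

Section criterion.
Context {R : realType}.
Local Notation leb := (@lebesgue_measure R).
Local Notation D := (`]0%R, +oo[%classic : set R).

(* What a candidate m for the dual norm of the kernel has to satisfy: the two
   Hardy bounds are those of the two halves of the Stieltjes operator. *)
Record criterion (U v : R -> R) (p C : R) (m : R -> \bar R) : Prop := {
  criterion_gt0 : forall x, 0 < m x ;
  criterion_dec : forall x y, (unit_ext U x <= unit_ext U y)%R -> m y <= m x ;
  criterion_inc : forall x y, (unit_ext U x <= unit_ext U y)%R ->
    (unit_ext U x)%:E * m x <= (unit_ext U y)%:E * m y ;
  criterion_measurable : forall mr : R -> R, (forall x, m x = (mr x)%:E) ->
    measurable_fun setT mr ;
  criterion_test : stieltjes_test_family muD (unit_ext U) (zero_ext v) p m ;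
  criterion_hardy : forall mr : R -> R, (forall x, m x = (mr x)%:E) ->
    hardy_bound muD (unit_ext U) (fun x => zero_ext v x * unit_ext U x `^ p)%R (fun x => 2
      `^ p * mr x `^ p)%R p C /\
    hardy_bound muD (\- unit_ext U)%R (zero_ext v) (fun x => 2 `^ p * (unit_ext U x * mr x)
      `^ p)%R p C }.

(** With K the sufficiency constant to the power 1 / q, K + 1 is positive even if K = 0, and K * (c
    / (K + 1)) <= c. The 2 is the slack in the hypotheses of [characterized_pq]; being at least 1,
    the constant also serves necessity. *)
Definition equiv_const_pq (p q C : R) : R := (2 * (suff_const_pq p q C `^ q^-1 + 1))%R.

Definition equiv_const_qp (p q C : R) : R :=
  (nec_const p q `^ (p * q / (p - q))^-1 + 2 * (suff_const_qp p q C `^ q^-1 + 1))%R.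

Lemma equiv_const_pq_gt0 p q C : (0 < equiv_const_pq p q C)%R.
Proof. by rewrite mulr_gt0// ltr_wpDl ?powR_ge0. Qed.

Lemma equiv_const_qp_gt0 p q C : (0 < equiv_const_qp p q C)%R.
Proof. by rewrite ltr_wpDl ?powR_ge0// mulr_gt0// ltr_wpDl ?powR_ge0. Qed.

Variables (U v w : R -> R) (p q C : R) (m : R -> \bar R).
Hypotheses (adm : admissible U) (wv : weight v) (ww : weight w).
Hypotheses (p0 : (0 < p)%R) (q0 : (0 < q)%R) (C0 : (0 < C)%R).
Hypothesis nd : nondegenerate_wrt U w q.
Hypothesis crit : criterion U v p C m.

Let a := unit_ext U.
Let nu := nuD ww.
Let ma := measurable_unit_ext adm.
Let a0 := unit_ext_gt0 adm.
Let mv := measurable_zero_ext wv.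
Let vge0 := zero_ext_ge0 wv.
Let Pfin := Phi_nuD_fin adm ww q0 nd.
Let W1p := nuD_sub_gt0 adm ww q0 nd.
Let W2p := nuD_sup_gt0 adm ww nd.
Let cgt0 := criterion_gt0 crit.
Let cdec := criterion_dec crit.
Let cinc := criterion_inc crit.
Let cmeas := criterion_measurable crit.
Let ctest := criterion_test crit.
Let chardy := criterion_hardy crit.

(** Off the half-line [unit_ext] is 1, a value that U attains by the intermediate value theorem;
    conditions over all of R thus reduce to x > 0. *)
Lemma unit_ext_onto x : exists2 y, (0 < y)%R & a y = a x.
Proof.
have [x0|x0] := boolP (0 < x)%R; first by exists x.
have [s s0 us] := admissible_large adm (a x).
have [c cs Uc] : exists2 c, c \in `[0%R, s] & U c = a x.
  apply: IVT; first exact: ltW.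
    case: adm => cU _ _ _; apply: continuous_subspaceW cU => z /=.
    by rewrite !in_itv/= => /andP[->].
  have [_ _ U0 _] := adm.
  by rewrite U0 ge_min le_max (ltW (a0 x)) us orbT.
have c0 : (0 < c)%R.
  rewrite lt_neqAle; move: cs; rewrite in_itv/= => /andP[-> _]; rewrite andbT.
  apply/eqP => c0; have := a0 x; rewrite -[unit_ext U x]/(a x) -Uc -c0.
  by have [_ _ -> _] := adm; rewrite ltxx.
by exists c => //; rewrite -Uc /a unit_extE.
Qed.

Lemma criterion_term_onto x : exists2 y, (0 < y)%R &
  Phi nu a q x `^ q^-1 * m x = Phi nu a q y `^ q^-1 * m y.
Proof.
have [y y0 yx] := unit_ext_onto x; exists y => //.
have -> : Phi nu a q x = Phi nu a q y by rewrite /Phi yx.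
by congr (_ * _); apply/eqP; rewrite eq_le !cdec// -/a yx.
Qed.

Lemma stieltjes_op_bounded_by_le c c' : (0 <= c)%R -> (c <= c')%R ->
  stieltjes_op_bounded_by (T := measurableTypeR R) muD nu a (zero_ext v) p q c ->
  stieltjes_op_bounded_by (T := measurableTypeR R) muD nu a (zero_ext v) p q c'.
Proof.
move=> c0 cc' H h mh h0; apply: (le_trans (H h mh h0)).
apply: lee_wpmul2r; first exact: poweR_ge0.
by rewrite lee_fin ge0_ler_powR ?nnegrE ?(ltW q0)// (le_trans c0).
Qed.

Lemma characterized_pq (S : \bar R) : (p <= q)%R -> 0 <= S ->
  (forall B, (forall x, (0 < x)%R -> Phi nu a q x `^ q^-1 * m x <= B) -> S <= B) ->
  (forall x, (0 < x)%R -> Phi nu a q x `^ q^-1 * m x <= 2%:E * S) ->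
  characterized_by (equiv_const_pq p q C) p%:E q%:E U v w S.
Proof.
move=> pq S0 Sle leS.
set K := (suff_const_pq p q C `^ q^-1)%R.
have K0 : (0 <= K)%R by exact: powR_ge0.
have K1 : (0 < K + 1)%R by rewrite ltr_wpDl.
have lamE : equiv_const_pq p q C = (2 * (K + 1))%R by [].
apply: characterized_byI => //; first exact: equiv_const_pq_gt0.
  move=> c /(stieltjes_ineqP p adm wv ww q0 c)[c0 bc].
  apply: (@le_trans _ _ c%:E).
    apply: Sle => x x0.
    exact: (stieltjes_op_bounded_sup (mu := muD) (nu := nu) ma a0 vge0 p0 q0 Pfin W1p cgt0
      ctest c0 bc).
  rewrite -EFinM lee_fin ler_peMl// lamE; lra.
move=> c c0 lamS; apply/(stieltjes_ineqP p adm wv ww q0 c); split; first exact: ltW.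
have A0 : (0 < c / (K + 1))%R by rewrite divr_gt0.
apply: (@stieltjes_op_bounded_by_le (K * (c / (K + 1)))%R).
- by rewrite mulr_ge0// ltW.
- by rewrite mulrCA ler_piMr ?(ltW c0)// ler_pdivrMr// mul1r lerDl.
apply: (sup_stieltjes_op_bounded (mu := muD) (nu := nu) ma a0 vge0 p0 q0 C0 Pfin W1p W2p cgt0 chardy
  pq A0).
move=> x; have [y y0 ->] := criterion_term_onto x.
apply: (le_trans (leS y y0)).
rewrite EFinM lee_pdivlMr// (muleC _ (_ + _)%:E) muleA -EFinM (mulrC (K + 1)%R).
by rewrite -lamE.
Qed.

Lemma characterized_qp (S : \bar R) : (q < p)%R -> 0 <= S ->
  S `^ (p * q / (p - q)) <=
    \int[nu]_x (Phi nu a q x `^ (q / (p - q)) * m x `^ (p * q / (p - q))) ->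
  \int[nu]_x (Phi nu a q x `^ (q / (p - q)) * m x `^ (p * q / (p - q))) <=
    (2 `^ (p * q / (p - q)))%:E * S `^ (p * q / (p - q)) ->
  characterized_by (equiv_const_qp p q C) p%:E q%:E U v w S.
Proof.
move=> qp S0 Sle leS.
set r := (p * q / (p - q))%R in Sle leS *.
have pq0 : (0 < p - q)%R by rewrite subr_gt0.
have r0 : (0 < r)%R by rewrite divr_gt0// mulr_gt0.
set K := (suff_const_qp p q C `^ q^-1)%R.
have K0 : (0 <= K)%R by exact: powR_ge0.
have K1 : (0 < K + 1)%R by rewrite ltr_wpDl.
have N0 : (0 <= nec_const p q `^ r^-1)%R by exact: powR_ge0.
have lamE : equiv_const_qp p q C = (nec_const p q `^ r^-1 + 2 * (K + 1))%R by [].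
apply: characterized_byI => //; first exact: equiv_const_qp_gt0.
  move=> c /(stieltjes_ineqP p adm wv ww q0 c)[c0 bc].
  have h := le_trans Sle (stieltjes_op_bounded_int (mu := muD) (nu := nu) ma a0 mv vge0 p0
    q0 Pfin W1p W2p cgt0 cmeas ctest 0%R qp c0 bc).
  apply: (@le_trans _ _ (nec_const p q `^ r^-1 * c)%:E).
    have nc0 : (0 <= nec_const p q)%R.
      by rewrite /nec_const !mulr_ge0 ?powR_ge0.
    rewrite -(@poweRK _ S r) ?(gt_eqF r0)//.
    have -> : (nec_const p q `^ r^-1 * c = (nec_const p q * c `^ r) `^ r^-1)%R.
      by rewrite powRM ?powR_ge0// -powRrM divff ?(gt_eqF r0)// powRr1.
    rewrite -poweR_EFin lee_poweR ?poweR_ge0// invr_ge0 ltW//.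
  by rewrite -EFinM lee_fin ler_wpM2r// lamE lerDl mulr_ge0// ltW.
move=> c c0 lamS; apply/(stieltjes_ineqP p adm wv ww q0 c); split; first exact: ltW.
have A0 : (0 < c / (K + 1))%R by rewrite divr_gt0.
apply: (@stieltjes_op_bounded_by_le (K * (c / (K + 1)))%R).
- by rewrite mulr_ge0// ltW.
- by rewrite mulrCA ler_piMr ?(ltW c0)// ler_pdivrMr// mul1r lerDl.
apply: (int_stieltjes_op_bounded (mu := muD) (nu := nu) ma a0 vge0 p0 q0 C0 Pfin W1p W2p cgt0 cdec
  cinc cmeas chardy 0%R qp A0).
apply: (le_trans leS); rewrite -poweR_EFin -poweRM// -poweR_EFin.
apply: lee_poweR; [exact: ltW|by rewrite mule_ge0|].
rewrite EFinM lee_pdivlMr// (muleC _ (_ + _)%:E) muleA -EFinM (mulrC (K + 1)%R).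
apply: le_trans lamS; apply: lee_wpmul2r => //.
by rewrite lee_fin lamE lerDr.
Qed.

End criterion.

(** * Dual norms for p > 1 *)

Section truncation.
Context d (T : measurableType d) (R : realType).
Variable mu : {sigma_finite_measure set T -> \bar R}.

(** The functions min(f, n), cut to sets of finite measure, increase to [f]. Their finite mass
    allows near extremizers to be normalised even if [f] is infinite somewhere or not integrable. *)
Lemma integral_truncation (f : T -> \bar R) (lam : \bar R) :
  measurable_fun setT f -> (forall x, 0 <= f x) -> lam < \int[mu]_x f x ->
  exists g : T -> R, [/\ measurable_fun setT g, forall x, (0 <= g x)%R,
    forall x, (g x)%:E <= f x, lam < \int[mu]_x (g x)%:E &
    \int[mu]_x (g x)%:E < +oo].
Proof.
move=> mf f0 lamf.
have [F [TF Fi mF]] := (sigma_finiteP setT mu).1 (sigma_finiteT mu).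
pose g n t : \bar R := mine (f t) n%:R%:E * (\1_(F n) t)%:E.
have mg n : measurable_fun setT (g n).
  apply: emeasurable_funM; first by apply: measurable_mine.
  by apply/measurable_EFinP; exact: measurable_indic (mF n).1.
have min0 n t : 0 <= mine (f t) n%:R%:E by rewrite le_min f0 lee_fin ler0n.
have g0 n t : 0 <= g n t by rewrite mule_ge0// lee_fin.
have gn n t : g n t <= n%:R%:E * (\1_(F n) t)%:E.
  by apply: lee_wpmul2r; [rewrite lee_fin|rewrite ge_min lexx orbT].
have gf n t : g n t <= f t.
  rewrite /g indicE; case: (_ \in _); rewrite ?mule1 ?mule0//.
  by rewrite ge_min lexx.
have gE n t : g n t = (fine (g n t))%:E.
  rewrite fineK// ge0_fin_numE// (le_lt_trans (gn n t))//.
  by rewrite -EFinM ltry.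
have ndg t : {homo g^~ t : n m / (n <= m)%N >-> n <= m}.
  move=> n m nm; rewrite /g.
  apply: lee_pmul => //; rewrite ?lee_fin//.
    rewrite le_min ge_min lexx/= ge_min lee_fin ler_nat nm orbT//.
  rewrite !indicE ler_nat; case: (boolP (t \in F n)) => //; rewrite inE => tF.
  by rewrite mem_set//; apply: (subsetPset _ _ (Fi _ _ nm)).
have gt t (r : R) : r%:E <= f t -> r%:E <= limn (g^~ t).
  move=> rf; have -> : limn (g^~ t) = ereal_sup (range (g^~ t)).
    by apply/cvg_lim => //; apply: ereal_nondecreasing_cvgn => m n; exact: ndg.
  have [N _ tN] : (\bigcup_i F i) t by rewrite -TF.
  pose n := maxn N (Num.bound `|r|%R).
  apply: (@le_trans _ _ (g n t)); last by apply: ereal_sup_ubound; exists n.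
  rewrite /g indicE mem_set ?mule1; last first.
    by apply: (subsetPset _ _ (Fi N n _)) => //; exact: leq_maxl.
  rewrite le_min rf lee_fin (le_trans (ler_norm _))//.
  rewrite (le_trans (ltW (archi_boundP (normr_ge0 _))))// ler_nat; exact: leq_maxr.
have flim t : f t <= limn (g^~ t).
  move: (gt t); case: (f t) (f0 t) => [r _|_|]//; first exact.
  by move=> h; rewrite [leRHS]eq_infty// => r; rewrite h// leey.
have := cvg_monotone_convergence (mu := mu) measurableT mg (fun n x _ => g0 n x) (fun x _
  => ndg x).
move=> /cvg_lim cv.
have [n ln] : exists n, lam < \int[mu]_x g n x.
  apply: contrapT => /forallNP h; move: lamf; rewrite ltNge => /negP; apply.
  apply: (@le_trans _ _ (\int[mu]_x (limn (g^~ x)))).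
    apply: ge0_integralT_le => //.
    apply: (emeasurable_fun_cvg g) => // x _.
    by apply: ereal_nondecreasing_is_cvgn => m n; exact: ndg.
  rewrite -cv//; apply: lime_le.
    by apply: ereal_nondecreasing_is_cvgn => i j ij; apply: ge0_integralT_le => // x; exact: ndg.
  by apply: nearW => n; rewrite leNgt; apply/negP; exact: h.
exists (fun x => fine (g n x)); split.
- exact: measurableT_comp.
- by move=> x; exact: fine_ge0.
- by move=> x; rewrite -gE.
- by under eq_integral do rewrite -gE.
- under eq_integral do rewrite -gE.
  apply: (@le_lt_trans _ _ (\int[mu]_x (n%:R%:E * (\1_(F n) x)%:E))).
    apply: ge0_integralT_le => //.
    apply: emeasurable_funM => //.
    by apply/measurable_EFinP; exact: measurable_indic (mF n).1.
  rewrite ge0_integralZl_EFin//.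
    rewrite integral_indic ?setIT//; last exact: (mF n).1.
    apply: lte_mul_pinfty => //; exact: (mF n).2.
  by apply/measurable_EFinP; exact: measurable_indic (mF n).1.
Qed.

End truncation.

(** * The conjugate weight and the norm of the kernel for it *)

Section conjugate_weight.
Context d (T : measurableType d) (R : realType).
Variables (mu : {sigma_finite_measure set T -> \bar R}) (a v : T -> R) (p : R).
Hypotheses (ma : measurable_fun setT a) (a0 : forall x, (0 < a x)%R).
Hypotheses (mv : measurable_fun setT v) (v0 : forall x, (0 <= v x)%R).
Hypotheses (p1 : (1 < p)%R) (mu0 : 0 < mu setT).

Let p0 : (0 < p)%R. Proof. exact: lt_trans p1. Qed.
Let pB0 : (0 < p - 1)%R. Proof. by rewrite subr_gt0. Qed.

(* The weight v^(1-p'), infinite where v vanishes. *)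
Definition conj_weight (t : T) : \bar R :=
  if v t == 0%R then +oo else (v t `^ (- (p - 1)^-1))%:E.

Definition conj_integral (x : T) : \bar R :=
  \int[mu]_t (((a x + a t)^-1 `^ (p / (p - 1)))%:E * conj_weight t).

Definition conj_norm (x : T) : \bar R := conj_integral x `^ (p / (p - 1))^-1.

Let p' : R := (p / (p - 1))%R.
Let p'0 : (0 < p')%R. Proof. by rewrite divr_gt0. Qed.
Let p'M : (p' * (p - 1) = p)%R. Proof. by rewrite /p' divfK ?gt_eqF. Qed.

Lemma measurable_conj_weight : measurable_fun setT conj_weight.
Proof.
apply: measurable_fun_ifT => //; last exact: measurable_EFin_powR.
exact: measurable_fun_eqr.
Qed.

Lemma conj_weight_gt0 t : 0 < conj_weight t.
Proof.
rewrite /conj_weight; case: eqP => // /eqP vt; rewrite lte_fin powR_gt0//.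
by rewrite lt0r vt v0.
Qed.

Let k x t : R := (a x + a t)^-1.
Let k0 x t : (0 < k x t)%R. Proof. by rewrite invr_gt0 addr_gt0. Qed.

Let mk : measurable_fun setT (fun z : T * T => k z.1 z.2).
Proof.
apply: measurable_inv_fun => [|z]; last by rewrite addr_gt0.
by apply: measurable_funD; exact: (measurableT_comp ma).
Qed.

Let mk2 x : measurable_fun setT (k x).
Proof. by apply: measurable_inv_fun => [|z]; [exact: measurable_funD|rewrite addr_gt0]. Qed.

Let f x t : \bar R := (k x t `^ p')%:E * conj_weight t.

Let f0 x t : 0 < f x t.
Proof. by rewrite mule_gt0 ?conj_weight_gt0// lte_fin powR_gt0. Qed.

Let mf x : measurable_fun setT (f x).
Proof.
by apply: emeasurable_funM; [exact: measurable_EFin_powR|exact: measurable_conj_weight].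
Qed.

Lemma measurable_conj_integral : measurable_fun setT conj_integral.
Proof.
apply: (@measurable_fun_fubini_tonelli_F _ _ _ _ _ mu (fun z => f z.1 z.2)) => [|z];
  last exact: ltW.
apply: emeasurable_funM; first exact: measurable_EFin_powR.
by apply: (measurableT_comp measurable_conj_weight).
Qed.

Lemma conj_integral_gt0 x : 0 < conj_integral x.
Proof.
rewrite lt0e integral_ge0 ?andbT => [|t _]; last exact/ltW/f0.
apply/eqP => V0; have := ge0_integral_eq0_ae (mf x) (fun t => ltW (f0 x t)) V0.
move=> [N [mN N0 sN]]; move: mu0; rewrite -(_ : N = setT) ?N0 ?ltxx//.
by apply/seteqP; split => // t _; apply: sN => /= ft; have := f0 x t; rewrite ft ltxx.
Qed.

Lemma conj_norm_gt0 x : 0 < conj_norm x.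
Proof. by rewrite poweR_gt0// conj_integral_gt0. Qed.

Lemma conj_norm_dec x y : (a x <= a y)%R -> conj_norm y <= conj_norm x.
Proof.
move=> xy; apply: lee_poweR; first by rewrite invr_ge0 ltW.
  exact/ltW/conj_integral_gt0.
apply: ge0_integralT_le; [exact: mf|exact: mf|by move=> t; exact/ltW/f0|].
move=> t; apply: lee_wpmul2r; first exact/ltW/conj_weight_gt0.
rewrite lee_fin ge0_ler_powR ?nnegrE ?(ltW (k0 _ _))// ?(ltW p'0)//.
by rewrite lef_pV2 ?posrE ?addr_gt0// lerD2r.
Qed.

(** Absorbing [a x] turns the kernel into a x / (a x + a t), which increases with a x. *)
Lemma conj_normE x : (a x)%:E * conj_norm x =
  (\int[mu]_t (((a x * k x t) `^ p')%:E * conj_weight t)) `^ p'^-1.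
Proof.
have -> : \int[mu]_t (((a x * k x t) `^ p')%:E * conj_weight t) = (a x `^ p')%:E *
  conj_integral x.
  rewrite -ge0_integralZl_EFin ?powR_ge0//; [|by move=> t _; exact/ltW/f0|exact: mf].
  apply: eq_integral => t _; rewrite muleA -EFinM.
  by rewrite (powRM (x := a x))// ltW.
rewrite poweRM ?lee_fin ?powR_ge0// ?(ltW (conj_integral_gt0 x))//.
by rewrite poweR_EFin -powRrM divff ?gt_eqF// powRr1// ltW.
Qed.

Lemma conj_norm_inc x y : (a x <= a y)%R -> (a x)%:E * conj_norm x <= (a y)%:E * conj_norm y.
Proof.
move=> xy; rewrite !conj_normE; apply: lee_poweR; first by rewrite invr_ge0 ltW.
  by apply: integral_ge0 => t _; rewrite mule_ge0 ?lee_fin ?powR_ge0// ltW// conj_weight_gt0.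
have m1 z : measurable_fun setT (fun t => ((a z * k z t) `^ p')%:E * conj_weight t).
  apply: emeasurable_funM; last exact: measurable_conj_weight.
  by apply: measurable_EFin_powR; exact: measurable_funM.
apply: ge0_integralT_le => // t.
  by rewrite mule_ge0 ?lee_fin ?powR_ge0// ltW// conj_weight_gt0.
apply: lee_wpmul2r; first exact/ltW/conj_weight_gt0.
have ax z : (0 <= a z * k z t)%R by rewrite mulr_ge0 ?(ltW (a0 z))// ltW.
rewrite lee_fin ge0_ler_powR ?nnegrE// ?(ltW p'0)//.
rewrite ler_pdivrMr ?addr_gt0// mulrAC ler_pdivlMr ?addr_gt0//.
by rewrite !mulrDr mulrC lerD2l ler_wpM2r// ltW.
Qed.

Lemma conj_norm_measurable (mr : T -> R) : (forall x, conj_norm x = (mr x)%:E) ->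
  measurable_fun setT mr.
Proof.
move=> h; apply/measurable_EFinP; rewrite -(_ : conj_norm = EFin \o mr); last exact/funext.
by apply: measurable_funP_poweR; exact: measurable_conj_integral.
Qed.

(** The extremizer in Hoelder's inequality is f / k with f = k ^ p' * v ^ (1 - p'). Here [f] is
    replaced by a truncation [g] of mass G, and h = G ^ (- 1 / p) * g / k. Where v > 0, g <= f gives
    g ^ (p - 1) <= k ^ p / v, hence the norm bound; k x t / k y t >= a y / (a x + a y) gives the
    lower bound. *)
Lemma conj_norm_test : stieltjes_test_family mu a v p conj_norm.
Proof.
move=> y lam lam0 lamy.
have lamV : (lam `^ p')%:E < conj_integral y.
  move: lamy; rewrite !ltNge; apply: contra => Vl.
  have := lee_poweR (r := p'^-1) _ (ltW (conj_integral_gt0 y)) Vl.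
  rewrite invr_ge0 (ltW p'0) => /(_ isT); rewrite poweR_EFin -powRrM divff ?gt_eqF//.
  by rewrite powRr1// ltW.
have [g [mg g0 gf lg gfin]] := integral_truncation (mf y) (fun t => ltW (f0 y t)) lamV.
pose G := fine (\int[mu]_t (g t)%:E).
have GE : \int[mu]_t (g t)%:E = G%:E.
  by rewrite fineK// ge0_fin_numE// integral_ge0// => t _; rewrite lee_fin.
have lG : (lam `^ p' < G)%R by rewrite -lte_fin -GE.
have G0 : (0 < G)%R by rewrite (le_lt_trans _ lG)// powR_ge0.
have kp t r : (0 < k y t `^ r)%R by rewrite powR_gt0.
pose h t : R := (G `^ (- p^-1) * (g t * (k y t)^-1))%R.
have h0 t : (0 <= h t)%R.
  by rewrite /h mulr_ge0 ?powR_ge0// mulr_ge0// invr_ge0 ltW.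
have mh : measurable_fun setT h.
  apply: measurable_funM => //; apply: measurable_funM => //.
  exact: measurable_inv_fun.
exists (EFin \o h); split.
- exact/measurable_EFinP.
- by move=> t; rewrite lee_fin.
- have -> : 1 = \int[mu]_t ((G^-1)%:E * (g t)%:E).
    rewrite ge0_integralZl_EFin ?invr_ge0 ?(ltW G0)//; last 2 first.
    - by move=> t _; rewrite lee_fin.
    - exact/measurable_EFinP.
    by rewrite GE -EFinM mulVf// gt_eqF.
  apply: ge0_integralT_le.
  - apply: emeasurable_funM; last exact/measurable_EFinP.
    by apply: measurable_funP_poweR; exact/measurable_EFinP.
  - by apply: emeasurable_funM => //; exact/measurable_EFinP.
  - by move=> t; rewrite mule_ge0 ?poweR_ge0// lee_fin.
  move=> t; rewrite /= -!EFinM lee_fin /h.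
  rewrite (powRM (x := G `^ (- p^-1))) ?powR_ge0//; last first.
    by rewrite mulr_ge0// invr_ge0 ltW.
  rewrite -powRrM mulNr mulVf ?(gt_eqF p0)// powR_inv1 ?(ltW G0)//.
  rewrite -mulrA; apply: ler_wpM2l; first by rewrite invr_ge0 ltW.
  rewrite (powRM (x := g t))// ?invr_ge0 ?(ltW (k0 y t))//.
  rewrite powRV ?(ltW (k0 y t))//.
  have [vt|vt] := eqVneq (v t) 0%R; first by rewrite vt mulr0.
  have vt0 : (0 < v t)%R by rewrite lt0r vt v0.
  have gp : (g t `^ (p - 1) <= k y t `^ p / v t)%R.
    have := gf t; rewrite /f /conj_weight (negbTE vt) -EFinM lee_fin => gt.
    have := ge0_ler_powR (ltW pB0) (g0 t) _ gt.
    rewrite nnegrE mulr_ge0 ?powR_ge0// => /(_ isT)/le_trans; apply.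
    rewrite (powRM (x := k y t `^ p')) ?powR_ge0// -!powRrM p'M mulNr mulVf ?gt_eqF//.
    by rewrite powR_inv1.
  have -> : (g t `^ p = g t * g t `^ (p - 1))%R.
    have [->|gt0] := eqVneq (g t) 0%R; first by rewrite powR0 ?gt_eqF// mul0r.
    have g00 : (0 < g t)%R by rewrite lt0r gt0 g0.
    by rewrite -{2}[g t]powRr1// -powRD_gt0// addrC subrK.
  rewrite -!mulrA; apply: ler_piMr => //.
  by rewrite mulrCA mulrC ler_pdivrMr// mul1r -ler_pdivlMr.
  by rewrite addr_ge0// ltW.
- move=> x.
  have -> : (lam * (a y / (a x + a y)))%:E =
      (lam * G^-1 * (a y / (a x + a y)))%:E * \int[mu]_t (g t)%:E.
    by rewrite GE -EFinM; congr EFin; rewrite mulrAC -!mulrA (mulrA G^-1)%R mulVf ?mul1r ?gt_eqF.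
  have c0 : (0 <= lam * G^-1 * (a y / (a x + a y)))%R.
    by rewrite !mulr_ge0 ?invr_ge0 ?addr_ge0// ltW.
  rewrite -ge0_integralZl_EFin//; last 2 first.
  - by move=> t _; rewrite lee_fin.
  - exact/measurable_EFinP.
  apply: ge0_integralT_le.
  - by apply: emeasurable_funM => //; exact/measurable_EFinP.
  - by apply: measurable_stieltjes_op_integrand => //; exact/measurable_EFinP.
  - by move=> t; rewrite mule_ge0// lee_fin.
  move=> t; rewrite -!EFinM lee_fin /h.
  have lG' : (lam * G^-1 <= G `^ (- p^-1))%R.
    rewrite ler_pdivrMr// -{2}[G]powRr1 ?(ltW G0)// -powRD_gt0//.
    have -> : (- p^-1 + 1 = p'^-1)%R by rewrite /p' invf_div; field; rewrite gt_eqF.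
    have := ge0_ler_powR (r := p'^-1) _ (powR_ge0 _ _) _ (ltW lG).
    rewrite invr_ge0 (ltW p'0) nnegrE (ltW G0) => /(_ isT isT).
    by rewrite -powRrM divff ?gt_eqF// powRr1// ltW.
  have kk : (a y / (a x + a y) <= (k y t)^-1 * k x t)%R.
    rewrite /k invrK ler_pdivrMr ?addr_gt0// mulrAC ler_pdivlMr ?addr_gt0//.
    have : (0 <= a t * a x + a y * a y)%R by rewrite addr_ge0 ?mulr_ge0 ?(ltW (a0 _)).
    lra.
  rewrite [leRHS](_ : _ = (G `^ (- p^-1)) * ((k y t)^-1 * k x t) * g t)%R;
    last by rewrite /k; ring.
  apply: ler_wpM2r => //; apply: ler_pM => //.
    by rewrite mulr_ge0 ?invr_ge0// ltW.
  by rewrite divr_ge0 ?addr_ge0// ltW.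
Qed.

(** Both halves are instances of [hardy_bound_gt1], with K equal to (2 m) ^ p' and (2 a m) ^ p'; as
    p' * (p - 1) = p, their powers p - 1 are the functions in the statement. *)
Lemma conj_norm_hardy (mr : T -> R) : (forall x, conj_norm x = (mr x)%:E) -> forall x0 : T,
  hardy_bound mu a (fun x => v x * a x `^ p)%R (fun x => 2 `^ p * mr x `^ p)%R p
    (hardy_pp_const p) /\
  hardy_bound mu (\- a)%R v (fun x => 2 `^ p * (a x * mr x) `^ p)%R p (hardy_pp_const p).
Proof.
move=> mE x0.
have mr0 x : (0 < mr x)%R by rewrite -lte_fin -mE conj_norm_gt0.
have VE x : conj_integral x = (mr x `^ p')%:E.
  by rewrite -poweR_EFin -mE /conj_norm poweRVK// ?gt_eqF// ltW// conj_integral_gt0.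
have mmr := conj_norm_measurable mE.
(* A finite norm forces v > 0 almost everywhere, as [conj_weight] is +oo where [v] vanishes. *)
have vpos : {ae mu, forall t, (0 < v t)%R}.
  have : mu.-integrable setT (f x0).
    apply/integrableP; split => //.
    under eq_integral do rewrite gee0_abs ?(ltW (f0 _ _))//.
    by rewrite -/(conj_integral x0) VE ltry.
  move=> /(integrable_ae measurableT); apply: filterS => t /(_ Logic.I).
  rewrite lt0r v0 andbT; apply: contraTneq => vt.
  by rewrite /f /conj_weight vt eqxx gt0_muley// lte_fin powR_gt0.
have vc t : (0 <= v t `^ (- (p - 1)^-1))%R by exact: powR_ge0.
have vle t : (v t `^ (- (p - 1)^-1))%:E <= conj_weight t.
  by rewrite /conj_weight; case: eqP => // _; exact: leey.
have two0 : (0 < 2 :> R)%R by [].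
have ap x r : (0 < a x `^ r)%R by rewrite powR_gt0.
split.
- have -> : (fun x => 2 `^ p * mr x `^ p)%R = (fun x => (2 `^ p' * mr x `^ p') `^ (p - 1))%R.
    apply/funext => x; rewrite (powRM (x := 2 `^ p')) ?powR_ge0// -!powRrM p'M//.
  apply: hardy_bound_gt1 => //.
  + apply: measurable_funM => //.
    by apply: (measurableT_comp (measurable_powR _)).
  + apply: measurable_funM => //.
    by apply: (measurableT_comp (measurable_powR _)).
  + by move=> x; rewrite mulr_ge0// ltW.
  + by apply: filterS vpos => t vt; rewrite mulr_gt0.
  + by move=> x; rewrite mulr_gt0// powR_gt0.
  + move=> x y xy; apply: ler_wpM2l; first exact: powR_ge0.
    rewrite ge0_ler_powR ?nnegrE ?(ltW p'0) ?(ltW (mr0 _))//.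
    by rewrite -lee_fin -!mE conj_norm_dec.
  move=> x; rewrite EFinM -VE -ge0_integralZl_EFin ?powR_ge0//; [|by move=> t _;
    exact/ltW/f0|exact: mf].
  have mL : measurable_fun setT (fun t => ((v t * a t `^ p) `^ (- (p - 1)^-1))%:E : \bar R).
    apply: measurable_EFin_powR; apply: measurable_funM => //.
    by apply: (measurableT_comp (measurable_powR _)).
  have mR : measurable_fun setT (fun t => (2 `^ p')%:E * f x t).
    by apply: emeasurable_funM.
  apply: (@le_trans _ _ (\int[mu]_(t in [set t | (a x <= a t)%R]) ((2 `^ p')%:E * f x t))).
    apply: ge0_integral_in_le => //; first exact: measurable_geset.
      by move=> t; rewrite lee_fin powR_ge0.
    move=> t /= xt; rewrite /f muleA -EFinM.
    rewrite (powRM (x := v t)) ?v0 ?(ltW (ap _ _))// -powRrM.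
    rewrite [X in X%:E <= _]mulrC [leLHS]EFinM.
    apply: lee_pmul; rewrite ?lee_fin ?powR_ge0//.
    have -> : (p * - (p - 1)^-1 = - p')%R by rewrite mulrN.
    rewrite -(powRM (x := 2%:R)) ?(ltW (k0 _ _))//.
    rewrite powRN -powRV ?(ltW (a0 t))//.
    rewrite ge0_ler_powR ?nnegrE ?(ltW p'0)//.
    + by rewrite invr_ge0 ltW.
    + by rewrite mulr_ge0// ltW.
    by rewrite /k ler_pdivlMr ?addr_gt0// mulrC ler_pdivrMr// mulr_natl mulr2n lerD2r.
  by apply: ge0_subset_integralT => //; [exact: measurable_geset|move=> t;
    rewrite mule_ge0 ?(ltW (f0 _ _))// lee_fin powR_ge0].
- have amr x : (0 < a x * mr x)%R by rewrite mulr_gt0.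
  have -> : (fun x => 2 `^ p * (a x * mr x) `^ p)%R = (fun x => (2 `^ p' * (a x * mr x) `^
    p') `^ (p - 1))%R.
    apply/funext => x; rewrite (powRM (x := 2 `^ p')) ?powR_ge0// -!powRrM p'M//.
  apply: hardy_bound_gt1 => //.
  + exact: measurableT_comp.
  + apply: measurable_funM => //.
    by apply: (measurableT_comp (measurable_powR _)); exact: measurable_funM.
  + by move=> x; rewrite mulr_gt0// powR_gt0.
  + move=> x y; rewrite lerN2 => xy; apply: ler_wpM2l; first exact: powR_ge0.
    rewrite ge0_ler_powR ?nnegrE ?(ltW p'0) ?(ltW (amr _))//.
    by rewrite -lee_fin !EFinM -!mE conj_norm_inc.
  move=> x; rewrite (powRM (x := a x)) ?(ltW (a0 x)) ?(ltW (mr0 x))// mulrA EFinM -VE.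
  have c0 : (0 <= 2 `^ p' * a x `^ p')%R by rewrite mulr_ge0 ?powR_ge0.
  rewrite -ge0_integralZl_EFin//; [|by move=> t _; exact/ltW/f0|exact: mf].
  have mL : measurable_fun setT (fun t => (v t `^ (- (p - 1)^-1))%:E : \bar R).
    exact: measurable_EFin_powR.
  have mR : measurable_fun setT (fun t => (2 `^ p' * a x `^ p')%:E * f x t).
    by apply: emeasurable_funM.
  have mset : measurable [set t | ((\- a) x <= (\- a) t)%R].
    by apply: measurable_geset; exact: measurableT_comp.
  apply: (@le_trans _ _ (\int[mu]_(t in [set t | ((\- a) x <= (\- a) t)%R]) ((2 `^ p' * a x
    `^ p')%:E * f x t))).
    apply: ge0_integral_in_le => //.
    move=> t /=; rewrite lerN2 => xt; rewrite /f muleA -EFinM.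
    apply: (le_trans (vle t)); rewrite -[leLHS]mul1e.
    apply: lee_wpmul2r; first exact/ltW/conj_weight_gt0.
    rewrite lee_fin -(powRM (x := 2%:R)) ?(ltW (a0 _))//.
    rewrite -(powRM (x := (2 * a x)%R)) ?(ltW (k0 _ _)) ?mulr_ge0 ?(ltW (a0 _))//.
    rewrite [leLHS](_ : _ = (1 `^ p')%R); last by rewrite powR1.
    rewrite ge0_ler_powR ?nnegrE ?(ltW p'0)//.
      by rewrite !mulr_ge0// ltW.
    by rewrite ler_pdivlMr ?addr_gt0// mul1r mulr_natl mulr2n lerD2l.
  by apply: ge0_subset_integralT => //; move=> t; rewrite mule_ge0 ?(ltW (f0 _ _))// lee_fin.
Qed.

End conjugate_weight.

Lemma npowE (R : realType) (x s : R) : (0 <= x)%R -> (0 < s)%R ->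
  npow x s = if x == 0%R then +oo else (x `^ (- s))%:E.
Proof.
move=> x0 s0; rewrite /npow inver; case: eqP => [_|_]; first by rewrite poweRyr ?gt_eqF.
by rewrite poweR_EFin powRV// powRN.
Qed.

Lemma conj_expE (R : realType) (p : R) : (1 < p)%R -> conj_exp p = (p / (p - 1))%R.
Proof.
move=> p1; have p0 : (0 < p)%R by exact: lt_trans p1.
rewrite /conj_exp /hoelder_conjugate /= eqe gt_eqF//= -EFinB inver.
by rewrite gt_eqF ?subr_gt0.
Qed.

Lemma measurable_Phi d (T : measurableType d) (R : realType)
    (nu : {sigma_finite_measure set T -> \bar R}) (a : T -> R) (q : R) :
  measurable_fun setT a -> (forall x, (0 < a x)%R) ->
  measurable_fun setT (Phi nu a q).
Proof.
move=> ma a0.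
apply: (@measurable_fun_fubini_tonelli_F _ _ _ _ _ nu
    (fun z => ((a z.1 / (a z.2 + a z.1)) `^ q)%:E)) => [|z]; last first.
  by rewrite lee_fin powR_ge0.
apply: measurable_EFin_powR; apply: measurable_funM; first exact: (measurableT_comp ma).
apply: measurable_inv_fun => [|z]; last by rewrite addr_gt0.
by apply: measurable_funD; exact: (measurableT_comp ma).
Qed.

Lemma hardy_pp_const_gt0 (R : realType) (p : R) : (1 < p)%R -> (0 < hardy_pp_const p)%R.
Proof.
move=> p1; have p0 : (0 < p)%R by exact: lt_trans p1.
rewrite mulr_gt0 ?powR_gt0 ?power_const_gt0 ?invr_gt0//.
by rewrite subr_gt0 invf_lt1.
Qed.

(** * The quantities S3 and S4 *)

Section power_case.
Context {R : realType}.
Local Notation leb := (@lebesgue_measure R).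
Local Notation D := (`]0%R, +oo[%classic : set R).
Variables (U v w : R -> R) (p q : R).
Hypotheses (adm : admissible U) (wv : weight v) (ww : weight w).
Hypotheses (p1 : (1 < p)%R) (q0 : (0 < q)%R).

Let p0 : (0 < p)%R. Proof. exact: lt_trans p1. Qed.
Let pB0 : (0 < p - 1)%R. Proof. by rewrite subr_gt0. Qed.
Let a := unit_ext U.
Let ma := measurable_unit_ext adm.
Let a0 := unit_ext_gt0 adm.
Let mv := measurable_zero_ext wv.
Let vge0 := zero_ext_ge0 wv.
Let V := conj_integral (T := measurableTypeR R) muD a (zero_ext v) p.
Let m := conj_norm (T := measurableTypeR R) muD a (zero_ext v) p.

Lemma muD_gt0 : 0 < (muD : set (measurableTypeR R) -> \bar R) setT.
Proof.
rewrite lt0e measure_ge0 andbT; apply/eqP => mu0.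
have : \int[leb]_(x in D) (cst 1 x) = 0.
  rewrite -integral_muD// integral_cst//.
  by rewrite mul1e; exact: mu0.
rewrite integral_cst//.
by rewrite mul1e [X in X = _](_ : _ = +oo)//;
  have := lebesgue_measure_itv `]0%R, +oo[ => /= ->; rewrite ltry.
Qed.

Lemma criterion_conj_norm : criterion U v p (hardy_pp_const p) m.
Proof.
split.
- exact: (conj_norm_gt0 (T := measurableTypeR R) p ma a0 mv vge0 muD_gt0).
- exact: (conj_norm_dec (T := measurableTypeR R) ma a0 mv vge0 p1 muD_gt0).
- exact: (conj_norm_inc (T := measurableTypeR R) ma a0 mv vge0 p1 muD_gt0).
- exact: (conj_norm_measurable (T := measurableTypeR R) ma a0 mv vge0).
- exact: (conj_norm_test (T := measurableTypeR R) ma a0 mv vge0 p1 muD_gt0).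
- by move=> mr mE; exact: (conj_norm_hardy (T := measurableTypeR R) ma a0 mv vge0 p1
  muD_gt0 mE 0%R).
Qed.

(** [kernelU U t x] divided by U t is the Stieltjes kernel 1 / (U t + U x). *)
Lemma VintE x : (0 < x)%R -> Vint U v p x = V x.
Proof.
move=> x0; rewrite /V /conj_integral integral_muD; first last.
- by move=> t; rewrite mule_ge0 ?lee_fin ?powR_ge0// ltW// conj_weight_gt0.
- apply: emeasurable_funM; last exact: measurable_conj_weight.
  apply: measurable_EFin_powR; apply: measurable_inv_fun => [|z]; last by rewrite addr_gt0.
  exact: measurable_funD.
rewrite /Vint conj_expE//; apply: eq_integral => t; rewrite half_lineE => t0.
have Ut0 := admissible_gt0 adm t0; have Ux0 := admissible_gt0 adm x0.
rewrite /a !unit_extE// npowE ?(ltW Ut0) ?divr_gt0// gt_eqF//.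
have -> : (p / (p - 1) - 1 = (p - 1)^-1)%R by field; rewrite gt_eqF.
rewrite npowE ?invr_gt0//; last exact: weight_ge0 wv t0.
rewrite /conj_weight /zero_ext /on_pos t0; congr (_ * _).
rewrite -EFinM /kernelU (powRM (x := U t)) ?(ltW Ut0) ?invr_ge0 ?addr_ge0 ?ltW//.
by rewrite mulrAC powRN divff ?mul1r// gt_eqF// powR_gt0.
Qed.

Lemma S3_characterized : nondegenerate_wrt U w q -> (p <= q)%R ->
  characterized_by (equiv_const_pq p q (hardy_pp_const p)) p%:E q%:E U v w (S3 U v w p q).
Proof.
move=> nd pq.
have termE x : (0 < x)%R -> Wint U w q x `^ q^-1 * Vint U v p x `^ (conj_exp p)^-1 =
    Phi (nuD ww) a q x `^ q^-1 * m x.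
  by move=> x0; rewrite (WintE q adm ww x0) VintE// conj_expE.
have S0 : 0 <= S3 U v w p q.
  apply: (@le_trans _ _ (Wint U w q 1 `^ q^-1 * Vint U v p 1 `^ (conj_exp p)^-1)).
    by rewrite mule_ge0 ?poweR_ge0.
  by apply: ereal_sup_ubound; exists 1%R => //=; rewrite in_itv/= ltr01.
apply: (characterized_pq (ww := ww) adm wv p0 q0 _ nd criterion_conj_norm pq S0).
- exact: hardy_pp_const_gt0.
- move=> B hB; apply: ge_ereal_sup => _ [x /= + <-]; rewrite in_itv/= andbT => x0.
  by rewrite termE// hB.
move=> x x0; apply: (@le_trans _ _ (S3 U v w p q)).
  by rewrite -termE//; apply: ereal_sup_ubound; exists x => //=; rewrite in_itv/= x0.
by rewrite -[leLHS]mul1e; apply: lee_wpmul2r => //; rewrite lee_fin ler1n.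
Qed.

Lemma S4_characterized : nondegenerate_wrt U w q -> (q < p)%R ->
  characterized_by (equiv_const_qp p q (hardy_pp_const p)) p%:E q%:E U v w (S4 U v w p q).
Proof.
move=> nd qp; have pq0 : (0 < p - q)%R by rewrite subr_gt0.
set r := (p * q / (p - q))%R.
have r0 : (0 < r)%R by rewrite divr_gt0// mulr_gt0.
have mm : measurable_fun setT m.
  by apply: measurable_funP_poweR; exact: measurable_conj_integral.
have SE : S4 U v w p q `^ r =
    \int[nuD ww]_x (Phi (nuD ww) a q x `^ (q / (p - q)) * m x `^ r).
  rewrite integral_nuD; first last.
  - by move=> x; rewrite mule_ge0 ?poweR_ge0.
  - apply: emeasurable_funM; apply: measurable_funP_poweR; last exact: mm.
    exact: (measurable_Phi (nuD ww) q ma a0).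
  rewrite /S4 /rexp -/r poweRVK ?gt_eqF//; last first.
    apply: integral_ge0 => x; rewrite /= in_itv/= andbT => x0.
    by rewrite !mule_ge0 ?poweR_ge0// lee_fin (weight_ge0 ww).
  apply: eq_integral => x; rewrite half_lineE => x0.
  rewrite (WintE q adm ww x0) VintE// conj_expE// /m /conj_norm -poweRrM.
  have -> : (r / p = q / (p - q))%R by rewrite /r; field; rewrite !gt_eqF.
  by rewrite (mulrC (p / (p - 1))^-1%R).
have S0 : 0 <= S4 U v w p q by exact: poweR_ge0.
apply: (characterized_qp (ww := ww) adm wv p0 q0 _ nd criterion_conj_norm qp S0).
- exact: hardy_pp_const_gt0.
- by rewrite -/r SE.
- rewrite -/r -SE -[leLHS]mul1e; apply: lee_wpmul2r; first exact: poweR_ge0.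
  rewrite lee_fin [leLHS](_ : _ = (1 `^ r)%R); last by rewrite powR1.
  by rewrite ge0_ler_powR ?nnegrE// ?(ltW r0)// ler1n.
Qed.

End power_case.

(** * Dual norms for p = 1 *)

Lemma ae_imply d (T : semiRingOfSetsType d) (R : realFieldType) (mu : set T -> \bar R)
    (P Q : T -> Prop) :
  (forall x, P x -> Q x) -> {ae mu, forall x, P x} -> {ae mu, forall x, Q x}.
Proof.
by move=> PQ [N [mN N0 sN]]; exists N; split => // x /= nQ; apply: sN => /= /PQ.
Qed.

(** * Essential suprema and null sets on the half-line *)

Section half_line_measure.
Context {R : realType}.
Local Notation leb := (@lebesgue_measure R).
Local Notation D := (`]0%R, +oo[%classic : set R).

Lemma ess_sup_onP (I : interval R) (f : R -> \bar R) (y : \bar R) :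
  ess_sup_on I f <= y <-> {ae leb, forall x, x \in I -> f x <= y}.
Proof.
split.
- move=> /ess_supP[N [mN N0 sN]]; exists (N `&` [set` I]); split => //.
    by apply: measurableI => //; exact: measurable_itv.
  move=> x /= /not_implyP[xI fy]; split => //; exact: sN.
- move=> [N [mN N0 sN]]; apply/ess_supP; exists (N `|` ~` [set` I]).
  have mI : measurable [set` I] by exact: measurable_itv.
  split; first by apply: measurableU => //; exact: measurableC.
    change (leb ((N `|` ~` [set` I]) `&` [set` I]) = 0).
    rewrite setIUl setICl setU0; apply/eqP; rewrite eq_le measure_ge0 andbT.
    by rewrite -[X in _ <= X]N0 le_measure ?inE//; exact: measurableI.
  move=> x /= fy; have [xI|xI] := boolP (x \in I); last by right; exact/negP.
  by left; apply: sN => /=; apply/not_implyP.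
Qed.

(** A null set cannot contain a half-line, so strictness survives. *)
Lemma ess_sup_tail_gt (t : R) (f : R -> \bar R) (y : \bar R) :
  (forall s, (t < s)%R -> y < f s) -> y < ess_sup_on `]t, +oo[ f.
Proof.
move=> fy; rewrite ltNge; apply/negP => /ess_sup_onP[N [mN N0 sN]].
have : leb `]t, +oo[%classic <= leb N.
  apply: le_measure; rewrite ?inE//=.
  move=> s /=; rewrite in_itv/= andbT => ts; apply: sN => /=; apply/not_implyP.
  by rewrite in_itv/= ts; split => //; apply/negP; rewrite -ltNge fy.
by rewrite N0 lebesgue_measure_itv/= ltry.
Qed.

Lemma muDE (A : set R) : measurable A -> muD A = leb (D `&` A).
Proof.
move=> mA; have := integral_muD_in (f := cst 1) mA _ (fun=> lee01).
move=> /(_ (measurable_cst _)); rewrite !integral_cst ?mul1e//.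
by apply: measurableI.
Qed.

Lemma ae_muD (P : R -> Prop) : {ae leb, forall x, (0 < x)%R -> P x} -> {ae muD, forall x, P x}.
Proof.
move=> [N [mN N0 sN]]; exists (N `|` ~` D); have mD := @measurable_half_line R.
split; first by apply: measurableU => //; exact: measurableC.
  rewrite muDE; last by apply: measurableU => //; exact: measurableC.
  rewrite setIUr setICr setU0; apply/eqP; rewrite eq_le measure_ge0 andbT.
  by rewrite -[X in _ <= X]N0 le_measure ?inE//; exact: measurableI.
move=> x /= nP; have [x0|x0] := boolP (0 < x)%R; last first.
  by right; rewrite /= in_itv/= andbT; exact/negP.
by left; apply: sN => /=; apply/not_implyP.
Qed.

End half_line_measure.

(** * The weighted supremum that plays the part of the dual norm *)

Section endpoint_weight.
Context {R : realType}.
Local Notation leb := (@lebesgue_measure R).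
Local Notation D := (`]0%R, +oo[%classic : set R).
Variables (U v : R -> R).
Hypotheses (adm : admissible U) (wv : weight v).

Let a := unit_ext U.
Let ma := measurable_unit_ext adm.
Let a0 := unit_ext_gt0 adm.
Let mv := measurable_zero_ext wv.
Let vge0 := zero_ext_ge0 wv.
Let phi (s : R) : \bar R := npow (U s * v s) 1.
Let E (t : R) : \bar R := ess_sup_on `]t, +oo[ phi.

(** Comparable to the essential supremum of 1 / ((U x + U s) v s), because U s / (U x + U s) is
    comparable to min(1, U s / U x). With [t] running over the whole half-line and the factor cut at
    1, the decrease of this function and the increase of its product with U x are visible term by
    term; [tail_sup_powE] recovers the expressions in S1 and S2. *)
Definition tail_sup (x : R) : \bar R :=
  ereal_sup [set (Num.min 1 (U t / unit_ext U x))%:E *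
                 ess_sup_on `]t, +oo[ (fun s => npow (U s * v s) 1) | t in `]0%R, +oo[ ].

Let Uv0 s : (0 < s)%R -> (0 <= U s * v s)%R.
Proof.
by move=> s0; rewrite mulr_ge0 ?(weight_ge0 wv)// ltW// (admissible_gt0 adm).
Qed.

Let npow_gt0 s r : (0 < s)%R -> (0 < r)%R -> 0 < npow (U s * v s) r.
Proof.
move=> s0 r0; rewrite npowE ?Uv0//; case: eqP => // /eqP n0.
by rewrite lte_fin powR_gt0// lt0r n0 Uv0.
Qed.

Let E_gt0 t : (0 < t)%R -> 0 < E t.
Proof. by move=> t0; apply: ess_sup_tail_gt => s ts; rewrite npow_gt0// (lt_trans t0). Qed.

Let E_dec t s : (s <= t)%R -> E t <= E s.
Proof.
move=> st; apply/ess_sup_onP; have /ess_sup_onP := lexx (E s).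
apply: ae_imply => y h; rewrite in_itv/= andbT => ty; apply: h.
by rewrite in_itv/= andbT (le_lt_trans st).
Qed.

Lemma ess_sup_npow (t r : R) : (0 < t)%R -> (0 < r)%R ->
  ess_sup_on `]t, +oo[ (fun s => npow (U s * v s) r) = E t `^ r.
Proof.
move=> t0 r0; have pr s : (0 < s)%R -> npow (U s * v s) r = phi s `^ r.
  by move=> s0; rewrite /phi /npow -poweRrM mul1r.
apply/eqP; rewrite eq_le; apply/andP; split.
- apply/ess_sup_onP; have /ess_sup_onP := lexx (E t).
  apply: ae_imply => s h ts; have := h ts; move: ts; rewrite in_itv/= andbT => ts hE.
  have s0 := lt_trans t0 ts.
  by rewrite pr//; apply: lee_poweR => //; [exact: ltW|exact/ltW/npow_gt0].
- set Er := leRHS; have Er0 : 0 <= Er.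
    by apply/ltW/ess_sup_tail_gt => s ts; rewrite npow_gt0// (lt_trans t0).
  rewrite -[leRHS](@poweRVK _ _ r) ?gt_eqF//.
  apply: lee_poweR; [exact: ltW|exact/ltW/E_gt0|].
  apply/ess_sup_onP; have /ess_sup_onP := lexx Er.
  apply: ae_imply => s h ts; have := h ts; move: ts; rewrite in_itv/= andbT => ts hE.
  have s0 := lt_trans t0 ts.
  rewrite -[leLHS](@poweRK _ _ r) ?gt_eqF//; last exact/ltW/npow_gt0.
  rewrite -pr//; apply: lee_poweR => //; first by rewrite invr_ge0 ltW.
  exact/ltW/npow_gt0.
Qed.

Let c (t x : R) : R := Num.min 1%R (U t / a x)%R.

Let c_gt0 t x : (0 < t)%R -> (0 < c t x)%R.
Proof. by move=> t0; rewrite lt_min ltr01 divr_gt0// (admissible_gt0 adm). Qed.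

Let endm_ub t x : (0 < t)%R -> (c t x)%:E * E t <= tail_sup x.
Proof.
by move=> t0; apply: ereal_sup_ubound; exists t => //; rewrite /= in_itv/= t0.
Qed.

Let endm_le x B : (forall t, (0 < t)%R -> (c t x)%:E * E t <= B) -> tail_sup x <= B.
Proof.
by move=> h; apply: ge_ereal_sup => _ [t /= + <-]; rewrite in_itv/= andbT; exact: h.
Qed.

Lemma tail_sup_gt0 x : 0 < tail_sup x.
Proof.
by apply: lt_le_trans (endm_ub x ltr01); rewrite mule_gt0 ?lte_fin ?c_gt0// E_gt0.
Qed.

Lemma tail_sup_dec x y : (unit_ext U x <= unit_ext U y)%R -> tail_sup y <= tail_sup x.
Proof.
move=> xy; apply: endm_le => t t0; apply: le_trans (endm_ub x t0).
apply: lee_wpmul2r; first exact/ltW/E_gt0.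
rewrite lee_fin le_min ge_min lexx/= ge_min; apply/orP; right.
rewrite ler_wpM2l ?(ltW (admissible_gt0 adm t0))//.
by rewrite lef_pV2 ?posrE.
Qed.

Lemma tail_sup_inc x y : (unit_ext U x <= unit_ext U y)%R ->
  (unit_ext U x)%:E * tail_sup x <= (unit_ext U y)%:E * tail_sup y.
Proof.
move=> xy; rewrite -lee_pdivlMl//; apply: endm_le => t t0.
rewrite lee_pdivlMl//; apply: (@le_trans _ _ ((unit_ext U y)%:E * ((c t y)%:E * E t))).
  rewrite !muleA -!EFinM; apply: lee_wpmul2r; first exact/ltW/E_gt0.
  rewrite lee_fin /c !minr_pMr ?(ltW (a0 _))// !mulr1.
  rewrite !(mulrC (unit_ext U _)) -/a !divfK ?gt_eqF//.
  by rewrite le_min !ge_min xy lexx orbT.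
by apply: lee_wpmul2l; [rewrite lee_fin ltW|exact: endm_ub].
Qed.

(** On the half-line monotonicity makes the superlevel sets intervals; elsewhere the function is
    constant because [unit_ext] is. *)
Lemma measurable_tail_sup : measurable_fun setT tail_sup.
Proof.
have -> : tail_sup = on_pos tail_sup (tail_sup 0%R).
  apply/funext => x; rewrite /on_pos; case: ifPn => // x0.
  by rewrite /tail_sup /unit_ext /on_pos (negbTE x0) ltxx.
apply: measurable_on_pos.
move=> mD; apply: (measurability _ (ErealGenOInfty.measurableE R)) => //.
move=> _ [_ [y ->] <-]; apply: is_interval_measurable => s t /=.
rewrite !in_itv/= !andbT => -[s0 ys] [t0 yt] u /andP[su ut].
have u0 : (0 < u)%R by exact: lt_le_trans su.
split; first by rewrite in_itv/= u0.
rewrite in_itv/= andbT (lt_le_trans yt)// tail_sup_dec// !unit_extE//.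
by apply: (admissible_le adm) => //; exact: ltW.
Qed.

Let point_below x th : (0 < x)%R -> (0 < th < 1)%R ->
  exists2 t, (0 < t < x)%R & U t = (th * U x)%R.
Proof.
move=> x0 /andP[th0 th1]; have Ux := admissible_gt0 adm x0.
have thU : (0 < th * U x < U x)%R by rewrite mulr_gt0//= gtr_pMl.
have [t tx Ut] : exists2 t, t \in `[0%R, x] & U t = (th * U x)%R.
  apply: IVT; first exact: ltW.
    case: adm => cU _ _ _; apply: continuous_subspaceW cU => z /=.
    by rewrite !in_itv/= => /andP[->].
  have [_ _ U0 _] := adm; rewrite U0; case/andP: thU => /ltW h1 /ltW h2.
  by rewrite ge_min le_max h1 h2 orbT.
exists t => //; move: tx; rewrite in_itv/= !le_eqVlt.
move=> /andP[/predU1P[t0|->] /predU1P[tx|->]] //; move: Ut thU.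
- by have [_ _ U0 _] := adm; rewrite -t0 U0 => <-; rewrite ltxx.
- by have [_ _ U0 _] := adm; rewrite -t0 U0 => <-; rewrite ltxx.
- by rewrite tx => <-; rewrite ltxx andbF.
Qed.

(* Letting t increase to x shows that restricting t to ]0, x[ does not change
   the supremum. *)
Lemma tail_sup_powE (x r : R) : (0 < x)%R -> (0 < r)%R ->
  npow (U x) r *
    ereal_sup [set (U t `^ r)%:E * ess_sup_on `]t, +oo[ (fun s => npow (U s * v s) r)
              | t in `]0%R, x[ ] = tail_sup x `^ r.
Proof.
move=> x0 r0; have Ux := admissible_gt0 adm x0.
have Er t : (0 < t)%R -> (U x `^ (- r))%:E * ((U t `^ r)%:E *
    ess_sup_on `]t, +oo[ (fun s => npow (U s * v s) r)) = ((U t / U x)%:E * E t) `^ r.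
  move=> t0; have Ut := admissible_gt0 adm t0.
  rewrite ess_sup_npow// muleA -EFinM poweRM ?lee_fin ?divr_ge0 ?(ltW Ut) ?(ltW Ux)//;
    last exact/ltW/E_gt0.
  by rewrite poweR_EFin (powRM (x := U t)) ?invr_ge0 ?(ltW Ut) ?(ltW Ux)// powRV ?(ltW
    Ux)// powRN mulrC.
rewrite npowE ?(ltW Ux)// gt_eqF// -ereal_sup_pZl ?powR_gt0//.
apply/eqP; rewrite eq_le; apply/andP; split.
- apply: ge_ereal_sup => _ [_ [t tx <-] <-]; move: tx; rewrite /= in_itv/= => /andP[t0 tx].
  have Ut := admissible_gt0 adm t0.
  rewrite Er//; apply: lee_poweR; [exact: ltW| |].
    by rewrite mule_ge0 ?(ltW (E_gt0 t0))// lee_fin divr_ge0// ltW.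
  apply: le_trans (endm_ub x t0); apply: lee_wpmul2r; first exact/ltW/E_gt0.
  rewrite lee_fin /c /a unit_extE// le_min lexx andbT ler_pdivrMr// mul1r.
  by apply: (admissible_le adm); exact: ltW.
set B := leRHS.
have EB t : (0 < t < x)%R -> (U t / U x)%:E * E t <= B `^ r^-1.
  move=> /andP[t0 tx]; have Ut := admissible_gt0 adm t0.
  rewrite -[leLHS](@poweRK _ _ r) ?gt_eqF//; last first.
    by rewrite mule_ge0 ?(ltW (E_gt0 t0))// lee_fin divr_ge0// ltW.
  apply: lee_poweR; [by rewrite invr_ge0 ltW|exact: poweR_ge0|].
  rewrite -Er//; apply: ereal_sup_ubound; eexists; last by [].
  by exists t => //; rewrite /= in_itv/= t0.
have B0 : 0 <= B.
  have h2 : (0 < (2^-1 : R))%R && ((2^-1 : R) < 1)%R by rewrite invr_gt0 invf_lt1 ?ltr0n ?ltr1n.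
  have [t tx _] := point_below x0 h2; case/andP: (tx) => t0 _.
  apply: (@le_trans _ _ (((U t / U x)%:E * E t) `^ r)); first exact: poweR_ge0.
  rewrite -Er//; apply: ereal_sup_ubound; eexists; last by [].
  by exists t => //; rewrite /= in_itv/= tx.
rewrite -[leRHS](@poweRVK _ _ r) ?gt_eqF//.
apply: lee_poweR; [exact: ltW|exact/ltW/tail_sup_gt0|].
apply: endm_le => t t0; have [tx|xt] := ltP t x.
  apply: le_trans (EB t _); last by rewrite t0.
  apply: lee_wpmul2r; first exact/ltW/E_gt0.
  by rewrite lee_fin /c /a unit_extE// ge_min lexx orbT.
apply: (@le_trans _ _ (E t)).
  rewrite -[leRHS]mul1e; apply: lee_wpmul2r; first exact/ltW/E_gt0.
  by rewrite lee_fin ge_min lexx.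
apply/lee_mul01Pr; first exact/ltW/E_gt0.
move=> th th01; have [t' tx' Ut'] := point_below x0 th01.
case/andP: (tx') => t'0 t'x.
apply: le_trans (EB _ tx'); rewrite Ut' mulfK ?gt_eqF//.
apply: lee_wpmul2l; first by case/andP: th01 => /ltW.
by apply: E_dec; rewrite (le_trans (ltW t'x)).
Qed.

(** An essential supremum is nearly attained on a set of positive measure: on B, 1 / (U v) exceeds
    ka = lam / c t y. The test function is ka U times a truncated indicator of B, divided by the
    mass of the latter; ka U v < 1 on B gives the norm bound. *)
Lemma tail_sup_test : stieltjes_test_family (T := measurableTypeR R) muD a (zero_ext v) 1
  tail_sup.
Proof.
move=> y lam lam0 /ereal_sup_gt[_ [t /= + <-]]; rewrite in_itv/= andbT => t0.
rewrite -/(c t y) -/phi -/(E t) => lamE.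
have ct := c_gt0 y t0; pose ka := (lam / c t y)%R.
have ka0 : (0 < ka)%R by rewrite divr_gt0.
have kaE : ka%:E < E t by rewrite /ka mulrC EFinM lte_pdivrMl.
pose B := [set s : R | (t < s)%R && (ka * unit_ext U s * zero_ext v s < 1)%R].
have mB : measurable B.
  have -> : B = `]t, +oo[%classic `&` [set s | (ka * unit_ext U s * zero_ext v s < 1)%R].
    by apply/seteqP; split => s /=; rewrite in_itv/= andbT => /andP.
  apply: measurableI; first exact: measurable_itv.
  rewrite [X in measurable X](_ : _ = ~` [set s | (1 <= ka * unit_ext U s * zero_ext v
    s)%R]); last first.
    by apply/seteqP; split => s /=; rewrite ltNge => /negP.
  apply: measurableC; apply: measurable_geset.
  by apply: measurable_funM => //; apply: measurable_funM.
have BD : B `<=` D by move=> s /= /andP[ts _]; rewrite in_itv/= andbT (lt_trans t0).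
have muB : 0 < muD B.
  rewrite lt0e measure_ge0 andbT muDE// (setIidr BD); apply/eqP => B0.
  move: kaE; rewrite ltNge => /negP; apply; apply/ess_sup_onP.
  exists B; split => // s /= /not_implyP[]; rewrite in_itv/= andbT => ts /negP.
  have s0 := lt_trans t0 ts; rewrite -ltNge /phi npowE ?Uv0// => hp.
  rewrite /B/= ts/=; move: hp.
  have [Uv|Uv] := eqVneq (U s * v s)%R 0%R.
    by rewrite -mulrA /unit_ext /zero_ext /on_pos s0 Uv mulr0 ltr01.
  have Uvp : (0 < U s * v s)%R by rewrite lt0r Uv Uv0.
  rewrite powR_inv1 ?Uv0// lte_fin => h.
  by rewrite -mulrA /unit_ext /zero_ext /on_pos s0 -ltr_pdivlMr// mul1r.
have iB : 0 < \int[muD]_s (\1_B s)%:E by rewrite integral_indic// setIT.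
have [g [mg g0 gB g1 gfin]] := integral_truncation (mu := muD)
   (f := fun s => (\1_B s)%:E) (ltac:(by apply/measurable_EFinP; exact: measurable_indic)) 
   (fun s => ltac:(by rewrite lee_fin)) iB.
pose G := fine (\int[muD]_s (g s)%:E).
have GE : \int[muD]_s (g s)%:E = G%:E.
  by rewrite fineK// ge0_fin_numE// integral_ge0// => s _; rewrite lee_fin.
have G0 : (0 < G)%R by rewrite -lte_fin -GE.
pose h s : R := (G^-1 * (ka * unit_ext U s * g s))%R.
have h0 s : (0 <= h s)%R.
  rewrite /h mulr_ge0 ?invr_ge0 ?(ltW G0)//.
  by apply: mulr_ge0; [apply: mulr_ge0; exact: ltW|exact: g0].
have mh : measurable_fun setT h.
  by apply: measurable_funM => //; apply: measurable_funM => //; apply: measurable_funM.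
have gnB s : ~ B s -> g s = 0%R.
  move=> nB; apply/eqP; rewrite eq_le g0 andbT -lee_fin (le_trans (gB s))//.
  by rewrite indicE memNset.
have mgE : measurable_fun setT (fun s => (g s)%:E) by exact/measurable_EFinP.
exists (EFin \o h); split.
- exact/measurable_EFinP.
- by move=> s; rewrite lee_fin.
- have -> : 1 = \int[muD]_s ((G^-1)%:E * (g s)%:E).
    rewrite ge0_integralZl_EFin ?invr_ge0 ?(ltW G0)//; last first.
      by move=> s _; rewrite lee_fin.
    by rewrite GE -EFinM mulVf// gt_eqF.
  apply: ge0_integralT_le.
  - apply: emeasurable_funM; last exact/measurable_EFinP.
    by apply: measurable_funP_poweR; exact/measurable_EFinP.
  - by apply: emeasurable_funM.
  - by move=> s; rewrite mule_ge0 ?poweR_ge0// lee_fin.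
  move=> s; rewrite /= (powRr1 (h0 s)) -!EFinM lee_fin /h.
  rewrite [leLHS](_ : _ = G^-1 * (ka * unit_ext U s * zero_ext v s * g s))%R; last by ring.
  apply: ler_wpM2l; first by rewrite invr_ge0 ltW.
  have [Bs|/gnB ->] := pselect (B s); last by rewrite mulr0.
  apply: ler_piMl => //.
  by case/andP: Bs => _ /ltW.
- move=> x.
  have -> : (lam * (a y / (a x + a y)))%:E =
      (G^-1 * (lam * (a y / (a x + a y))))%:E * \int[muD]_s (g s)%:E.
    by rewrite GE -EFinM mulrAC mulVf ?mul1r// gt_eqF.
  have c0 : (0 <= G^-1 * (lam * (a y / (a x + a y))))%R.
    by rewrite !mulr_ge0 ?invr_ge0 ?addr_ge0 ?(ltW G0) ?(ltW lam0) ?(ltW (a0 _)).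
  rewrite -ge0_integralZl_EFin//; last first.
    by move=> s _; rewrite lee_fin.
  apply: ge0_integralT_le.
  - by apply: emeasurable_funM.
  - by apply: measurable_stieltjes_op_integrand => //; exact/measurable_EFinP.
  - by move=> s; rewrite mule_ge0// lee_fin.
  move=> s; rewrite -!EFinM lee_fin /h.
  have [Bs|/gnB ->] := pselect (B s); last by rewrite !mulr0 mul0r.
  case/andP: Bs => ts _; have s0 := lt_trans t0 ts.
  have Uts : (U t <= unit_ext U s)%R by rewrite unit_extE// (admissible_le adm)// ltW.
  have Ut := admissible_gt0 adm t0.
  (* U s / (a x + U s) only decreases if U s is lowered to U t; the rest follows from c t y * a y =
     min(a y, U t). *)
  have key : (c t y * (a y / (a x + a y)) <= a s / (a x + a s))%R.
    apply: (@le_trans _ _ (U t / (a x + U t))%R); last first.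
      rewrite ler_pdivrMr ?addr_gt0// mulrAC ler_pdivlMr ?addr_gt0//.
      by rewrite !mulrDr (mulrC (U t) (unit_ext U s)) lerD2r ler_wpM2r// ltW.
    rewrite mulrA ler_pdivrMr ?addr_gt0// mulrAC ler_pdivlMr ?addr_gt0//.
    rewrite /c; have [h1|h1] := leP 1%R (U t / a y)%R.
      rewrite mul1r; move: h1; rewrite ler_pdivlMr// mul1r => h1.
      by rewrite !mulrDr (mulrC (U t) (a y)) lerD2r ler_wpM2r// ltW.
    rewrite divfK ?gt_eqF//; apply: ler_wpM2l; first exact: ltW.
    by rewrite lerD2l; move: h1; rewrite ltr_pdivrMr// mul1r => /ltW.
  have -> : lam = (ka * c t y)%R by rewrite /ka divfK// gt_eqF.
  rewrite [leRHS](_ : _ = G^-1 * (ka * (a s / (a x + a s)) * g s))%R; last by rewrite /a; ring.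
  rewrite -(mulrA G^-1)%R; apply: ler_wpM2l; first by rewrite invr_ge0 ltW.
  by apply: ler_wpM2r => //; rewrite -mulrA; apply: ler_wpM2l => //; exact: ltW.
Qed.

(** For almost every [x], 1 / (U x v x) is at most the essential supremum beyond any rational t < x.
    A rational between [x] and the point where U equals U x / 2 costs the factor 2. *)
Lemma tail_sup_ae (mr : R -> R) : (forall x, tail_sup x = (mr x)%:E) ->
  {ae (muD : set (measurableTypeR R) -> \bar R), forall x, (1 <= zero_ext v x * (unit_ext U
    x * (2 * mr x)))%R}.
Proof.
move=> mE; apply: ae_muD.
(* Only rational [t], so that the exceptional null sets form a countable union; codes of no rational
   give 0, which the positivity condition excludes. *)
pose tn (n : nat) : R := if unpickle n is Some z then ratr (z : rat) else 0%R.
have : {ae leb, forall x (n : nat), (0 < tn n)%R -> x \in `]tn n, +oo[ -> phi x <= E (tn n)}.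
  apply: ae_foralln => n; have /ess_sup_onP := lexx (E (tn n)).
  by apply: ae_imply => x h _.
apply: ae_imply => x h x0; have Ux := admissible_gt0 adm x0.
have h2 : (0 < (2^-1 : R))%R && ((2^-1 : R) < 1)%R by rewrite invr_gt0 invf_lt1 ?ltr0n ?ltr1n.
have [t /andP[t0 tx] Ut] := point_below x0 h2.
have [z] := rat_in_itvoo tx; rewrite in_itv/= => /andP[tz zx].
have z0 := lt_trans t0 tz.
have := h (pickle z); rewrite /tn pickleK => /(_ z0); rewrite in_itv/= zx => /(_ isT) hx.
have : (2^-1)%:E * phi x <= (mr x)%:E.
  rewrite -mE; apply: le_trans (endm_ub x z0); apply: lee_pmul => //.
  - by apply/ltW/npow_gt0.
  rewrite lee_fin /c le_min /a unit_extE//; apply/andP; split; first by lra.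
  by rewrite ler_pdivlMr// -Ut (admissible_le adm)// ltW.
rewrite /phi npowE ?Uv0//; have [Uv|Uv] := eqVneq (U x * v x)%R 0%R.
  by rewrite gt0_muley// lte_fin; lra.
have Uvp : (0 < U x * v x)%R by rewrite lt0r Uv Uv0.
rewrite powR_inv1 ?Uv0// lee_fin => hm; rewrite /zero_ext /unit_ext /on_pos x0.
have : (2^-1 * (U x * v x)^-1 * (U x * v x) <= mr x * (U x * v x))%R by rewrite ler_wpM2r ?Uv0.
by rewrite -mulrA mulVf// => hh; lra.
Qed.

Lemma criterion_tail_sup : criterion U v 1 1 tail_sup.
Proof.
split.
- exact: tail_sup_gt0.
- exact: tail_sup_dec.
- exact: tail_sup_inc.
- by move=> mr mE; apply/measurable_EFinP; rewrite (_ : EFin \o mr = tail_sup)//;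
  [exact: measurable_tail_sup|apply/funext => x; rewrite mE].
- exact: tail_sup_test.
move=> mr mE; have ae := tail_sup_ae mE.
have mr0 x : (0 < mr x)%R by rewrite -lte_fin -mE tail_sup_gt0.
split; apply: (hardy_bound1 (T := measurableTypeR R)).
- exact: ma.
- apply: measurable_funM => //; apply: (measurableT_comp (measurable_powR _)); exact: ma.
- by move=> x; rewrite mulr_ge0 ?powR_ge0.
- by move=> x; rewrite mulr_gt0 ?powR_gt0.
- by apply: ae_imply ae => x; rewrite !powRr1 ?(ltW (a0 x)) ?(ltW (mr0 x))// mulrA.
- exact: measurableT_comp.
- exact: mv.
- exact: vge0.
- by move=> x; rewrite mulr_gt0 ?powR_gt0// mulr_gt0.
- apply: ae_imply ae => x; rewrite !powRr1 ?mulr_ge0 ?(ltW (a0 x)) ?(ltW (mr0 x))//.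
  by rewrite [(unit_ext U x * (2 * _))%R]mulrCA.
Qed.

End endpoint_weight.

(** * The quantities S1 and S2 *)

Section endpoint_case.
Context {R : realType}.
Local Notation leb := (@lebesgue_measure R).
Local Notation D := (`]0%R, +oo[%classic : set R).
Variables (U v w : R -> R) (q : R).
Hypotheses (adm : admissible U) (wv : weight v) (ww : weight w) (q0 : (0 < q)%R).

Let a := unit_ext U.
Let ma := measurable_unit_ext adm.
Let a0 := unit_ext_gt0 adm.
Let m := tail_sup U v.

Lemma S1_characterized : nondegenerate_wrt U w q -> (1 <= q)%R ->
  characterized_by (equiv_const_pq 1 q 1) 1%:E q%:E U v w (S1 U v w q).
Proof.
move=> nd q1.
have termE x : (0 < x)%R -> Wint U w q x `^ q^-1 * npow (U x) 1 *
    ereal_sup [set (U t)%:E * ess_sup_on `]t, +oo[ (fun s => npow (U s * v s) 1)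
              | t in `]0%R, x[ ] = Phi (nuD ww) a q x `^ q^-1 * m x.
  move=> x0; rewrite (WintE q adm ww x0) -muleA; congr (_ * _).
  rewrite -[m x]poweRe1 ?(ltW (tail_sup_gt0 adm wv x))// -(tail_sup_powE adm wv x0 ltr01);
    congr (_ * ereal_sup _).
  apply: eq_imagel => t /=; rewrite in_itv/= => /andP[t0 _].
  by rewrite powRr1// ltW// (admissible_gt0 adm).
have S0 : 0 <= S1 U v w q.
  apply: (@le_trans _ _ (Phi (nuD ww) a q 1%R `^ q^-1 * m 1%R)).
    by rewrite mule_ge0 ?poweR_ge0// ltW// (tail_sup_gt0 adm wv).
  by rewrite -termE//; apply: ereal_sup_ubound; exists 1%R => //=; rewrite in_itv/= ltr01.
apply: (characterized_pq (ww := ww) adm wv ltr01 q0 ltr01 nd (criterion_tail_sup adm wv) q1 S0).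
- move=> B hB; apply: ge_ereal_sup => _ [x /= + <-]; rewrite in_itv/= andbT => x0.
  by rewrite termE// hB.
move=> x x0; apply: (@le_trans _ _ (S1 U v w q)).
  by rewrite -termE//; apply: ereal_sup_ubound; exists x => //=; rewrite in_itv/= x0.
by rewrite -[leLHS]mul1e; apply: lee_wpmul2r => //; rewrite lee_fin ler1n.
Qed.

Lemma S2_characterized : nondegenerate_wrt U w q -> (q < 1)%R ->
  characterized_by (equiv_const_qp 1 q 1) 1%:E q%:E U v w (S2 U v w q).
Proof.
move=> nd q1; have pq0 : (0 < 1 - q)%R by rewrite subr_gt0.
have rE : (1 * q / (1 - q) = qstar q)%R by rewrite mul1r.
have r0 : (0 < qstar q)%R by rewrite divr_gt0.
have SE : S2 U v w q `^ qstar q =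
    \int[nuD ww]_x (Phi (nuD ww) a q x `^ (q / (1 - q)) * m x `^ (qstar q)).
  rewrite integral_nuD; first last.
  - by move=> x; rewrite mule_ge0 ?poweR_ge0.
  - apply: emeasurable_funM; apply: measurable_funP_poweR;
    last exact: (measurable_tail_sup adm wv).
    exact: (measurable_Phi (nuD ww) q ma a0).
  have termE x : (0 < x)%R -> Wint U w q x `^ qstar q * npow (U x) (qstar q) *
      ereal_sup [set (U t `^ qstar q)%:E * ess_sup_on `]t, +oo[ (fun s => npow (U s * v s)
        (qstar q))
              | t in `]0%R, x[ ] = Phi (nuD ww) a q x `^ (qstar q) * m x `^ (qstar q).
    move=> x0; rewrite (WintE q adm ww x0) -muleA; congr (_ * _).
    exact: (tail_sup_powE adm wv x0 r0).
  rewrite /S2 poweRVK ?gt_eqF//; last first.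
    apply: integral_ge0 => x; rewrite /= in_itv/= andbT => x0.
    by rewrite termE// mule_ge0 ?lee_fin ?(weight_ge0 ww)// mule_ge0 ?poweR_ge0.
  by apply: eq_integral => x; rewrite half_lineE => x0; rewrite termE.
have S0 : 0 <= S2 U v w q by exact: poweR_ge0.
apply: (characterized_qp (ww := ww) adm wv ltr01 q0 ltr01 nd (criterion_tail_sup adm wv) q1 S0).
- by rewrite rE SE.
- rewrite rE -SE -[leLHS]mul1e; apply: lee_wpmul2r; first exact: poweR_ge0.
  rewrite lee_fin [leLHS](_ : _ = (1 `^ qstar q)%R); last by rewrite powR1.
  by rewrite ge0_ler_powR ?nnegrE// ?(ltW r0)// ler1n.
Qed.

End endpoint_case.

(** * The case p = oo *)

Section sup_norm_case.
Context {R : realType}.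
Local Notation leb := (@lebesgue_measure R).
Local Notation D := (`]0%R, +oo[%classic : set R).
Variables (U v w : R -> R) (q : R).
Hypotheses (adm : admissible U) (wv : weight v) (ww : weight w) (q0 : (0 < q)%R).

Let a := unit_ext U.
Let ma := measurable_unit_ext adm.
Let a0 := unit_ext_gt0 adm.
Let mv := measurable_zero_ext wv.
(** The inverse in the extended reals is +oo where [v] vanishes, where a bound on the norm of [h]
    does not restrict [h]. *)
Let h0 (t : R) : \bar R := (v t)%:E^-1.

Let h0E t : h0 t = if v t == 0%R then +oo else ((v t)^-1)%:E.
Proof. by rewrite /h0 inver. Qed.

Let h0M : Mplus h0.
Proof.
split=> [|t t0]; last first.
  by rewrite h0E; case: eqP => // _; rewrite lee_fin invr_ge0 (weight_ge0 wv).
apply: (eq_measurable_fun (fun t => if zero_ext v t == 0%R then +oo else (zero_ext v t `^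
  (- 1))%:E)).
  move=> t; rewrite half_lineE h0E /zero_ext /on_pos => t0; rewrite t0.
  by rewrite powR_inv1// (weight_ge0 wv).
apply: measurable_funTS; apply: measurable_fun_ifT => //; last exact: measurable_EFin_powR.
exact: measurable_fun_eqr.
Qed.

Lemma S5E : S5 U v w q = wnorm q%:E w (stieltjes U h0).
Proof.
rewrite /S5 /wnorm; congr (_ `^ _); apply: eq_integral => x; rewrite half_lineE => x0.
have Ux := admissible_gt0 adm x0.
have -> : stieltjes U h0 x = \int[leb]_(t in `]0%R, +oo[)
    ((kernelU U t x)%:E * npow (U t) 1 / (v t)%:E).
  apply: eq_integral => t; rewrite half_lineE => t0.
  have Ut := admissible_gt0 adm t0.
  rewrite inver gt_eqF ?addr_gt0// npowE ?(ltW Ut)// gt_eqF// powR_inv1 ?(ltW Ut)//.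
  by rewrite -EFinM /kernelU mulrAC divff ?gt_eqF// mul1r muleC.
rewrite gee0_abs//; apply: integral_ge0 => t; rewrite /= in_itv/= andbT => t0.
have Ut := admissible_gt0 adm t0.
rewrite mule_ge0//; last by case: h0M => _; exact.
by rewrite mule_ge0 ?poweR_ge0// lee_fin divr_ge0 ?addr_ge0// ltW.
Qed.

Lemma sup_norm_ge0 h : Mplus h -> 0 <= wnorm +oo v h.
Proof.
move=> [_ hp]; rewrite leNgt; apply/negP => n0.
have : wnorm +oo v h < wnorm +oo v h; last by rewrite ltxx.
apply: ess_sup_tail_gt => s s0; apply: (lt_le_trans n0).
by rewrite mule_ge0// lee_fin (weight_ge0 wv).
Qed.

Lemma wnorm_inv_le1 : wnorm +oo v h0 <= 1.
Proof.
apply/ess_sup_onP; exists set0; split => // s /= /not_implyP[].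
rewrite in_itv/= andbT => s0 []; rewrite gee0_abs; last by case: h0M => _; exact.
rewrite h0E; have [->|vs] := eqVneq (v s) 0%R; first by rewrite mule0.
by rewrite -EFinM mulVf.
Qed.

(* The inequality fails in general for n = 0: v may vanish on a set of positive
   measure. *)
Lemma wnorm_stieltjes_le h (n : R) : Mplus h -> (0 < n)%R -> wnorm +oo v h <= n%:E ->
  wnorm q%:E w (stieltjes U h) <= n%:E * wnorm q%:E w (stieltjes U h0).
Proof.
move=> hM n0 hn; rewrite !(wnorm_stieltjesE q adm ww)//.
have mon g : Mplus g -> measurable_fun setT (on_pos g 0).
  by case=> mg _; exact: measurable_on_pos.
have pon g : Mplus g -> forall x, 0 <= on_pos g 0 x.
  by move=> gM x; rewrite /on_pos; case: ifP => // x0; case: gM => _; exact.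
have ms g : Mplus g -> measurable_fun setT (stieltjes_op muD a (on_pos g 0)).
  by move=> gM; apply: measurable_stieltjes_op; [exact: ma|exact: a0|exact: mon|exact: pon].
have mi g x : Mplus g -> measurable_fun setT (fun t => on_pos g 0 t * ((a x + a t)^-1)%:E).
  by move=> gM; apply: measurable_stieltjes_op_integrand; [exact: ma|exact: a0|exact: mon].
have pi g x t : Mplus g -> 0 <= on_pos g 0 t * ((a x + a t)^-1)%:E.
  by move=> gM; rewrite mule_ge0 ?pon// lee_fin invr_ge0 addr_ge0// ltW.
have sp g x : Mplus g -> 0 <= stieltjes_op muD a (on_pos g 0) x.
  by move=> gM; apply: integral_ge0 => t _; exact: pi.
have aeh : {ae (muD : set (measurableTypeR R) -> \bar R), forall t, on_pos h 0 t <= n%:E *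
  on_pos h0 0 t}.
  apply: ae_muD; move/ess_sup_onP: hn; apply: ae_imply => t + t0.
  rewrite in_itv/= t0 => /(_ isT); rewrite gee0_abs; last by case: hM => _; exact.
  rewrite /on_pos t0 h0E; have [->|vt] := eqVneq (v t) 0%R.
    by rewrite gt0_muley ?leey.
  by rewrite lee_pdivlMr// lt0r vt (weight_ge0 wv).
have sle x : stieltjes_op muD a (on_pos h 0) x <= n%:E * stieltjes_op muD a (on_pos h0 0) x.
  rewrite /stieltjes_op -ge0_integralZl_EFin ?(ltW n0)//; [|by move=> t _; exact: pi|exact: mi].
  apply: ae_ge0_le_integral => //.
  - by move=> t _; exact: pi.
  - exact: mi.
  - by move=> t _; rewrite mule_ge0 ?pi// lee_fin ltW.
  - by apply: measurable_funeM; exact: mi.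
  apply: ae_imply aeh => t ht _; rewrite muleA; apply: lee_wpmul2r => //.
  by rewrite lee_fin invr_ge0 addr_ge0// ltW.
rewrite -[n%:E in leRHS](@poweRK _ _ q) ?gt_eqF//; last by rewrite lee_fin ltW.
rewrite -poweRM ?poweR_ge0//; last by apply: integral_ge0 => x _; exact: poweR_ge0.
apply: lee_poweR; first by rewrite invr_ge0 ltW.
  by apply: integral_ge0 => x _; exact: poweR_ge0.
rewrite poweR_EFin -ge0_integralZl_EFin ?powR_ge0//; last 2 first.
- by move=> x _; exact: poweR_ge0.
- by apply: measurable_funP_poweR; exact: ms.
apply: ge0_integralT_le.
- by apply: measurable_funP_poweR; exact: ms.
- by apply: measurable_funeM; apply: measurable_funP_poweR; exact: ms.
- by move=> x; exact: poweR_ge0.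
move=> x; rewrite -poweR_EFin -poweRM ?lee_fin ?(ltW n0)// ?sp//.
by apply: lee_poweR; [exact: ltW|exact: sp|exact: sle].
Qed.

(** The constant is 1: by [S5E] the quantity is the left-hand side at 1 / v, whose norm is at most
    1, and conversely a norm bound n > 0 puts [h] below n / v almost everywhere. *)
Lemma S5_characterized : characterized_by 1 +oo q%:E U v w (S5 U v w q).
Proof.
apply: characterized_byI => //.
- exact: poweR_ge0.
- move=> c [c0 hc]; rewrite mul1e S5E; apply: (le_trans (hc _ h0M)).
  rewrite -[leRHS]mule1; apply: lee_wpmul2l => //; exact: wnorm_inv_le1.
move=> c c0; rewrite mul1e => Sc; split; first exact: ltW.
move=> h hM; have := sup_norm_ge0 hM.
case nE: (wnorm +oo v h) => [n||]//; last first.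
  by rewrite gt0_muley ?leey.
(* [n] may be 0, which [wnorm_stieltjes_le] excludes. The perturbation e / c becomes e after
   multiplication by c. *)
rewrite lee_fin => n0;  apply/lee_addgt0Pr => e e0.
have ne : (0 < n + e / c)%R by rewrite ltr_wpDl// divr_gt0.
have hne : wnorm +oo v h <= (n + e / c)%:E.
  by rewrite nE lee_fin lerDl divr_ge0// ltW.
apply: (le_trans (wnorm_stieltjes_le hM ne hne)).
rewrite -S5E; apply: (@le_trans _ _ ((n + e / c)%:E * c%:E)).
  by apply: lee_wpmul2l => //; rewrite lee_fin ltW.
by rewrite -EFinM -EFinM -EFinD lee_fin mulrDl divfK ?gt_eqF// mulrC.
Qed.

End sup_norm_case.

(** * Assembly of the five cases, with the constant fixed before the weights *)

Theorem theorem5p6 (R : realType) (p q : \bar R) (p_gt0 : 0 < p) (q_gt0 : 0 < q) :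
  exists2 lam : R, (0 < lam)%R & forall u v w : R -> R,
    weight u -> weight v -> weight w ->
    (forall t : R, (0 < t)%R -> (0 < primitive u t)%R) ->
    admissible (primitive u) ->
    nondegenerate_wrt (primitive u) w (fine q) ->
    [/\ p = 1 -> 1 <= q -> q < +oo ->
          characterized_by lam p q (primitive u) v w
            (S1 (primitive u) v w (fine q)),
        p = 1 -> 0 < q -> q < 1 ->
          characterized_by lam p q (primitive u) v w
            (S2 (primitive u) v w (fine q)),
        1 < p -> p <= q -> q < +oo ->
          characterized_by lam p q (primitive u) v w
            (S3 (primitive u) v w (fine p) (fine q)),
        1 < p -> p < +oo -> 0 < q -> q < p ->
          characterized_by lam p q (primitive u) v w
            (S4 (primitive u) v w (fine p) (fine q)) &
        p = +oo -> 0 < q -> q < +oo ->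
          characterized_by lam p q (primitive u) v w
            (S5 (primitive u) v w (fine q))].
Proof.
case: q q_gt0 => [q||]// q0; last first.
  (* For q = +oo every case is vacuous. *)
  exists 1%R => // u v w _ _ _ _ _ _; split=> //; rewrite ?ltxx//.
  by move=> _ py _; rewrite ltNge leey.
case: p p_gt0 => [p||]// p0; last first.
  exists 1%R => // u v w _ wv ww _ adm _; split=> //.
  by move=> _ _ _; exact: S5_characterized adm wv ww q0.
rewrite !lte_fin in p0 q0.
(* The Hardy constant is 1 for p = 1. Values p < 1 meet no case, and p <= q separates (i) and (iii)
   from (ii) and (iv). *)
pose C : R := if p == 1%R then 1%R else hardy_pp_const p.
exists (if (p <= q)%R then equiv_const_pq p q C else equiv_const_qp p q C).
  by case: ifP => _; [exact: equiv_const_pq_gt0|exact: equiv_const_qp_gt0].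
move=> u v w _ wv ww _ adm nd; split => //.
- by move=> [p1]; rewrite lee_fin /C p1 => q1 _; rewrite q1 eqxx; exact: S1_characterized.
- move=> [p1] _; rewrite lte_fin /C p1 => q1; rewrite leNgt q1 eqxx/=.
  exact: (S2_characterized adm wv ww q0 nd q1).
- rewrite lte_fin lee_fin /C => p1 pq _; rewrite pq gt_eqF//.
  exact: S3_characterized.
rewrite !lte_fin /C => p1 _ _ qp; rewrite leNgt qp/= gt_eqF//.
exact: S4_characterized.
Qed.
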